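(* Let $d\ge2$, $k\in\mathbb{R}$ and let $a(x,\xi)$ be a function on $\mathbb{R}^{d-1}\times\mathbb{R}^{d-1}$, smooth with respect to the variable $\xi$, satisfying $$|\partial_\xi^\alpha a(x,\xi)|\le C_\alpha\langle\xi\rangle^{k-|\alpha|}$$ for all multi-indices $\alpha$. Let $k'>k$. Then $$\|\mathrm{Op}_h(a)\|_{H_h^{k'}\to L^2}\lesssim\log(1+h^{-1})\sum_{|\alpha|\le d}C_\alpha .$$
   Context: Here $0<h\le1$ is a semiclassical parameter and $\langle\xi\rangle=(1+|\xi|^2)^{1/2}$. For a symbol $a(x,\xi)$ on $\mathbb{R}^{d-1}\times\mathbb{R}^{d-1}$, $$(\mathrm{Op}_h(a)f)(x)=(2\pi h)^{-d+1}\int_{\mathbb{R}^{d-1}}\int_{\mathbb{R}^{d-1}}e^{-\frac ih\langle x-y,\xi\rangle}a(x,\xi)f(y)\,d\xi\,dy .$$ $L^2=L^2(\mathbb{R}^{d-1})$, and $H_h^k=H_h^k(\mathbb{R}^{d-1})$ is the Sobolev space with the semiclassical norm $\|u\|_{H_h^k}=\|\mathrm{Op}_h(\langle\xi\rangle^k)u\|_{L^2}$. $A\lesssim B$ means $A\le CB$ with a constant $C>0$ independent of $h$, of the symbol $a$ and of the constants $C_\alpha$ (it may depend on $d,k,k'$). *)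

(* Defs.v *)
From HB Require Import structures.
From mathcomp Require Import all_boot all_order all_algebra.
From mathcomp Require Import all_classical all_reals all_analysis.
From mathcomp Require Import complex.

Set Implicit Arguments.
Unset Strict Implicit.
Unset Printing Implicit Defensive.

Import Order.TTheory GRing.Theory Num.Theory.
Import numFieldNormedType.Exports.
Import ComplexField.Normc.

Local Open Scope classical_set_scope.
Local Open Scope ring_scope.
Local Open Scope complex_scope.

Section rV_measurable.
Variables (R : realType) (n : nat).

Let coord (i : 'I_n) (x : 'rV[R]_n) : R := x ord0 i.

Let rV_set0 : g_sigma_preimage coord set0.
Proof. exact: sigma_algebra0. Qed.

Let rV_setC A : g_sigma_preimage coord A -> g_sigma_preimage coord (~` A).
Proof. exact: sigma_algebraC. Qed.

Let rV_bigcup (F : _^nat) : (forall i, g_sigma_preimage coord (F i)) ->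
  g_sigma_preimage coord (\bigcup_i (F i)).
Proof. exact: sigma_algebra_bigcup. Qed.

HB.instance Definition _ := @isMeasurable.Build
  default_measure_display 'rV[R]_n
  (g_sigma_preimage coord) rV_set0 rV_setC rV_bigcup.

Lemma measurable_rV_coord i :
  measurable_fun [set: 'rV[R]_n] (fun x => x ord0 i).
Proof.
move=> _ Y mY; rewrite setTI; apply: sub_sigma_algebra => /=.
rewrite -bigcup_seq/=; exists i => /=; first by rewrite mem_index_enum.
by exists Y => //; rewrite setTI.
Qed.

Lemma measurable_fun_rVP d (T : measurableType d) (f : T -> 'rV[R]_n) :
  (forall i, measurable_fun setT (fun t => f t ord0 i)) ->
  measurable_fun setT f.
Proof.
move=> mf; apply: (measurability
  (\big[setU/set0]_(i < n) preimage_set_system setT (coord i) measurable)) => //.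
move=> _ [B + <-]; rewrite -bigcup_seq => -[i _ [C mC <-]].
by rewrite setTI -comp_preimage; exact: mf.
Qed.

End rV_measurable.

Section lebesgue_rV.
Variable R : realType.

Definition cons_rV n (p : measurableTypeR R * 'rV[R]_n) : 'rV[R]_n.+1 :=
  row_mx (p.1 : R)%:M p.2.

Lemma cons_rV0 n (p : measurableTypeR R * 'rV[R]_n) : cons_rV p ord0 ord0 = p.1.
Proof.
rewrite /cons_rV mxE; case: splitP => // j _.
by rewrite (ord1 j) mxE mulr1n.
Qed.

Lemma cons_rVS n (p : measurableTypeR R * 'rV[R]_n) (i : 'I_n) :
  cons_rV p ord0 (lift ord0 i) = p.2 ord0 i.
Proof.
rewrite /cons_rV mxE; case: splitP => [j|j] /=; first by rewrite ord1.
by rewrite /bump leq0n !add1n => -[ij]; congr (p.2 _ _); apply/val_inj.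
Qed.

Lemma measurable_cons_rV n : measurable_fun setT (@cons_rV n).
Proof.
apply: measurable_fun_rVP => i; case: (unliftP ord0 i) => [j ->|->].
  rewrite (_ : (fun t => _) = (fun x : 'rV[R]_n => x ord0 j) \o snd); last first.
    by apply/funext => p; rewrite cons_rVS.
  by apply: measurableT_comp; [exact: measurable_rV_coord | exact: measurable_snd].
rewrite (_ : (fun t => _) = fst); last by apply/funext => p; rewrite cons_rV0.
exact: measurable_fst.
Qed.

Definition uncons_rV n (x : 'rV[R]_n.+1) : measurableTypeR R * 'rV[R]_n :=
  (x ord0 ord0, \row_j x ord0 (lift ord0 j)).

Lemma cons_rVK n : cancel (@cons_rV n) (@uncons_rV n).
Proof.
move=> p; rewrite /uncons_rV cons_rV0 [RHS]surjective_pairing; congr pair.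
by apply/rowP => j; rewrite mxE cons_rVS.
Qed.

Lemma measurable_uncons_rV n : measurable_fun setT (@uncons_rV n).
Proof.
apply/measurable_fun_pairP; split; first exact: measurable_rV_coord.
apply: measurable_fun_rVP => i.
rewrite (_ : (fun t => _) = (fun x : 'rV[R]_n.+1 => x ord0 (lift ord0 i))).
  exact: measurable_rV_coord.
by apply/funext => x; rewrite mxE.
Qed.

Section step.
Variables (n : nat) (m : {sigma_finite_measure set 'rV[R]_n -> \bar R}).

Definition lebesgue_rVS : set 'rV[R]_n.+1 -> \bar R :=
  pushforward (lebesgue_measure \x m)%E (@cons_rV n).


HB.instance Definition _ := Measure.copy lebesgue_rVS
  (@measure_function_pushforward__canonical__measure_function_Measure
    _ _ _ _ _ _ _ (@measurable_cons_rV n)).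

Let lebesgue_rVS_sigma_finite : sigma_finite setT lebesgue_rVS.
Proof.
have /sigma_finiteP[F [TF ndF Foo]] := sigma_finiteT (@lebesgue_measure R).
have /sigma_finiteP[G [TG ndG Goo]] := sigma_finiteT m.
exists (fun k => @uncons_rV n @^-1` (F k `*` G k)).
  rewrite -preimage_bigcup (_ : \bigcup_k _ = setT) ?preimage_setT//.
  rewrite -subTset => -[x y] _.
  have [i _ Fix] : (\bigcup_i F i) x by rewrite -TF.
  have [j _ Gjy] : (\bigcup_i G i) y by rewrite -TG.
  exists (maxn i j) => //; split.
  - by move: x Fix; exact/subsetPset/ndF/leq_maxl.
  - by move: y Gjy; exact/subsetPset/ndG/leq_maxr.
move=> k; have [mF Fk] := Foo k; have [mG Gk] := Goo k; split.
  rewrite -[X in measurable X]setTI.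
  by apply: measurable_uncons_rV => //; exact: measurableX.
rewrite /lebesgue_rVS /pushforward -comp_preimage.
rewrite (_ : _ \o _ = id); last by apply/funext => p; exact: cons_rVK.
by rewrite preimage_id product_measure1E// lte_mul_pinfty// ge0_fin_numE.
Qed.

HB.instance Definition _ := Measure_isSigmaFinite.Build _ _ _ lebesgue_rVS
  lebesgue_rVS_sigma_finite.

End step.

Fixpoint lebesgue_rV n : {sigma_finite_measure set 'rV[R]_n -> \bar R} :=
  if n is n'.+1 then lebesgue_rVS (lebesgue_rV n')
  else \d_(0 : 'rV[R]_0).

End lebesgue_rV.

(* Complex-valued functions on R^n are maps 'rV[R]_n -> R[i], integrated,      *)
(* differentiated and tested for measurability through their real and          *)
(* imaginary parts. The norm carried by 'rV[R]_n in the library is the sup     *)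
(* norm; it only enters through its topology. Euclidean lengths are explicit.  *)
Section complex_functions.
Variable R : realType.

Definition cmeasurable_fun d (T : measurableType d) (f : T -> R[i]) :=
  measurable_fun setT (fun x => complex.Re (f x)) /\
  measurable_fun setT (fun x => complex.Im (f x)).

Definition expi (t : R) : R[i] := cos t +i* sin t.

Variable n : nat.
Local Notation mu := (@lebesgue_rV R n).
Implicit Types (f g : 'rV[R]_n -> R[i]) (x y : 'rV[R]_n).

Definition cintegral f : R[i] :=
  (\int[mu]_x complex.Re (f x)) +i* (\int[mu]_x complex.Im (f x)).

Definition L2norm f : \bar R := Lnorm mu 2%:E (fun x => (normc (f x))%:E).

Definition in_L2 f := cmeasurable_fun f /\ (L2norm f < +oo)%E.

Definition dotp x y : R := \sum_(i < n) x ord0 i * y ord0 i.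

Definition japanese x : R := Num.sqrt (1 + dotp x x).

Definition cderivable f x :=
  differentiable (fun y => complex.Re (f y)) x /\
  differentiable (fun y => complex.Im (f y)) x.

Definition partial (i : 'I_n) f : 'rV[R]_n -> R[i] := fun x =>
  ('D_(delta_mx ord0 i) (fun y => complex.Re (f y)) x)
  +i* ('D_(delta_mx ord0 i) (fun y => complex.Im (f y)) x).

(* C^oo: differentiability of all iterated partial derivatives, in any order,  *)
(* makes each of them continuous.                                              *)
Definition smooth f :=
  forall (s : seq 'I_n) x, cderivable (foldr partial f s) x.

Definition mlength (alpha : {ffun 'I_n -> nat}) : nat := (\sum_i alpha i)%N.

Definition mpartial (alpha : {ffun 'I_n -> nat}) f : 'rV[R]_n -> R[i] :=
  foldr (fun i => iter (alpha i) (partial i)) f (enum 'I_n).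

Definition schwartz f := smooth f /\
  forall (N : nat) alpha, exists B : R,
    forall x, japanese x ^+ N * normc (mpartial alpha f x) <= B.

(* A distribution is only evaluated on Schwartz functions; its values on other *)
(* functions are irrelevant.                                                   *)
Definition distribution := ('rV[R]_n -> R[i]) -> R[i].

Definition tempered (u : distribution) :=
  (forall (c : R[i]) f g, schwartz f -> schwartz g ->
     u (fun x => c * f x + g x) = c * u f + u g) /\
  (exists (M : R) (N : nat), forall f (B : R), schwartz f ->
     (forall alpha x, (mlength alpha <= N)%N ->
        japanese x ^+ N * normc (mpartial alpha f x) <= B) ->
     normc (u f) <= M * B).

Definition regular_dist f : distribution :=
  fun phi => cintegral (fun x => f x * phi x).

Definition eq_dist (u v : distribution) :=
  forall phi, schwartz phi -> u phi = v phi.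

(* The L^2 norm of a distribution, +oo if it is not given by an L^2 function.  *)
Definition dist_L2norm (u : distribution) : \bar R :=
  ereal_inf [set L2norm f | f in [set f | in_L2 f /\ eq_dist u (regular_dist f)]].

End complex_functions.

Section semiclassical.
Variables (R : realType) (n : nat) (h : R).
Implicit Types (a : 'rV[R]_n -> 'rV[R]_n -> R[i]) (m : 'rV[R]_n -> R[i]).
Implicit Types (u : distribution R n) (f w : 'rV[R]_n -> R[i]).

(* Op_h(a) on Schwartz functions. As usual for pseudodifferential operators,   *)
(* the double integral is an oscillatory one: it is the iterated integral in   *)
(* which y is integrated first, the two orders agreeing when a is integrable   *)
(* in xi.                                                                      *)
Definition Op a f : 'rV[R]_n -> R[i] := fun x =>
  (((2 * pi * h) ^- n)%:C) *
  cintegral (fun xi => cintegral (fun y =>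
    expi (- (h^-1 * dotp (x - y) xi)) * a x xi * f y)).

(* Fourier multipliers Op_h(m), m = m(xi), act on tempered distributions by    *)
(* duality; the transpose of Op_h(m) is Op_h(m(-xi)).                          *)
Definition Op_dist m u : distribution R n :=
  fun phi => u (Op (fun _ xi => m (- xi)) phi).

Definition japanese_pow (k : R) : 'rV[R]_n -> R[i] :=
  fun xi => (japanese xi `^ k)%:C.

Definition sobolev_norm (k : R) u : \bar R :=
  dist_L2norm (Op_dist (japanese_pow k) u).

Definition in_sobolev (k : R) u :=
  tempered u /\ (sobolev_norm k u < +oo)%E.

(* The continuous extension of Op_h(a) from Schwartz functions to H_h^k, as a  *)
(* relation: w in L^2 is the value of Op_h(a) at u in H_h^k when Schwartz      *)
(* functions f_j converge to u in H_h^k and the Op_h(a) f_j to w in L^2.       *)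
Definition Op_sobolev (k : R) a u w :=
  [/\ in_sobolev k u, in_L2 w &
   exists f_ : nat -> 'rV[R]_n -> R[i],
   [/\ forall j, schwartz (f_ j),
       sobolev_norm k (fun phi => regular_dist (f_ j) phi - u phi)
         @[j --> \oo] --> 0%E &
       L2norm (fun x => Op a (f_ j) x - w x) @[j --> \oo] --> 0%E]].

Definition Op_norm (k : R) a : \bar R :=
  ereal_sup [set L2norm w | w in [set w | exists u,
    Op_sobolev k a u w /\ (sobolev_norm k u <= 1)%E]].

End semiclassical.

(* Main.v *)
(* The logarithm is bounded below by [ln 2], so it is enough to bound [Op_h(a)]
   uniformly in [h]. Put [n = d - 1], [e = k' - k]. For a Schwartz function [f]
   and [g = Op_h(<xi>^k') f], Fourier inversion gives
   [Op_h(a) f (x) = c \int e^(-i <x, xi> / h) b(x, xi) (F g)(xi) dxi] with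
   [b(x, xi) = a(x, xi) <xi>^(-k')], a symbol of order [-e]. Its kernel
   [kappa(z) = \int e^(-i <z, xi>) b(x, xi) dxi] is estimated, with [t] the largest
   [|z_j|], by integrating by parts [n + 1] times in [xi_j] when [t >= 1], and
   [n] times when [t <= 1], where the vanishing of [\int \partial_j^n b] gains a
   power [t^q] with [0 < q < min(e, 1)]. Both bounds lie below a multiple of
   [prod_i 1 / (|z_i|^(1 - q/n) + |z_i|^(1 + q/n))], which is integrable and does
   not depend on [x]. After rescaling by [h] its L^1 norm is independent of [h],
   and Young's inequality gives [|Op_h(a) f| <= M |g|] in L^2. Finally
   [|g|] is the Sobolev norm of [f] by duality, and the extension from Schwartz
   functions to the Sobolev space rests on the density of Schwartz functions in
   L^2 and on the completeness of L^2. *)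

Require Import Defs.
From HB Require Import structures.
From mathcomp Require Import all_boot all_order all_algebra.
From mathcomp Require Import all_classical all_reals all_analysis.
From mathcomp Require Import complex.
From mathcomp Require Import measurable_realfun.
From mathcomp Require Import ring lra.

Set Implicit Arguments.
Unset Strict Implicit.
Unset Printing Implicit Defensive.

Import Order.TTheory GRing.Theory Num.Theory.
Import numFieldNormedType.Exports.
Import ComplexField.Normc.

Local Open Scope classical_set_scope.
Local Open Scope ring_scope.
Local Open Scope complex_scope.

(** * Integration of complex-valued functions *)

(** A symbol of order [- e] is in general not integrable in [xi], so its kernel has no pointwise
    meaning. It is therefore multiplied by a [cutoff]; the kernel bound is applied to the product,
    and the cutoff is removed by dominated convergence only after pairing with [g]. About the
    dependence of [a] on [x] nothing but measurability is known: [x] is frozen, and the only link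
    between different [x] is the common majorant of the kernels.

    The exponent [q] balances three demands: [q > 0] makes the majorant integrable at 0 and at
    infinity, [q < e] keeps [<xi> ^ (q - n - e)] integrable once [|exp (i t) - 1| <= 2 |t| ^ q] has
    been used, and [q < 1] lets [t ^ (- n - 1)] be absorbed by [t ^ (- n - q)] for large [t]. The
    strict inequality [k < k'] enters as [e > 0], which leaves room for [q].

    The majorant is a product of functions of one coordinate, so that its integral reduces to the
    line. Integrating by parts in [xi_j] alone needs only pure derivatives, which is why symbol
    classes are defined one direction at a time. *)

Section complex_basics.
Variable R : realType.
Implicit Types z w : R[i].

Lemma normcD z w : normc (z + w) <= normc z + normc w.
Proof. exact: (@le_normcD R). Qed.

Lemma normc_N z : normc (- z) = normc z.
Proof. exact: (@normcN R). Qed.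

Lemma normc_sub z w : normc (z - w) = normc (w - z).
Proof. by rewrite -normc_N opprB. Qed.

Lemma normc_ge0 z : 0 <= normc z.
Proof. by case: z => a b /=; exact: sqrtr_ge0. Qed.

Lemma normcr (r : R) : normc r%:C = `|r|.
Proof. by rewrite /= expr0n/= addr0 sqrtr_sqr. Qed.

Lemma normc_sqr z : normc z ^+ 2 = complex.Re z ^+ 2 + complex.Im z ^+ 2.
Proof. by case: z => a b /=; rewrite sqr_sqrtr// addr_ge0// sqr_ge0. Qed.

Lemma ler_Re_normc z : `|complex.Re z| <= normc z.
Proof.
rewrite -(@ler_pXn2r _ 2)// ?nnegrE ?normc_ge0//.
by rewrite normc_sqr real_normK ?num_real// lerDl sqr_ge0.
Qed.

Lemma ler_Im_normc z : `|complex.Im z| <= normc z.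
Proof.
rewrite -(@ler_pXn2r _ 2)// ?nnegrE ?normc_ge0//.
by rewrite normc_sqr real_normK ?num_real// lerDr sqr_ge0.
Qed.

Lemma ler_normcD_ReIm z : normc z <= `|complex.Re z| + `|complex.Im z|.
Proof.
rewrite -(@ler_pXn2r _ 2)// ?nnegrE ?normc_ge0 ?addr_ge0//.
rewrite normc_sqr sqrrD !real_normK ?num_real//.
by rewrite addrAC lerDl mulrn_wge0// mulr_ge0.
Qed.

Lemma ReM z w : complex.Re (z * w) =
  complex.Re z * complex.Re w - complex.Im z * complex.Im w.
Proof. by case: z w => a b [c d]. Qed.

Lemma ImM z w : complex.Im (z * w) =
  complex.Re z * complex.Im w + complex.Im z * complex.Re w.
Proof. by case: z w => a b [c d]. Qed.

Lemma ReD z w : complex.Re (z + w) = complex.Re z + complex.Re w.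
Proof. by case: z w => a b [c d]. Qed.

Lemma ImD z w : complex.Im (z + w) = complex.Im z + complex.Im w.
Proof. by case: z w => a b [c d]. Qed.

Lemma ReN z : complex.Re (- z) = - complex.Re z.
Proof. by case: z. Qed.

Lemma ImN z : complex.Im (- z) = - complex.Im z.
Proof. by case: z. Qed.

Lemma complexE_eq z w :
  complex.Re z = complex.Re w -> complex.Im z = complex.Im w -> z = w.
Proof. by case: z w => a b [c d] /= -> ->. Qed.

Lemma normc_expi (t : R) : normc (expi t) = 1.
Proof. by rewrite /expi /= cos2Dsin2 sqrtr1. Qed.

Lemma expiD (s t : R) : expi (s + t) = expi s * expi t.
Proof. by apply: complexE_eq; rewrite /= ?cosD ?sinD// [RHS]addrC. Qed.

Lemma expi0 : expi (0 : R) = 1.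
Proof. by rewrite /expi cos0 sin0. Qed.

Lemma normc_conj z : normc z^* = normc z.
Proof. by case: z => a b /=; rewrite sqrrN. Qed.

End complex_basics.

Section complex_measurable.
Context d (T : measurableType d) (R : realType).
Implicit Types f g : T -> R[i].

Lemma cmeasurableD f g : cmeasurable_fun f -> cmeasurable_fun g ->
  cmeasurable_fun (fun x => f x + g x).
Proof.
move=> [f1 f2] [g1 g2]; split.
  by under eq_fun do rewrite ReD; exact: measurable_funD.
by under eq_fun do rewrite ImD; exact: measurable_funD.
Qed.

Lemma cmeasurableM f g : cmeasurable_fun f -> cmeasurable_fun g ->
  cmeasurable_fun (fun x => f x * g x).
Proof.
move=> [f1 f2] [g1 g2]; split.
  by under eq_fun do rewrite ReM; apply: measurable_funB; exact: measurable_funM.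
by under eq_fun do rewrite ImM; apply: measurable_funD; exact: measurable_funM.
Qed.

Lemma cmeasurable_cst (c : R[i]) : cmeasurable_fun (fun _ : T => c).
Proof. by split; exact: measurable_cst. Qed.

Lemma cmeasurable_real (f : T -> R) : measurable_fun setT f ->
  cmeasurable_fun (fun x => (f x)%:C).
Proof. by move=> mf; split => //=. Qed.

Lemma cmeasurableN f : cmeasurable_fun f -> cmeasurable_fun (fun x => - f x).
Proof.
move=> [f1 f2]; split.
  by under eq_fun do rewrite ReN; exact: measurableT_comp.
by under eq_fun do rewrite ImN; exact: measurableT_comp.
Qed.

Lemma cmeasurableB f g : cmeasurable_fun f -> cmeasurable_fun g ->
  cmeasurable_fun (fun x => f x - g x).
Proof. by move=> mf mg; apply: cmeasurableD => //; exact: cmeasurableN. Qed.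

Lemma cmeasurable_expi (f : T -> R) : measurable_fun setT f ->
  cmeasurable_fun (fun x => expi (f x)).
Proof.
move=> mf; split => /=; apply: measurableT_comp => //;
  apply: continuous_measurable_fun; [exact: continuous_cos|exact: continuous_sin].
Qed.

Lemma cmeasurable_conj f : cmeasurable_fun f -> cmeasurable_fun (fun x => (f x)^*).
Proof.
move=> [f1 f2]; split => //=.
  by rewrite [X in measurable_fun _ X](_ : _ = (fun x => complex.Re (f x)))//; apply/funext => x; case: (f x).
rewrite [X in measurable_fun _ X](_ : _ = (fun x => - complex.Im (f x))).
  exact: measurableT_comp.
by apply/funext => x; case: (f x).
Qed.

Lemma measurable_normc f : cmeasurable_fun f ->
  measurable_fun setT (fun x => normc (f x)).
Proof.
move=> [f1 f2].
rewrite [X in measurable_fun _ X](_ : _ = (fun x =>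
    Num.sqrt (complex.Re (f x) ^+ 2 + complex.Im (f x) ^+ 2))); last first.
  by apply/funext => x; case: (f x).
apply: measurableT_comp.
  exact: (continuous_measurable_fun (@sqrt_continuous R)).
by apply: measurable_funD; exact: measurable_funX.
Qed.

Lemma cmeasurable_comp d' (S : measurableType d') (h : S -> T) f :
  measurable_fun setT h -> cmeasurable_fun f -> cmeasurable_fun (fun x => f (h x)).
Proof.
move=> mh [f1 f2]; split.
  exact: (measurableT_comp f1 mh).
exact: (measurableT_comp f2 mh).
Qed.

Lemma cmeasurable_sum (I : Type) (s : seq I) (F : I -> T -> R[i]) :
  (forall i, cmeasurable_fun (F i)) -> cmeasurable_fun (fun x => \sum_(i <- s) F i x).
Proof.
move=> mF; elim: s => [|i s ih].
  by under eq_fun do rewrite big_nil; exact: cmeasurable_cst.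
by under eq_fun do rewrite big_cons; exact: cmeasurableD.
Qed.

End complex_measurable.
Section complex_integral.
Context d (T : measurableType d) (R : realType).
Variable mu : {measure set T -> \bar R}.
Implicit Types f g : T -> R[i].

(** [cintegral] over an arbitrary measure: Fubini needs it on products and the Poisson kernel on the
    line. *)
Definition cint f : R[i] :=
  (\int[mu]_x complex.Re (f x)) +i* (\int[mu]_x complex.Im (f x)).

(** Measurability of both parts is carried along, since integrability of the modulus alone does not
    imply it. *)
Definition cintegrable f :=
  cmeasurable_fun f /\ mu.-integrable setT (fun x => (normc (f x))%:E).

Lemma cintegrable_measurable f : cintegrable f -> cmeasurable_fun f.
Proof. by case. Qed.

Lemma cintegrable_le f (g : T -> R) : cmeasurable_fun f ->
  (forall x, normc (f x) <= g x) -> mu.-integrable setT (EFin \o g) ->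
  cintegrable f.
Proof.
move=> mf fg ig; split=> //; apply: le_integrable ig => //.
  by apply/measurable_EFinP; exact: measurable_normc.
move=> x _ /=; rewrite lee_fin ger0_norm ?normc_ge0//.
by rewrite (le_trans (fg x))// ler_norm.
Qed.

Lemma cintegrable_Re f : cintegrable f ->
  mu.-integrable setT (EFin \o (fun x => complex.Re (f x))).
Proof.
move=> [[m1 m2] fi]; apply: le_integrable fi => //.
  exact/measurable_EFinP.
move=> x _ /=; rewrite lee_fin (le_trans (ler_Re_normc _))//.
by rewrite ger0_norm// normc_ge0.
Qed.

Lemma cintegrable_Im f : cintegrable f ->
  mu.-integrable setT (EFin \o (fun x => complex.Im (f x))).
Proof.
move=> [[m1 m2] fi]; apply: le_integrable fi => //.
  exact/measurable_EFinP.
move=> x _ /=; rewrite lee_fin (le_trans (ler_Im_normc _))//.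
by rewrite ger0_norm// normc_ge0.
Qed.

Lemma cintegrableD f g : cintegrable f -> cintegrable g ->
  cintegrable (fun x => f x + g x).
Proof.
move=> [mf fi] [mg gi].
apply: (@cintegrable_le _ (fun x => normc (f x) + normc (g x))).
- exact: cmeasurableD.
- by move=> x; exact: normcD.
- exact: (integrableD _ fi gi).
Qed.

Lemma cintegrableMl (c : T -> R[i]) (B : R) f : cmeasurable_fun c ->
  (forall x, normc (c x) <= B) -> cintegrable f ->
  cintegrable (fun x => c x * f x).
Proof.
move=> mc cB [mf fi].
apply: (@cintegrable_le _ (fun x => B * normc (f x))).
- exact: cmeasurableM.
- by move=> x; rewrite normcM ler_wpM2r ?normc_ge0.
- exact: (integrableZl _ B fi).
Qed.

Lemma cintegrableZl (c : R[i]) f : cintegrable f -> cintegrable (fun x => c * f x).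
Proof. by apply: (@cintegrableMl _ (normc c)) => //; exact: cmeasurable_cst. Qed.

Lemma cintegrableN f : cintegrable f -> cintegrable (fun x => - f x).
Proof. by move=> /(cintegrableZl (-1)); under eq_fun do rewrite mulN1r. Qed.

Lemma cintegrableB f g : cintegrable f -> cintegrable g ->
  cintegrable (fun x => f x - g x).
Proof. by move=> fi gi; apply: cintegrableD => //; exact: cintegrableN. Qed.

Lemma cintegrable_sum (I : Type) (s : seq I) (F : I -> T -> R[i]) :
  (forall i, cintegrable (F i)) -> cintegrable (fun x => \sum_(i <- s) F i x).
Proof.
move=> iF; elim: s => [|i s ih].
  under eq_fun do rewrite big_nil.
  apply: (@cintegrable_le _ (cst 0)); first exact: cmeasurable_cst.
    by move=> x; rewrite normc0.
  exact: integrable0.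
by under eq_fun do rewrite big_cons; exact: cintegrableD.
Qed.

Lemma eq_cint f g : f =1 g -> cint f = cint g.
Proof. by move=> /funext ->. Qed.

Lemma cintD f g : cintegrable f -> cintegrable g ->
  cint (fun x => f x + g x) = cint f + cint g.
Proof.
move=> fi gi; apply: complexE_eq => /=.
  rewrite -(RintegralD measurableT (cintegrable_Re fi) (cintegrable_Re gi)).
  by apply: eq_Rintegral => x _; exact: ReD.
rewrite -(RintegralD measurableT (cintegrable_Im fi) (cintegrable_Im gi)).
by apply: eq_Rintegral => x _; exact: ImD.
Qed.

Lemma cintZl (c : R[i]) f : cintegrable f -> cint (fun x => c * f x) = c * cint f.
Proof.
move=> fi; apply: complexE_eq; rewrite ?ReM ?ImM /=.
  rewrite -(RintegralZl _ measurableT (cintegrable_Re fi)).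
  rewrite -(RintegralZl _ measurableT (cintegrable_Im fi)).
  rewrite -RintegralB//; first by apply: eq_Rintegral => x _; exact: ReM.
    exact: (integrableZl _ (complex.Re c) (cintegrable_Re fi)).
  exact: (integrableZl _ (complex.Im c) (cintegrable_Im fi)).
rewrite -(RintegralZl _ measurableT (cintegrable_Re fi)).
rewrite -(RintegralZl _ measurableT (cintegrable_Im fi)).
rewrite -RintegralD//; first by apply: eq_Rintegral => x _; exact: ImM.
  exact: (integrableZl _ (complex.Re c) (cintegrable_Im fi)).
exact: (integrableZl _ (complex.Im c) (cintegrable_Re fi)).
Qed.

Lemma cintB f g : cintegrable f -> cintegrable g ->
  cint (fun x => f x - g x) = cint f - cint g.
Proof.
move=> fi gi; rewrite cintD//; last exact: cintegrableN.
congr (_ + _); rewrite -mulN1r -cintZl//.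
by apply: eq_cint => x; rewrite mulN1r.
Qed.

Lemma cint_sum (I : Type) (s : seq I) (F : I -> T -> R[i]) :
  (forall i, cintegrable (F i)) ->
  cint (fun x => \sum_(i <- s) F i x) = \sum_(i <- s) cint (F i).
Proof.
move=> iF; elim: s => [|i s ih].
  rewrite big_nil; under eq_fun do rewrite big_nil.
  by apply: complexE_eq; rewrite /= /Rintegral integral0.
by rewrite big_cons -ih -cintD//; [under eq_fun do rewrite big_cons|exact: cintegrable_sum].
Qed.

(* Rotate [cint f] to the positive real axis by a unimodular constant. *)
Lemma normc_cint f : cintegrable f -> normc (cint f) <= \int[mu]_x normc (f x).
Proof.
move=> fi; have [->|I0] := eqVneq (cint f) 0.
  by rewrite normc0; apply: Rintegral_ge0 => x _; exact: normc_ge0.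
set I := cint f in I0 *.
have nI0 : 0 < normc I.
  by rewrite lt_neqAle normc_ge0 andbT eq_sym; apply/contraNneq: I0 => /eq0_normc/eqP.
pose c : R[i] := ((normc I)^-1)%:C * I^*.
have nc : normc c = 1.
  by rewrite normcM normcr normc_conj ger0_norm ?invr_ge0 ?normc_ge0// mulVf// gt_eqF.
have cI : c * I = (normc I)%:C.
  have -> : c * I = ((normc I)^-1 * normc I ^+ 2)%:C.
    by rewrite /c normc_sqr; case: (I) => a b; apply: complexE_eq => /=; ring.
  by rewrite expr2 mulKf// gt_eqF.
have -> : normc I = complex.Re (cint (fun x => c * f x)).
  by rewrite cintZl// -/I cI.
rewrite /=; apply: le_Rintegral => //.
- exact: (cintegrable_Re (cintegrableZl c fi)).
- by case: fi.
- by move=> x _; rewrite (le_trans (ler_norm _))// (le_trans (ler_Re_normc _))// normcM nc mul1r.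
Qed.

Lemma normc_cint_le f (g : T -> R) : cmeasurable_fun f ->
  (forall x, normc (f x) <= g x) -> mu.-integrable setT (EFin \o g) ->
  normc (cint f) <= \int[mu]_x g x.
Proof.
move=> mf fg ig; have fi := cintegrable_le mf fg ig.
apply: (le_trans (normc_cint fi)); apply: le_Rintegral => //; by case: fi.
Qed.

(** Convergence is expressed through the modulus of the difference, so that only real limits
    occur. *)
Lemma cint_dominated (f_ : nat -> T -> R[i]) f (g : T -> R) :
  (forall n, cmeasurable_fun (f_ n)) -> cmeasurable_fun f ->
  (forall x, normc (f_ n x - f x) @[n --> \oo] --> 0) ->
  (forall n x, normc (f_ n x) <= g x) ->
  mu.-integrable setT (EFin \o g) ->
  normc (cint (f_ n) - cint f) @[n --> \oo] --> 0.
Proof.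
move=> mf_ mf cf fg ig.
(* The limit inherits the bound [g], up to any [e > 0]; the differences are then dominated by
   [2 g]. *)
have fg' x : normc (f x) <= g x.
  apply/ler_addgt0Pr => e e0.
  have /cvgr0Pnorm_lt/(_ e e0)[n _ /(_ n (leqnn n))] := cf x.
  rewrite ger0_norm ?normc_ge0// => h.
  have -> : f x = f_ n x - (f_ n x - f x) by rewrite opprB addrC subrK.
  by rewrite (le_trans (normcD _ _))// normc_N lerD// ltW.
have fi := cintegrable_le mf fg' ig.
have fi_ n := cintegrable_le (mf_ n) (fg n) ig.
have mB n := cmeasurableB (mf_ n) mf.
have iB n := cintegrableB (fi_ n) fi.
have H : (\int[mu]_x normc (f_ n x - f x)) @[n --> \oo] --> 0.
  have := @dominated_cvg _ _ _ mu setT measurableT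
    (fun n x => (normc (f_ n x - f x))%:E) (cst 0%E) (fun x => (2 * g x)%:E).
  rewrite integral0 => h.
  apply: (@fine_cvg _ _ _ _ _ 0); apply: h => //.
  - by move=> n; apply/measurable_EFinP; exact: measurable_normc.
  - by move=> x _; apply: cvg_EFin; [exact: nearW|exact: cf].
  - exact: (integrableZl _ 2 ig).
  - move=> n x _; rewrite /= lee_fin ger0_norm ?normc_ge0//.
    by rewrite (le_trans (normcD _ _))// normc_N mulr2n mulrDl mul1r lerD.
apply: (squeeze_cvgr _ _ H); last exact: (@cvg_cst _ (0 : R)).
apply: nearW => n; apply/andP; split; first exact: normc_ge0.
by rewrite -(cintB (fi_ n) fi); exact: normc_cint (iB n).
Qed.

End complex_integral.
Arguments cint : simpl never.
Arguments normc : simpl never.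

(** * Fubini for complex-valued functions *)

Section complex_fubini.
Context d1 d2 (T1 : measurableType d1) (T2 : measurableType d2) (R : realType).
Variables (m1 : {sigma_finite_measure set T1 -> \bar R})
          (m2 : {sigma_finite_measure set T2 -> \bar R}).
Implicit Types F : T1 * T2 -> R[i].

(** Integrability on the product makes only almost every slice integrable. Asking it of every slice
    lets [fineK] undo pointwise the [fine] hidden in the inner integral. *)
Lemma cint_fubini1 F : cintegrable (m1 \x m2)%E F ->
  (forall x, cintegrable m2 (fun y => F (x, y))) ->
  cint (m1 \x m2)%E F = cint m1 (fun x => cint m2 (fun y => F (x, y))).
Proof.
move=> iF is_; apply: complexE_eq => /=; rewrite /Rintegral.
  rewrite -(integral12_prod_meas1 (cintegrable_Re iF)); congr fine.
  apply: eq_integral => x _; rewrite fineK//.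
  exact: integrable_fin_num (cintegrable_Re (is_ x)).
rewrite -(integral12_prod_meas1 (cintegrable_Im iF)); congr fine.
apply: eq_integral => x _; rewrite fineK//.
exact: integrable_fin_num (cintegrable_Im (is_ x)).
Qed.

Lemma cint_fubini2 F : cintegrable (m1 \x m2)%E F ->
  (forall y, cintegrable m1 (fun x => F (x, y))) ->
  cint (m1 \x m2)%E F = cint m2 (fun y => cint m1 (fun x => F (x, y))).
Proof.
move=> iF is_; apply: complexE_eq => /=; rewrite /Rintegral.
  rewrite -(integral21_prod_meas1 (cintegrable_Re iF)); congr fine.
  apply: eq_integral => x _; rewrite fineK//.
  exact: integrable_fin_num (cintegrable_Re (is_ x)).
rewrite -(integral21_prod_meas1 (cintegrable_Im iF)); congr fine.
apply: eq_integral => x _; rewrite fineK//.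
exact: integrable_fin_num (cintegrable_Im (is_ x)).
Qed.

Lemma cintegrable_prod F (g : T1 -> R[i]) (f : T2 -> R[i]) : cmeasurable_fun F ->
  (forall z, normc (F z) <= normc (g z.1) * normc (f z.2)) ->
  cintegrable m1 g -> cintegrable m2 f -> cintegrable (m1 \x m2)%E F.
Proof.
move=> mF Fle [mg ig] [mf jf]; split => //.
apply/integrable12ltyP.
  by apply/measurable_EFinP; exact: measurable_normc.
apply: (@le_lt_trans _ _ (\int[m1]_x ((normc (g x))%:E * \int[m2]_y (normc (f y))%:E))%E).
  apply: ge0_le_integral => //.
  - by move=> x _; apply: integral_ge0 => y _.
  - apply: (@measurable_fun_fubini_tonelli_F _ _ _ _ _ m2 (fun z => `|(normc (F z))%:E|%E)) => //.
    apply: measurableT_comp => //.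
    by apply/measurable_EFinP; exact: measurable_normc.
  - apply: emeasurable_funM => //.
    by apply/measurable_EFinP; exact: measurable_normc.
  - move=> x _; rewrite -ge0_integralZl//; last 3 first.
    + by apply/measurable_EFinP; exact: measurable_normc.
    + by move=> y _; rewrite lee_fin normc_ge0.
    + by rewrite lee_fin normc_ge0.
    apply: ge0_le_integral => //.
    + apply: measurableT_comp => //.
      apply/measurable_EFinP; apply: measurable_normc.
      apply: (cmeasurable_comp (h := fun y => (x, y))) mF.
      exact: pair1_measurable.
    + apply: emeasurable_funM => //.
      by apply/measurable_EFinP; exact: measurable_normc.
    + move=> y _; rewrite abse_EFin ger0_norm ?normc_ge0// -EFinM lee_fin; exact: (Fle (x, y)).
rewrite ge0_integralZr//; last 3 first.
- by apply/measurable_EFinP; exact: measurable_normc.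
- by move=> y _; rewrite lee_fin normc_ge0.
- by apply: integral_ge0 => y _; rewrite lee_fin normc_ge0.
apply: lte_mul_pinfty.
- by apply: integral_ge0 => y _; rewrite lee_fin normc_ge0.
- exact: integrable_fin_num.
- exact: integrable_lty.
Qed.

(** Fubini for [g x * K (x, y) * f y], which the bound on [K] keeps below [|g| |f|]. With [K] an
    exponential phase this becomes the multiplication formula for the Fourier transform. *)
Lemma cint_swap (K : T1 * T2 -> R[i]) (g : T1 -> R[i]) (f : T2 -> R[i]) :
  cmeasurable_fun K -> (forall z, normc (K z) <= 1) ->
  cintegrable m1 g -> cintegrable m2 f ->
  cint m1 (fun x => g x * cint m2 (fun y => K (x, y) * f y)) =
  cint m2 (fun y => f y * cint m1 (fun x => K (x, y) * g x)).
Proof.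
move=> mK K1 ig jf.
have m1K x : cmeasurable_fun (fun y => K (x, y)).
  by apply: (cmeasurable_comp (h := fun y => (x, y))) mK; exact: pair1_measurable.
have m2K y : cmeasurable_fun (fun x => K (x, y)).
  by apply: (cmeasurable_comp (h := fun x => (x, y))) mK; exact: pair2_measurable.
have i1 x : cintegrable m2 (fun y => K (x, y) * f y).
  exact: (cintegrableMl _ (fun y => K1 (x, y))).
have i2 y : cintegrable m1 (fun x => K (x, y) * g x).
  exact: (cintegrableMl _ (fun x => K1 (x, y))).
pose F (z : T1 * T2) := g z.1 * (K z * f z.2).
have iF : cintegrable (m1 \x m2)%E F.
  apply: (cintegrable_prod (g := g) (f := f)) => //.
    apply: cmeasurableM; last apply: cmeasurableM => //.
      exact: (cmeasurable_comp measurable_fst (cintegrable_measurable ig)).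
    exact: (cmeasurable_comp measurable_snd (cintegrable_measurable jf)).
  move=> z; rewrite /F !normcM ler_wpM2l ?normc_ge0//.
  by rewrite ler_piMl ?normc_ge0.
transitivity (cint (m1 \x m2)%E F).
  rewrite cint_fubini1//; last by move=> x; exact: (cintegrableZl (g x) (i1 x)).
  by congr cint; apply/funext => x; rewrite -cintZl.
rewrite cint_fubini2//.
  congr cint; apply/funext => y; rewrite -cintZl//.
  by congr cint; apply/funext => x; rewrite /F/=; ring.
move=> y; have := cintegrableZl (f y) (i2 y).
by congr cintegrable; apply/funext => x; rewrite /F/=; ring.
Qed.

End complex_fubini.

(** * Lebesgue measure on R^n *)

Section lebesgue_affine.
Variable R : realType.
Local Notation leb := (@lebesgue_measure R).
Variables (l c : R).
Hypothesis l0 : l != 0.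

Let phi : measurableTypeR R -> measurableTypeR R := fun t => l * t + c.

Let mphi : measurable_fun setT phi.
Proof. by apply: measurable_funD => //; exact: measurable_funM. Qed.

Let pf := measure_function_pushforward__canonical__measure_function_Measure
  leb mphi.

(** By uniqueness of Lebesgue measure, intervals []a, b]] suffice. A negative [l] reverses the
    orientation and moves the closed end of the preimage to the left, hence the two cases. *)
Lemma lebesgue_pushforward_affine (A : set R) : measurable A ->
  leb A = (`|l|%:E * leb (phi @^-1` A))%E.
Proof.
move=> mA.
have nl0 : 0 < `|l| by rewrite normr_gt0.
pose nn : {nonneg R} := NngNum (ltW nl0).
rewrite (@lebesgue_measure_unique R (mscale nn pf))//.
move=> _ [[a b] /= ab <-].
rewrite /mscale/= /pushforward/=.
case: (ltgtP l 0) (l0) => // l0' _.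
  rewrite (_ : phi @^-1` _ = `[(b - c) / l, (a - c) / l[%classic); last first.
    apply/seteqP; split => t /=; rewrite !in_itv/= /phi.
      move=> /andP[h1 h2]; apply/andP; split.
        by rewrite ler_ndivrMr// mulrC lerBrDr.
      by rewrite ltr_ndivlMr// mulrC ltrBlDr.
    move=> /andP[h1 h2]; apply/andP; split.
      by rewrite -ltrBlDr mulrC -ltr_ndivlMr.
    by rewrite -lerBrDr mulrC -ler_ndivrMr.
  rewrite !lebesgue_measure_itv/= !lte_fin.
  rewrite ltr_nM2r ?invr_lt0// ltrD2r; case: ifPn; rewrite ?mule0// => _.
  by rewrite -!EFinB -EFinM -mulrBl ltr0_norm//; congr EFin; field; rewrite lt_eqF.
rewrite (_ : phi @^-1` _ = `](a - c) / l, (b - c) / l]%classic); last first.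
  apply/seteqP; split => t /=; rewrite !in_itv/= /phi.
    move=> /andP[h1 h2]; apply/andP; split.
      by rewrite ltr_pdivrMr// mulrC ltrBlDr.
    by rewrite ler_pdivlMr// mulrC lerBrDr.
  move=> /andP[h1 h2]; apply/andP; split.
    by rewrite -ltrBlDr mulrC -ltr_pdivrMr.
  by rewrite -lerBrDr mulrC -ler_pdivlMr.
rewrite !lebesgue_measure_itv/= !lte_fin.
rewrite ltr_pM2r ?invr_gt0// ltrD2r; case: ifPn; rewrite ?mule0// => _.
by rewrite -!EFinB -EFinM -mulrBl gtr0_norm//; congr EFin; field; rewrite gt_eqF.
Qed.

Lemma ge0_integral_affine1 (f : R -> \bar R) :
  measurable_fun (setT : set (measurableTypeR R)) f -> (forall t, 0 <= f t)%E ->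
  (\int[leb]_t f t = `|l|%:E * \int[leb]_t f (l * t + c)%R)%E.
Proof.
move=> mf f0.
have nl0 : 0 < `|l| by rewrite normr_gt0.
pose nn : {nonneg R} := NngNum (ltW nl0).
transitivity (\int[mscale nn pf]_t f t)%E.
  by apply: eq_measure_integral => A mA _; exact: lebesgue_pushforward_affine.
rewrite ge0_integral_mscale//.
by rewrite ge0_integral_pushforward.
Qed.

End lebesgue_affine.

Section lebesgue_rV_integral.
Variable R : realType.
Local Notation leb := (@lebesgue_measure R).

Lemma ge0_integral_rV0 (f : 'rV[R]_0 -> \bar R) :
  measurable_fun setT f -> (\int[lebesgue_rV R 0]_x f x = f 0%R)%E.
Proof. by move=> mf; rewrite integral_dirac// diracT mul1e. Qed.

Lemma ge0_integral_rVS n (f : 'rV[R]_n.+1 -> \bar R) :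
  measurable_fun setT f -> (forall x, 0 <= f x)%E ->
  (\int[lebesgue_rV R n.+1]_x f x =
   \int[leb]_t \int[lebesgue_rV R n]_x f (cons_rV (t, x)))%E.
Proof.
move=> mf f0.
transitivity (\int[(leb \x lebesgue_rV R n)%E]_z f (cons_rV z))%E.
  by rewrite ge0_integral_pushforward//; exact: measurable_cons_rV.
rewrite fubini_tonelli1//.
by apply: measurableT_comp => //; exact: measurable_cons_rV.
Qed.

Lemma measurable_slice n (t : R) : measurable_fun setT (fun x : 'rV[R]_n => cons_rV (t, x)).
Proof.
apply: (measurableT_comp (@measurable_cons_rV R n) (g := fun x => (t, x))).
exact: pair1_measurable.
Qed.

Lemma measurable_integral_slice n (f : 'rV[R]_n.+1 -> \bar R) :
  measurable_fun setT f -> (forall x, 0 <= f x)%E ->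
  measurable_fun setT
    (fun t : measurableTypeR R => \int[lebesgue_rV R n]_x f (cons_rV (t, x)))%E.
Proof.
move=> mf f0.
apply: (@measurable_fun_fubini_tonelli_F _ _ _ _ _ (lebesgue_rV R n)
  (fun z => f (cons_rV z))) => //.
by apply: measurableT_comp => //; exact: measurable_cons_rV.
Qed.

(** Tonelli peels off one coordinate at a time, each contributing a factor [|l|]. The shift [c] is
    generalised in the induction because its tail serves in the lower dimension. *)
Lemma ge0_integral_affine n (l : R) (c : 'rV[R]_n) (f : 'rV[R]_n -> \bar R) :
  l != 0 -> measurable_fun setT f -> (forall x, 0 <= f x)%E ->
  (\int[lebesgue_rV R n]_x f x =
   (`|l| ^+ n)%:E * \int[lebesgue_rV R n]_x f (l *: x + c)%R)%E.
Proof.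
move=> l0.
have maff m (b : 'rV[R]_m) : measurable_fun setT (fun x : 'rV[R]_m => l *: x + b).
  apply: measurable_fun_rVP => i; under eq_fun do rewrite !mxE.
  apply: measurable_funD => //; apply: measurable_funM => //.
  exact: measurable_rV_coord.
elim: n c f => [|n ih] c f mf f0.
  rewrite !ge0_integral_rV0//; last exact: (measurableT_comp mf (maff _ c)).
  by rewrite expr0 mul1e; congr (f _); apply/rowP => -[].
rewrite !ge0_integral_rVS//; last exact: (measurableT_comp mf (maff _ c)).
rewrite [LHS](@ge0_integral_affine1 _ l (c ord0 ord0))//; first last.
- by move=> t; exact: integral_ge0.
- exact: measurable_integral_slice.
rewrite exprS EFinM -muleA; congr (_ * _)%E.
rewrite -ge0_integralZl//; last 2 first.
- exact: (@measurable_integral_slice n (fun x => f (l *: x + c))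
    (measurableT_comp mf (maff _ c)) (fun x => f0 _)).
- by move=> t _; exact: integral_ge0.
apply: eq_integral => t _.
rewrite (ih (\row_j c ord0 (lift ord0 j)))//; last first.
  by apply: measurableT_comp => //; exact: measurable_slice.
congr (_ * _)%E; apply: eq_integral => x _; congr f.
apply/rowP => i; case: (unliftP ord0 i) => [j ->|->].
  by rewrite [RHS]mxE [X in _ = X + _]mxE !cons_rVS !mxE.
by rewrite [RHS]mxE [X in _ = X + _]mxE !cons_rV0.
Qed.

Lemma ge0_integral_prod_rV n (q : 'I_n -> R -> R) :
  (forall i, measurable_fun setT (q i)) -> (forall i t, 0 <= q i t) ->
  (\int[lebesgue_rV R n]_x (\prod_i q i (x ord0 i))%:E =
   \big[*%E/1%E]_i \int[leb]_t (q i t)%:E)%E.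
Proof.
have mprod m (p : 'I_m -> R -> R) : (forall i, measurable_fun setT (p i)) ->
    measurable_fun setT (fun x : 'rV[R]_m => \prod_i p i (x ord0 i)).
  move=> mp; apply: measurable_prod => i _.
  by apply: measurableT_comp => //; exact: measurable_rV_coord.
elim: n q => [|n ih] q mq q0.
  by rewrite ge0_integral_rV0 ?big_ord0//; apply/measurable_EFinP; exact: mprod.
have p0 m (p : 'I_m -> R -> R) x : (forall i t, 0 <= p i t) -> (0 <= (\prod_i p i (x i))%:E)%E.
  by move=> ?; rewrite lee_fin prodr_ge0.
rewrite ge0_integral_rVS//; last 2 first.
- by apply/measurable_EFinP; exact: mprod.
- by move=> x; exact: (p0 _ q).
rewrite big_ord_recl -ih// -ge0_integralZr//; last 2 first.
- by move=> t _; rewrite lee_fin.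
- by apply: integral_ge0 => x _; exact: (p0 _ (fun i => q (lift ord0 i))).
apply: eq_integral => t _.
rewrite -ge0_integralZl//; last 3 first.
- by apply/measurable_EFinP; exact: (mprod _ (fun i => q (lift ord0 i))).
- by move=> x _; exact: (p0 _ (fun i => q (lift ord0 i))).
- by rewrite lee_fin.
apply: eq_integral => x _; rewrite big_ord_recl cons_rV0 -EFinM.
  by congr (_ * _)%:E; apply: eq_bigr => j _; rewrite (cons_rVS (t, x) j).
by apply/measurable_EFinP; exact: mq.
Qed.

(** The product of spikes, the powers of [japanese] and the Poisson kernel all become integrable on
    [R^n] through this reduction to the line. *)
Lemma integrable_prod_rV n (q : R -> R) : measurable_fun setT q ->
  (forall t, 0 <= q t) -> (\int[leb]_t (q t)%:E < +oo)%E ->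
  (lebesgue_rV R n).-integrable setT (fun x => (\prod_i q (x ord0 i))%:E).
Proof.
move=> mq q0 qoo; apply/integrableP; split.
  apply/measurable_EFinP; apply: measurable_prod => i _.
  by apply: measurableT_comp => //; exact: measurable_rV_coord.
under eq_integral do rewrite abse_EFin ger0_norm ?prodr_ge0//.
rewrite (ge0_integral_prod_rV (q := fun _ => q))//.
have fin : (\int[leb]_t (q t)%:E)%E \is a fin_num.
  by rewrite ge0_fin_numE// integral_ge0// => t _; rewrite lee_fin.
suff : (\big[*%E/1%E]_(i < n) \int[leb]_t (q t)%:E)%E \is a fin_num.
  by move=> h; rewrite ltey_eq h.
by elim/big_ind : _ => // x y; exact: fin_numM.
Qed.

(** The indicator is a product with one factor supported at a single point. The kernel estimate is
    available only off the coordinate hyperplanes, which are thus negligible. *)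
Lemma lebesgue_rV_hyperplane n (i : 'I_n) (c : R) :
  lebesgue_rV R n [set x | x ord0 i = c] = 0%E.
Proof.
have mA : measurable [set x : 'rV[R]_n | x ord0 i = c].
  rewrite -[X in measurable X]setTI.
  exact: (measurable_rV_coord i measurableT (measurable_set1 c)).
transitivity (\int[lebesgue_rV R n]_x (\1_[set x : 'rV[R]_n | x ord0 i = c] x)%:E)%E.
  by rewrite integral_indic// setIT.
pose q (j : 'I_n) (t : R) : R := if j == i then \1_[set c] t else 1.
transitivity (\int[lebesgue_rV R n]_x (\prod_j q j (x ord0 j))%:E)%E.
  apply: eq_integral => x _; congr EFin.
  rewrite (bigD1 i)//= big1 ?mulr1 => [|j ji]; last by rewrite /q (negbTE ji).
  by rewrite /q eqxx !indicE; congr (_ %:R); congr nat_of_bool; apply/idP/idP; rewrite !inE.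
rewrite ge0_integral_prod_rV.
- rewrite (bigD1 i)//= [X in (X * _)%E](_ : _ = 0%E) ?mul0e//.
  rewrite /q eqxx integral_indic// setIT.
  exact: lebesgue_measure_set1.
- move=> j; rewrite /q; case: (j == i) => //; exact: measurable_indic.
- by move=> j t; rewrite /q; case: (j == i).
Qed.

End lebesgue_rV_integral.
(** * Partial derivatives *)

Section continuous_measurable.
Variables (R : realType) (n : nat).

Lemma measurable_box (x : 'rV[R]_n) (e : R) :
  measurable [set y : 'rV[R]_n | forall i, ball (x ord0 i) e (y ord0 i)].
Proof.
rewrite (_ : [set _ | _] = \big[setI/setT]_(i <- index_enum 'I_n)
    [set y : 'rV[R]_n | ball (x ord0 i) e (y ord0 i)]).
  apply: bigsetI_measurable => i _.
  rewrite -[X in measurable X]setTI.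
  apply: (measurable_rV_coord i measurableT).
  exact: measurable_ball.
rewrite -bigcap_seq; apply/seteqP; split => y /=.
  by move=> h i _; exact: h.
by move=> h i; apply: (h i); rewrite /= mem_index_enum.
Qed.

(** The sigma-algebra of ['rV[R]_n] is generated by the coordinates, not by the topology; the two
    are linked by writing an open set as a countable union of boxes with rational centres and radii
    [1 / (N + 1)]. *)
Lemma open_measurable_rV (U : set 'rV[R]_n) : open U -> measurable U.
Proof.
move=> oU.
pose B (q : 'rV[rat]_n * nat) := [set y : 'rV[R]_n |
  forall i, ball (ratr (q.1 ord0 i) : R) (q.2.+1%:R^-1) (y ord0 i)].
rewrite (_ : U = \bigcup_(q in [set q | B q `<=` U]) B q).
  rewrite bigcup_mkcond; apply: countable_bigcupT_measurable => // q.
  case: ifP => // _.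
  rewrite (_ : B q = [set y : 'rV[R]_n | forall i, ball ((\row_j (ratr (q.1 ord0 j) : R)) ord0 i) (q.2.+1%:R^-1) (y ord0 i)]).
    exact: measurable_box.
  by apply/seteqP; split => y /= h i; have := h i; rewrite mxE.
apply/seteqP; split; last by move=> x [q /= qU /qU].
move=> x Ux.
have [e /= e0 eU] : exists2 e : R, 0 < e & ball x e `<=` U.
  by move: oU; rewrite openE => /(_ _ Ux) /nbhs_ballP[e /= e0 ?]; exists e.
have [N Ne] : exists N : nat, N.+1%:R^-1 < e / 2.
  have e2 : 0 < e / 2 by rewrite divr_gt0.
  have := near_infty_natSinv_lt (PosNum e2) => -[N _ /(_ N (leqnn N)) /= ?].
  by exists N.
have N0 : (0 : R) < N.+1%:R^-1 by rewrite invr_gt0.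
have hq (i : 'I_n) : exists q : rat, ball (x ord0 i) (N.+1%:R^-1) (ratr q : R).
  have [||y [/= h [q _ qy]]] := @dense_rat R (ball (x ord0 i) (N.+1%:R^-1)).
  - by exists (x ord0 i); exact: ballxx.
  - exact: ball_open.
  by exists q; rewrite qy.
have [q hq'] := choice hq.
exists (\row_i q i, N) => /=; last first.
  by move=> i; rewrite /= mxE; exact: ball_sym.
move=> y /= hy; apply: eU; split => // k i; rewrite ord1.
(* In each coordinate, [x] and [y] both lie within [1 / (N + 1) < e / 2] of the rational centre. *)
apply: (@le_ball _ _ _ (N.+1%:R^-1 + N.+1%:R^-1)).
  by rewrite (splitr e) lerD// ltW.
apply: ball_triangle (hq' i) _.
by have := hy i; rewrite /= mxE.
Qed.

Lemma continuous_measurable_rV (f : 'rV[R]_n -> R) :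
  continuous f -> measurable_fun setT f.
Proof.
move=> cf; apply: (measurability _ (RGenOpens.measurableE R)).
move=> _ [_ [a [b ->] <-]]; rewrite setTI; apply: open_measurable_rV.
by move/continuousP : cf; apply; exact: interval_open.
Qed.
End continuous_measurable.

Section frechet.
Variables (R : realType) (n : nat).
Implicit Types (g : 'rV[R]_n -> R) (x : 'rV[R]_n).
Local Notation e_ i := (delta_mx ord0 i : 'rV[R]_n).

Definition lincomb_coord (c : 'I_n -> R) (u : 'rV[R]_n) : R := \sum_i u ord0 i * c i.

Fact lincomb_coord_linear c : linear (lincomb_coord c).
Proof.
move=> k u v; rewrite /lincomb_coord scaler_sumr -big_split; apply: eq_bigr => i _.
by rewrite !mxE mulrDl -mulrA.
Qed.

HB.instance Definition _ c := GRing.isLinear.Build R 'rV[R]_n R _ (lincomb_coord c) (lincomb_coord_linear c).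

(** A remainder quadratic in [u] is [o(u)], so uniqueness of the differential identifies it with
    [lincomb_coord c]. Explicit remainders of this kind are what integrals depending on a parameter
    provide. *)
Lemma frechet_of_quadratic g x (c : 'I_n -> R) (B : R) :
  (forall u : 'rV[R]_n, `|g (u + x) - g x - \sum_i u ord0 i * c i| <= B * `|u| ^+ 2) ->
  differentiable g x /\ forall i, 'D_(e_ i) g x = c i.
Proof.
move=> H.
pose L : {linear 'rV[R]_n -> R} := lincomb_coord c.
have cL : continuous L.
  suff dL u : differentiable (lincomb_coord c) u.
    by move=> u; exact: differentiable_continuous (dL u).
  rewrite /lincomb_coord; elim: (index_enum _) => [|i s ih].
    by under eq_fun do rewrite big_nil; exact: differentiable_cst.
  under eq_fun do rewrite big_cons.
  apply: differentiableD => //.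
  by apply: differentiableM; [exact: differentiable_coord|exact: differentiable_cst].
have gL : g \o shift x = cst (g x) + (L : 'rV[R]_n -> R) +o_ (0 : 'rV[R]_n) id.
  apply/eqaddoP => _/posnumP[e].
  have d0 : 0 < e%:num / (`|B| + 1) by rewrite divr_gt0// ltr_wpDl.
  apply/nbhs_ballP; exists (e%:num / (`|B| + 1)) => //= u.
  rewrite mx_norm_ball /ball_/= sub0r normrN => /ltW ud.
  rewrite (_ : _ u = g (u + x) - g x - \sum_i u ord0 i * c i); last first.
    by rewrite !fctE opprD addrA.
  apply: (le_trans (H u)).
  rewrite expr2 mulrA ler_wpM2r//.
  rewrite (@le_trans _ _ ((`|B| + 1) * `|u|))//.
    by rewrite ler_wpM2r// (le_trans (ler_norm _))// lerDl.
  by rewrite -ler_pdivlMl ?ltr_wpDl// mulrC.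
have dE := diff_unique cL gL.
have dg : differentiable g x.
  by apply/diff_locallyP; rewrite dE; split.
split=> // i; rewrite deriveE// dE /=.
rewrite /lincomb_coord (bigD1 i)//= big1 ?addr0 ?mxE ?eqxx ?mul1r// => j ji.
by rewrite mxE eqxx (negbTE ji)/= mul0r.
Qed.

Lemma derive_coord j i x : 'D_(e_ i) (fun y : 'rV[R]_n => y ord0 j) x = (j == i)%:R.
Proof.
have [|_ ->//] := @frechet_of_quadratic (fun y : 'rV[R]_n => y ord0 j) x (fun i => (j == i)%:R) 0.
move=> u; rewrite (bigD1 j)//= big1 ?addr0 ?eqxx ?mulr1 ?mxE ?addrK ?subrr ?normr0 ?mul0r//.
by move=> k kj; rewrite eq_sym (negbTE kj) mulr0.
Qed.

Lemma derive_comp (phi : R -> R) (q : 'rV[R]_n -> R) x i (l : R) :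
  is_derive (q x) 1 phi l -> differentiable q x ->
  differentiable (phi \o q) x /\ 'D_(e_ i) (phi \o q) x = l * 'D_(e_ i) q x.
Proof.
move=> [dphi lE] dq.
have dphi' : differentiable phi (q x) by exact/derivable1_diffP.
have dc := differentiable_comp dq dphi'.
split=> //; rewrite !deriveE// diff_comp//= diff1E// derive1E lE.
by rewrite /GRing.scale/= mulrC.
Qed.

End frechet.

Section complex_derivation.
Variables (R : realType) (n : nat).
Implicit Types (f g : 'rV[R]_n -> R[i]) (x : 'rV[R]_n) (i : 'I_n).
Local Notation e_ i := (delta_mx ord0 i : 'rV[R]_n).

Lemma cderivable_cst (c : R[i]) x : cderivable (fun=> c) x.
Proof. by split; exact: differentiable_cst. Qed.

Lemma cderivableD f g x : cderivable f x -> cderivable g x ->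
  cderivable (fun y => f y + g y) x.
Proof.
move=> [f1 f2] [g1 g2]; split.
  under eq_fun do rewrite ReD; exact: differentiableD.
under eq_fun do rewrite ImD; exact: differentiableD.
Qed.

Lemma cderivableM f g x : cderivable f x -> cderivable g x ->
  cderivable (fun y => f y * g y) x.
Proof.
move=> [f1 f2] [g1 g2]; split.
  under eq_fun do rewrite ReM.
  by apply: differentiableB; exact: differentiableM.
under eq_fun do rewrite ImM.
by apply: differentiableD; exact: differentiableM.
Qed.

Lemma Re_conj (z : R[i]) : complex.Re z^* = complex.Re z. Proof. by case: z. Qed.

Lemma Im_conj (z : R[i]) : complex.Im z^* = - complex.Im z. Proof. by case: z. Qed.

Lemma cderivable_conj f x : cderivable f x -> cderivable (fun y => (f y)^*) x.
Proof.
move=> [f1 f2]; split; first by under eq_fun do rewrite Re_conj.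
by under eq_fun do rewrite Im_conj; exact: differentiableN.
Qed.

Lemma cderivable_real (r : 'rV[R]_n -> R) x :
  differentiable r x -> cderivable (fun y => (r y)%:C) x.
Proof. by move=> dr; split => //=; exact: differentiable_cst. Qed.

Lemma partial_cst (c : R[i]) i x : partial i (fun=> c) x = 0.
Proof. by rewrite /partial !derive_cst. Qed.

Lemma partialD f g i x : cderivable f x -> cderivable g x ->
  partial i (fun y => f y + g y) x = partial i f x + partial i g x.
Proof.
move=> [f1 f2] [g1 g2]; apply: complexE_eq; rewrite /partial/=.
  under eq_fun do rewrite ReD.
  by rewrite -deriveD//; exact: diff_derivable.
under eq_fun do rewrite ImD.
by rewrite -deriveD//; exact: diff_derivable.
Qed.

Lemma partialM f g i x : cderivable f x -> cderivable g x ->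
  partial i (fun y => f y * g y) x = partial i f x * g x + f x * partial i g x.
Proof.
move=> [f1 f2] [g1 g2].
pose v := e_ i.
have a1 : derivable (fun y => complex.Re (f y)) x v by exact: diff_derivable.
have a2 : derivable (fun y => complex.Im (f y)) x v by exact: diff_derivable.
have b1 : derivable (fun y => complex.Re (g y)) x v by exact: diff_derivable.
have b2 : derivable (fun y => complex.Im (g y)) x v by exact: diff_derivable.
have E1 := deriveB (derivableM a1 b1) (derivableM a2 b2).
have E2 := deriveD (derivableM a1 b2) (derivableM a2 b1).
rewrite (deriveM a1 b1) (deriveM a2 b2) in E1.
rewrite (deriveM a1 b2) (deriveM a2 b1) in E2.
rewrite /GRing.scale/= in E1 E2.
apply: complexE_eq; rewrite /partial/= -/v.
  under eq_fun do rewrite ReM.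
  by rewrite [LHS]E1 ReD !ReM/=; move: ('D_v _ x) ('D_v _ x) ('D_v _ x) ('D_v _ x) => ? ? ? ?; ring.
under eq_fun do rewrite ImM.
by rewrite [LHS]E2 ImD !ImM/=; move: ('D_v _ x) ('D_v _ x) ('D_v _ x) ('D_v _ x) => ? ? ? ?; ring.
Qed.

Lemma partialZ (c : R[i]) f i x : cderivable f x ->
  partial i (fun y => c * f y) x = c * partial i f x.
Proof.
move=> df; rewrite (partialM i (cderivable_cst c x) df).
by rewrite partial_cst mul0r add0r.
Qed.

Lemma partial_conj f i x : cderivable f x ->
  partial i (fun y => (f y)^*) x = (partial i f x)^*.
Proof.
move=> [f1 f2]; rewrite /partial; congr (_ +i* _).
  by under eq_fun do rewrite Re_conj.
under eq_fun do rewrite Im_conj.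
by rewrite -deriveN//; exact: diff_derivable.
Qed.

Lemma partial_real (r : 'rV[R]_n -> R) i x :
  partial i (fun y => (r y)%:C) x = ('D_(e_ i) r x)%:C.
Proof. by rewrite /partial /= derive_cst. Qed.

Lemma cderivable_coord j x : cderivable (fun y : 'rV[R]_n => (y ord0 j)%:C) x.
Proof. by apply: cderivable_real; exact: differentiable_coord. Qed.

Lemma partial_coord j i x :
  partial i (fun y : 'rV[R]_n => (y ord0 j)%:C) x = ((j == i)%:R)%:C.
Proof. by rewrite partial_real derive_coord. Qed.

Lemma continuous_cderivable_Re f : (forall x, cderivable f x) ->
  continuous (fun y => complex.Re (f y)).
Proof. by move=> df x; apply: differentiable_continuous; case: (df x). Qed.

Lemma continuous_cderivable_Im f : (forall x, cderivable f x) ->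
  continuous (fun y => complex.Im (f y)).
Proof. by move=> df x; apply: differentiable_continuous; case: (df x). Qed.

Lemma cmeasurable_cderivable f : (forall x, cderivable f x) -> cmeasurable_fun f.
Proof.
move=> df; split; apply: continuous_measurable_rV.
  exact: continuous_cderivable_Re.
exact: continuous_cderivable_Im.
Qed.

End complex_derivation.

(** * Symbols and rapidly decreasing functions *)

Section symbols.
Variables (R : realType) (n : nat).
Implicit Types (f g : 'rV[R]_n -> R[i]) (x : 'rV[R]_n) (w : 'rV[R]_n -> R).

Lemma iter_partialD i m f g :
  (forall k x, (k < m)%N -> cderivable (iter k (partial i) f) x) ->
  (forall k x, (k < m)%N -> cderivable (iter k (partial i) g) x) ->
  iter m (partial i) (fun y => f y + g y) =
  (fun y => iter m (partial i) f y + iter m (partial i) g y).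
Proof.
elim: m => // m ih df dg; rewrite iterS ih.
- by apply/funext => x; rewrite partialD ?iterS//; [exact: df|exact: dg].
- by move=> k x km; apply: df; rewrite ltnS ltnW.
- by move=> k x km; apply: dg; rewrite ltnS ltnW.
Qed.

(** The symbol estimates of order [s] along the single direction [i], up to order [M], with one
    constant for all orders. The weight is left open because the cutoff is first estimated with
    [jap_ A] and only then compared with [japanese]. *)
Definition symb i M w (s B : R) f := forall m, (m <= M)%N ->
  (forall x, cderivable (iter m (partial i) f) x) /\
  (forall x, normc (iter m (partial i) f x) <= B * w x `^ (s - m%:R)).

Lemma symb_der i M w s B f x : symb i M w s B f -> cderivable f x.
Proof. by move=> /(_ 0%N (leq0n _))[+ _]; exact. Qed.

Lemma symb_bound i M w s B f x : symb i M w s B f -> normc (f x) <= B * w x `^ s.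
Proof. by move=> /(_ 0%N (leq0n _))[_ /(_ x)]; rewrite subr0. Qed.

Lemma symb_partial i M w s B f : symb i M.+1 w s B f ->
  symb i M w (s - 1) B (partial i f).
Proof.
move=> sf m mM; have [df bf] := sf m.+1 mM; rewrite -iterSr; split=> // x.
by rewrite -addrA -opprD nat1r.
Qed.

Lemma symbS i M w s B f : (forall x, cderivable f x) ->
  (forall x, normc (f x) <= B * w x `^ s) ->
  symb i M w (s - 1) B (partial i f) -> symb i M.+1 w s B f.
Proof.
move=> df bf sf [|m] mM; first by split => // x; rewrite subr0.
have [df' bf'] := sf m mM; rewrite iterSr; split=> // x.
by rewrite -nat1r opprD addrA.
Qed.

Lemma symbW i M w s B f : symb i M.+1 w s B f -> symb i M w s B f.
Proof. by move=> sf m mM; apply: sf; rewrite (leq_trans mM). Qed.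

Lemma symb_le i M w s B B' f : B <= B' -> symb i M w s B f -> symb i M w s B' f.
Proof.
move=> BB sf m mM; have [df bf] := sf m mM; split=> // x.
by rewrite (le_trans (bf x))// ler_wpM2r// powR_ge0.
Qed.

Lemma symbD i M w s B B' f g : symb i M w s B f -> symb i M w s B' g ->
  symb i M w s (B + B') (fun y => f y + g y).
Proof.
move=> sf sg m mM.
rewrite iter_partialD; last 2 first.
- by move=> k x km; have [+ _] := sf k (ltnW (leq_trans km mM)); exact.
- by move=> k x km; have [+ _] := sg k (ltnW (leq_trans km mM)); exact.
have [df bf] := sf m mM; have [dg bg] := sg m mM; split=> x.
  exact: cderivableD.
by rewrite (le_trans (normcD _ _))// mulrDl lerD.
Qed.

(** By the Leibniz rule each derivative doubles the number of terms, whence [2 ^ M]. *)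
Lemma symbM i M w s s' B B' f g : (forall x, 0 < w x) ->
  symb i M w s B f -> symb i M w s' B' g ->
  symb i M w (s + s') (2 ^+ M * (B * B')) (fun y => f y * g y).
Proof.
move=> w0.
have H s1 s2 B1 B2 f1 g1 M1 M2 : symb i M1 w s1 B1 f1 -> symb i M2 w s2 B2 g1 ->
    forall x, normc (f1 x * g1 x) <= B1 * B2 * w x `^ (s1 + s2).
  move=> sf sg x; rewrite normcM powRD; last by rewrite (gt_eqF (w0 x)) implybT.
  rewrite mulrACA ler_pM ?normc_ge0//.
    exact: symb_bound sf.
  exact: symb_bound sg.
elim: M s s' B B' f g => [|M ih] s s' B B' f g sf sg.
  move=> [|//] _ /=; split=> x.
    by apply: cderivableM; [exact: symb_der sf|exact: symb_der sg].
  by rewrite subr0 expr0 mul1r; exact: (H _ _ _ _ _ _ _ _ sf sg).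
(* The constants carry no sign of their own; it is recovered from a bound on a modulus. *)
have BB0 x : 0 <= B * B' * w x `^ (s + s').
  by apply: le_trans (H _ _ _ _ _ _ _ _ sf sg x); exact: normc_ge0.
apply: symbS.
- by move=> x; apply: cderivableM; [exact: symb_der sf|exact: symb_der sg].
- move=> x; rewrite -mulrA (le_trans (H _ _ _ _ _ _ _ _ sf sg x))//.
  by rewrite ler_peMl// exprn_ege1// ler1n.
rewrite (_ : partial i _ = fun x => partial i f x * g x + f x * partial i g x).
  rewrite exprS -mulrA (mulr_natl _ 2) mulr2n.
  apply: symbD.
    by rewrite addrAC; apply: ih; [exact: symb_partial|exact: symbW].
  by rewrite -addrA; apply: ih; [exact: symbW|exact: symb_partial].
apply/funext => x; rewrite partialM//; [exact: symb_der sf|exact: symb_der sg].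
Qed.

Lemma symb_cst i M w (c : R[i]) : (forall x, 0 < w x) -> symb i M w 0 (normc c) (fun=> c).
Proof.
move=> w0.
have H0 m : iter m (partial i) (fun _ : 'rV[R]_n => 0 : R[i]) = (fun=> 0).
  by elim: m => // m ihm; rewrite iterS ihm; apply/funext => x; rewrite partial_cst.
move=> [|m] _; first by split=> x; [exact: cderivable_cst|rewrite subr0 powRr0 mulr1].
rewrite iterSr (_ : partial i _ = (fun=> 0)) ?H0; last first.
  by apply/funext => x; rewrite partial_cst.
by split=> x; [exact: cderivable_cst|rewrite normc0 mulr_ge0 ?normc_ge0 ?powR_ge0].
Qed.

Lemma symbZ i M w s B (c : R[i]) f : (forall x, 0 < w x) -> symb i M w s B f ->
  symb i M w s (2 ^+ M * (normc c * B)) (fun y => c * f y).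
Proof.
move=> w0 sf; have := symbM w0 (@symb_cst i M w c w0) sf.
by rewrite add0r.
Qed.

Definition jap_ (A : R) x : R := Num.sqrt (A + dotp x x).

Lemma dotp_ge0 x : 0 <= dotp x x.
Proof. by apply: sumr_ge0 => i _; rewrite -expr2 sqr_ge0. Qed.

Lemma jap_gt0 A x : 0 < A -> 0 < jap_ A x.
Proof. by move=> A0; rewrite sqrtr_gt0 ltr_wpDr// dotp_ge0. Qed.

Lemma jap_sqr A x : 0 < A -> jap_ A x ^+ 2 = A + dotp x x.
Proof. by move=> A0; rewrite sqr_sqrtr// ltW// ltr_wpDr// dotp_ge0. Qed.

Lemma ler_jap A A' x : A <= A' -> jap_ A x <= jap_ A' x.
Proof. by move=> AA; rewrite ler_wsqrtr// lerD2r. Qed.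

Lemma coord_le_jap A x j : 0 < A -> `|x ord0 j| <= jap_ A x.
Proof.
move=> A0; rewrite -(@ler_pXn2r _ 2)// ?nnegrE// ?(ltW (jap_gt0 x A0))//.
rewrite jap_sqr// real_normK ?num_real// /dotp (bigD1 j)//= -expr2 addrCA lerDl.
by rewrite addr_ge0 ?(ltW A0)// sumr_ge0// => i _; rewrite -expr2 sqr_ge0.
Qed.

Lemma differentiable_dotp x : differentiable (fun y : 'rV[R]_n => dotp y y) x.
Proof.
rewrite /dotp; elim: (index_enum _) => [|i s ih].
  by under eq_fun do rewrite big_nil; exact: differentiable_cst.
under eq_fun do rewrite big_cons.
by apply: differentiableD => //; apply: differentiableM; exact: differentiable_coord.
Qed.

Lemma derive_dotp i x : 'D_(delta_mx ord0 i) (fun y : 'rV[R]_n => dotp y y) x = 2 * x ord0 i.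
Proof.
have dc j y : derivable (fun y : 'rV[R]_n => y ord0 j) y (delta_mx ord0 i).
  by apply: diff_derivable; exact: differentiable_coord.
rewrite (_ : (fun y => _) = \sum_(j < n) (fun y : 'rV[R]_n => y ord0 j * y ord0 j)); last first.
  by apply/funext => y; rewrite fct_sumE.
rewrite derive_sum => [|j]; last exact: (derivableM (dc j x) (dc j x)).
rewrite (bigD1 i)//= big1 => [|j ji].
  rewrite (deriveM (dc i x) (dc i x)) derive_coord eqxx /GRing.scale/=; ring.
by rewrite (deriveM (dc j x) (dc j x)) derive_coord (negbTE ji) /GRing.scale/=; ring.
Qed.

Lemma symb_coord i M A j : 0 < A -> 
  symb i M (jap_ A) 1 1 (fun x : 'rV[R]_n => (x ord0 j)%:C).
Proof.
move=> A0; have w0 x := jap_gt0 x A0.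
case: M => [|M].
  move=> [|//] _; split=> x; first exact: cderivable_coord.
  by rewrite subr0 mul1r powRr1 ?(ltW (w0 x))//= normcr; exact: coord_le_jap.
apply: symbS.
- by move=> x; exact: cderivable_coord.
- by move=> x; rewrite mul1r powRr1 ?(ltW (w0 x))// normcr; exact: coord_le_jap.
rewrite subrr (_ : partial i _ = (fun=> ((j == i)%:R)%:C)); last first.
  by apply/funext => x; rewrite partial_coord.
apply: (symb_le _ (@symb_cst i M (jap_ A) _ w0)).
by rewrite normcr; case: (j == i); rewrite ?normr1// normr0.
Qed.

Lemma jap_powRE A s x : 0 < A -> jap_ A x `^ s = (A + dotp x x) `^ (s / 2).
Proof.
move=> A0; rewrite /jap_ -powR12_sqrt; last by rewrite addr_ge0 ?dotp_ge0 ?ltW.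
by rewrite -powRrM mulrC.
Qed.

Lemma jap_powR_derive A s x i : 0 < A ->
  cderivable (fun y : 'rV[R]_n => (jap_ A y `^ s)%:C) x /\
  partial i (fun y : 'rV[R]_n => (jap_ A y `^ s)%:C) x =
    s%:C * ((x ord0 i)%:C * (jap_ A x `^ (s - 2))%:C).
Proof.
move=> A0.
have q0 : 0 < A + dotp x x by rewrite ltr_wpDr// dotp_ge0.
have dq : differentiable (fun y : 'rV[R]_n => A + dotp y y) x.
  by apply: differentiableD; [exact: differentiable_cst|exact: differentiable_dotp].
have [d1 d2] := derive_comp i (is_derive1_powR (s / 2) q0) dq.
have -> : (fun y : 'rV[R]_n => (jap_ A y `^ s)%:C) =
    (fun y => (((@powR R ^~ (s / 2)) \o (fun y : 'rV[R]_n => A + dotp y y)) y)%:C).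
  by apply/funext => y; rewrite jap_powRE.
split; first exact: cderivable_real.
rewrite partial_real d2 deriveD; last 2 first.
- exact: derivable_cst.
- by apply: diff_derivable; exact: differentiable_dotp.
rewrite derive_cst add0r derive_dotp jap_powRE//.
rewrite (_ : (s - 2) / 2 = s / 2 - 1); last by field.
by rewrite -!rmorphM; congr (_%:C); field.
Qed.

(** Differentiating [jap_ A ^ s] gives [s x_i jap_ A ^ (s - 2)], a coordinate of order 1 with
    constant 1 times a lower power. As neither constant depends on [A], the final one is uniform in
    [A], which the cutoff relies on. *)
Lemma symb_jap M s : exists C : R, forall A i, 1 <= A ->
  symb i M (jap_ A) s C (fun x => (jap_ A x `^ s)%:C).
Proof.
have bnd s' A x : normc (jap_ A x `^ s')%:C = jap_ A x `^ s'.
  by rewrite normcr ger0_norm// powR_ge0.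
elim: M s => [|M ih] s.
  exists 1 => A i A1 [|//] _; have A0 := lt_le_trans ltr01 A1; split=> x.
    by have [] := jap_powR_derive s x i A0.
  by rewrite subr0 mul1r bnd.
have [C HC] := ih (s - 2).
(* The value 1 handles the function itself, the other entry its derivatives. *)
exists (Num.max 1 (2 ^+ M * (normc s%:C * (2 ^+ M * (1 * C))))) => A i A1.
have A0 := lt_le_trans ltr01 A1.
have w0 x := jap_gt0 x A0.
apply: symbS.
- by move=> x; have [] := jap_powR_derive s x i A0.
- by move=> x; rewrite bnd ler_peMl ?powR_ge0// le_max lexx.
rewrite (_ : partial i _ = fun x => s%:C * ((x ord0 i)%:C * (jap_ A x `^ (s - 2))%:C)).
  apply: (symb_le _ (symbZ _ w0 (B := 2 ^+ M * (1 * C)) _)).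
    by rewrite le_max lexx orbT.
  have := symbM w0 (@symb_coord i M A i A0) (HC A i A1).
  by rewrite (_ : 1 + (s - 2) = s - 1)//; ring.
by apply/funext => x; have [] := jap_powR_derive s x i A0.
Qed.

End symbols.

(** * Rapidly decreasing functions, slowly growing functions, Schwartz functions *)

Section rapid_decrease.
Variables (R : realType) (n : nat).
Implicit Types (f g : 'rV[R]_n -> R[i]) (x : 'rV[R]_n).

Lemma japanese_ge1 x : 1 <= japanese x.
Proof.
rewrite -(@ler_pXn2r _ 2)// ?nnegrE ?sqrtr_ge0// expr1n.
by rewrite sqr_sqrtr ?addr_ge0 ?dotp_ge0// lerDl dotp_ge0.
Qed.

Lemma japanese_gt0 x : 0 < japanese x.
Proof. exact: lt_le_trans ltr01 (japanese_ge1 x). Qed.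

Definition rapid f := (forall x, cderivable f x) /\
  forall N, exists B : R, forall x, japanese x ^+ N * normc (f x) <= B.

Definition slow f := (forall x, cderivable f x) /\
  exists N (B : R), forall x, normc (f x) <= B * japanese x ^+ N.

Lemma rapidD f g : rapid f -> rapid g -> rapid (fun x => f x + g x).
Proof.
move=> [df rf] [dg rg]; split=> [x|N]; first exact: cderivableD.
have [B HB] := rf N; have [B' HB'] := rg N.
exists (B + B') => x; apply: le_trans (lerD (HB x) (HB' x)).
by rewrite -mulrDr ler_wpM2l ?normcD// exprn_ge0// ltW// japanese_gt0.
Qed.

Lemma rapid_slow f g : slow f -> rapid g -> rapid (fun x => f x * g x).
Proof.
move=> [df [N' [B' rf]]] [dg rg]; split=> [x|N]; first exact: cderivableM.
have [B HB] := rg (N + N')%N; exists (`|B'| * B) => x.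
have jN k : 0 <= japanese x ^+ k by rewrite exprn_ge0// ltW// japanese_gt0.
rewrite normcM.
apply: le_trans (ler_wpM2l (normr_ge0 _) (HB x)).
rewrite exprD (_ : `|B'| * _ = japanese x ^+ N * (`|B'| * japanese x ^+ N' * normc (g x))); last by ring.
rewrite ler_wpM2l// ler_wpM2r ?normc_ge0// (le_trans (rf x))//.
by rewrite ler_wpM2r// ler_norm.
Qed.

(* Only derivatives in a single coordinate direction are considered, so that
   no symmetry of second derivatives is needed. *)
Definition psch f := forall i m, rapid (iter m (partial i) f).

Definition pslow f := forall i m, slow (iter m (partial i) f).

Lemma psch_slowM f g : pslow f -> psch g -> psch (fun x => f x * g x).
Proof.
move=> sf sg i.
have {}sf := sf i; have {}sg := sg i => m.
(* All orders up to [m] are treated at once: splitting an iterated derivative of a sum requires the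
   lower iterates of both terms to be differentiable. *)
suff H k : (k <= m)%N -> rapid (iter k (partial i) (fun x => f x * g x)) by exact: H.
elim: m k f g sf sg => [|m ih] [|k] f g sf sg //; try
  by move=> _; apply: rapid_slow; [exact: sf 0%N|exact: sg 0%N].
rewrite ltnS => km.
have df x : cderivable f x by case: (sf 0%N).
have dg x : cderivable g x by case: (sg 0%N).
rewrite iterSr (_ : partial i _ = fun x => partial i f x * g x + f x * partial i g x); last first.
  by apply/funext => x; rewrite partialM.
have h1 l : (l <= m)%N -> rapid (iter l (partial i) (fun x => partial i f x * g x)).
  by apply: ih => // j; rewrite -iterSr; exact: sf.
have h2 l : (l <= m)%N -> rapid (iter l (partial i) (fun x => f x * partial i g x)).
  by apply: ih => // j; rewrite -iterSr; exact: sg.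
rewrite iter_partialD.
- by apply: rapidD; [exact: h1|exact: h2].
- by move=> l x lk; have [+ _] := h1 l (ltnW (leq_trans lk km)); exact.
- by move=> l x lk; have [+ _] := h2 l (ltnW (leq_trans lk km)); exact.
Qed.

Lemma symb_slow i M s B f : symb i M (@japanese R n) s B f -> slow (iter M (partial i) f).
Proof.
move=> /(_ M (leqnn M))[df bf]; split=> //.
have [N sN] : exists N : nat, s - M%:R <= N%:R.
  by exists (Num.bound `|s - M%:R|); rewrite (le_trans (ler_norm _))// ltW// archi_boundP.
exists N, `|B| => x; apply: (le_trans (bf x)).
apply: (@le_trans _ _ (`|B| * japanese x `^ (s - M%:R))).
  by rewrite ler_wpM2r ?powR_ge0// ler_norm.
rewrite ler_wpM2l// -powR_mulrn ?(ltW (japanese_gt0 x))//.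
by rewrite ler_powR// japanese_ge1.
Qed.

Lemma pslow_jap s : pslow (fun x => (japanese x `^ s)%:C).
Proof.
move=> i m; have [C HC] := @symb_jap R n m s.
exact: symb_slow (HC 1 i (lexx _)).
Qed.

Lemma pslow_coord j : pslow (fun x : 'rV[R]_n => (x ord0 j)%:C).
Proof. move=> i m; exact: symb_slow (@symb_coord R n i m 1 j ltr01). Qed.

Lemma pslow_cst (c : R[i]) : pslow (fun x : 'rV[R]_n => c).
Proof.
move=> i m.
exact: symb_slow (@symb_cst R n i m (@japanese R n) c (fun x => japanese_gt0 x)).
Qed.

Lemma psch_Z (c : R[i]) f : psch f -> psch (fun x => c * f x).
Proof. by apply: psch_slowM; exact: pslow_cst. Qed.

(** Bridge from multi-indices to the pure derivatives in [symb] and [psch]. *)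
Lemma mpartial_single i m f :
  mpartial [ffun j => if j == i then m else 0%N] f = iter m (partial i) f.
Proof.
rewrite /mpartial.
have H s : uniq s -> foldr (fun j => iter ([ffun j => if j == i then m else 0%N] j) (partial j)) f s =
    if i \in s then iter m (partial i) f else f.
  elim: s => //= j s ih /andP[js us]; rewrite ih// ffunE inE eq_sym.
  by case: eqVneq js => [->|] //= /negbTE ->.
by rewrite H ?enum_uniq// mem_enum.
Qed.

Lemma smooth_iter f i m x : smooth f -> cderivable (iter m (partial i) f) x.
Proof.
move=> sf; have := sf (nseq m i) x; congr (cderivable _ _).
by elim: m => //= m ->.
Qed.

Lemma schwartz_psch f : schwartz f -> psch f.
Proof.
move=> [sf bf] i m; split=> [x|N]; first exact: smooth_iter.
have [B HB] := bf N [ffun j => if j == i then m else 0%N].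
by exists B => x; rewrite -mpartial_single.
Qed.

(** A coinduction principle: a class of rapidly decreasing functions closed under all [partial i]
    contains every iterated derivative of its members, so mixed derivatives never have to be
    reordered. *)
Lemma schwartz_stable (P : ('rV[R]_n -> R[i]) -> Prop) :
  (forall f, P f -> rapid f) -> (forall f i, P f -> P (partial i f)) ->
  forall f, P f -> schwartz f.
Proof.
move=> Pr Pp f Pf; split.
  move=> s x; suff : P (foldr (@partial R n) f s) by move=> /Pr[+ _]; exact.
  by elim: s => //= i s; exact: Pp.
move=> N alpha; suff : P (mpartial alpha f) by move=> /Pr[_ /(_ N)].
rewrite /mpartial; elim: (enum _) => //= i s ih.
by elim: (alpha i) => //= m; exact: Pp.
Qed.

Lemma mpartialE alpha f : mpartial alpha f =
  foldr (@partial R n) f (flatten [seq nseq (alpha i) i | i <- enum 'I_n]).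
Proof.
rewrite /mpartial; elim: (enum _) => //= i s ->.
by rewrite foldr_cat; elim: (alpha i) => //= m ->.
Qed.

Lemma foldr_partial_lin (c : R[i]) f g s : smooth f -> smooth g ->
  foldr (@partial R n) (fun x => c * f x + g x) s =
  (fun x => c * foldr (@partial R n) f s x + foldr (@partial R n) g s x).
Proof.
move=> sf sg; elim: s => //= i s ->; apply/funext => x.
have df := sf s x; have dg := sg s x.
rewrite partialD//; last by apply: cderivableM => //; exact: cderivable_cst.
by rewrite partialZ.
Qed.

Lemma schwartz_lin (c : R[i]) f g : schwartz f -> schwartz g ->
  schwartz (fun x => c * f x + g x).
Proof.
move=> [sf bf] [sg bg]; split.
  move=> s x; rewrite foldr_partial_lin//; apply: cderivableD; last exact: sg.
  by apply: cderivableM; [exact: cderivable_cst|exact: sf].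
move=> N alpha; have [B HB] := bf N alpha; have [B' HB'] := bg N alpha.
exists (normc c * B + B') => x; rewrite mpartialE foldr_partial_lin// -!mpartialE.
have jN : 0 <= japanese x ^+ N by rewrite exprn_ge0// ltW// japanese_gt0.
apply: le_trans (lerD (ler_wpM2l (normc_ge0 c) (HB x)) (HB' x)).
by rewrite mulrCA -normcM -mulrDr ler_wpM2l// normcD.
Qed.

Lemma schwartz_conj f : schwartz f -> schwartz (fun x => (f x)^*).
Proof.
move=> [sf bf].
have H s : foldr (@partial R n) (fun x => (f x)^*) s =
    (fun x => (foldr (@partial R n) f s x)^*).
  elim: s => //= i s ->; apply/funext => x.
  by rewrite partial_conj//; exact: sf.
split; first by move=> s x; rewrite H; apply: cderivable_conj; exact: sf.
move=> N alpha; have [B HB] := bf N alpha; exists B => x.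
by rewrite mpartialE H -mpartialE normc_conj.
Qed.

End rapid_decrease.

(** * Integrable weights *)

Section spike.
Variable R : realType.
Local Notation leb := (@lebesgue_measure R).
Variable p : R.
Hypothesis p01 : 0 < p < 1.

Let p0 : 0 < p. Proof. by case/andP: p01. Qed.
Let p1 : p < 1. Proof. by case/andP: p01. Qed.

(* Decreasing and integrable on the half-line, comparable to [t^(p - 1)] at 0 and
   to [t^(- 1 - p)] at infinity; its primitive is [p^-1 * atan (t^p)]. *)
Definition spike (t : R) : R :=
  if t == 0 then 1 else (`|t| `^ (1 - p) + `|t| `^ (1 + p))^-1.

Let h (t : R) : R := (t `^ (1 - p) + t `^ (1 + p))^-1.

Let h_ge0 t : 0 <= h t.
Proof. by rewrite invr_ge0 addr_ge0// powR_ge0. Qed.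

Lemma spike_ge0 t : 0 <= spike t.
Proof. by rewrite /spike; case: ifP => // _; rewrite invr_ge0 addr_ge0// powR_ge0. Qed.

Let mpow (a : R) : measurable_fun setT (fun t : R => t `^ a).
Proof. exact: measurable_powR. Qed.

Let mh : measurable_fun setT h.
Proof.
have -> : h = (fun t => (t `^ (1 - p) + t `^ (1 + p)) `^ (-1)).
  by apply/funext => t; rewrite powR_inv1// addr_ge0// powR_ge0.
apply: (measurableT_comp (mpow (-1))).
exact: measurable_funD (mpow _) (mpow _).
Qed.

Lemma measurable_spike : measurable_fun setT spike.
Proof.
apply: measurable_fun_ifT => //.
  exact: measurable_fun_eqr.
have -> : (fun t : R => (`|t| `^ (1 - p) + `|t| `^ (1 + p))^-1) = h \o (@Num.Def.normr R R) by [].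
by apply: (measurableT_comp mh).
Qed.

Lemma spike_le (u v : R) : 0 < u -> u <= v -> spike v <= spike u.
Proof.
move=> u0 uv; have v0 := lt_le_trans u0 uv.
rewrite /spike !gt_eqF// !gtr0_norm//.
rewrite lef_pV2 ?posrE ?addr_gt0 ?powR_gt0//.
by rewrite lerD// ge0_ler_powR ?nnegrE ?subr_ge0 ?(ltW p1) ?(ltW u0) ?(ltW v0)// addr_ge0// ltW.
Qed.

(** For [u <= 1] the power [u ^ (1 + p)] is the smaller summand of the denominator, which is then at
    most [2 u ^ (1 - p)]. For [u >= 1] the roles are exchanged. *)
Lemma spike_ge_small (u : R) : 0 < u -> u <= 1 -> u `^ (p - 1) <= 2 * spike u.
Proof.
move=> u0 u1; rewrite /spike gt_eqF// gtr0_norm//.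
rewrite -(opprB 1 p) powRN.
rewrite ler_pdivlMr ?addr_gt0 ?powR_gt0// mulrC ler_pdivrMr ?powR_gt0//.
rewrite mulrDl mul1r lerD2l -[leRHS]mulr1.
rewrite (_ : 1 + p = (1 - p) + 2 * p); last by ring.
rewrite powRD; last by rewrite (gt_eqF u0) implybT.
have e1 : 1 `^ (2 * p) = 1 :> R by rewrite powR1.
rewrite ler_wpM2l ?powR_ge0// -[leRHS]e1.
by rewrite ge0_ler_powR ?nnegrE ?mulr_ge0// ltW.
Qed.

Lemma spike_ge_large (u : R) : 1 <= u -> u `^ (- (1 + p)) <= 2 * spike u.
Proof.
move=> u1; have u0 := lt_le_trans ltr01 u1.
rewrite /spike gt_eqF// gtr0_norm// powRN.
rewrite ler_pdivlMr ?addr_gt0 ?powR_gt0// mulrC ler_pdivrMr ?powR_gt0//.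
rewrite mulrDl mul1r lerD2r ler_powR//.
by have := p0; lra.
Qed.

Let F (t : R) : R := p^-1 * atan (t `^ p).

Let dF (t : R) : 0 < t -> is_derive t (1 : R) F (h t).
Proof.
move=> t0.
have := is_deriveZ (p^-1) (is_derive1_comp (is_derive1_atan _) (is_derive1_powR p t0)).
rewrite (_ : _ *: _ = h t)//.
rewrite /h /GRing.scale/=.
have P1 : t `^ (p - 1) = t `^ p / t.
  by rewrite powRB ?powRr1 ?ltW// (gt_eqF t0) implybT.
have P2 : t `^ (1 - p) = t / t `^ p.
  by rewrite powRB ?powRr1 ?ltW// (gt_eqF t0) implybT.
have P3 : t `^ (1 + p) = t * t `^ p.
  by rewrite powRD ?powRr1 ?ltW// (gt_eqF t0) implybT.
rewrite P1 P2 P3; have : 0 < t `^ p by rewrite powR_gt0.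
move: (t `^ p) => y y0; field.
have yy : 0 < 1 + y ^+ 2 by rewrite ltr_wpDr// sqr_ge0.
by rewrite !gt_eqF//= ltr_wpDr// !mulr_ge0// ltW.
Qed.

Let int_h_itv (a b : R) : 0 < a -> a < b ->
  (\int[leb]_(t in `[a, b]) (h t)%:E <= (p^-1 * pi)%:E)%E.
Proof.
move=> a0 ab.
rewrite (@continuous_FTC2 _ h F)//.
(* A crude bound is enough: both arctangents lie between [- pi / 2] and [pi / 2]. *)
- rewrite -EFinB lee_fin /F -mulrBr ler_wpM2l ?invr_ge0 ?(ltW p0)//.
  have := atan_ltpi2 (b `^ p); have := atan_gtNpi2 (a `^ p); lra.
- apply: (@continuous_in_subspaceT _ _ _ (h : R -> R)) => t; rewrite inE/= in_itv/= => /andP[ta _].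
  have t0 := lt_le_trans a0 ta.
  apply: (@continuousV _ _ (fun t : R => t `^ (1 - p) + t `^ (1 + p)) t).
    by rewrite gt_eqF// addr_gt0// powR_gt0.
  have cpow a' : {for t, continuous (fun t : R => t `^ a')}.
    apply: differentiable_continuous; apply/derivable1_diffP.
    by have [] := is_derive1_powR a' t0.
  by apply: (@continuousD _ _ _ (fun t : R => t `^ (1 - p)) (fun t => t `^ (1 + p)) t).
- split.
  + by move=> t; rewrite in_itv/= => /andP[ta _]; have [] := dF (lt_trans a0 ta).
  + apply: cvg_at_right_filter; apply: differentiable_continuous.
    by apply/derivable1_diffP; have [] := dF a0.
  + apply: cvg_at_left_filter; apply: differentiable_continuous.
    by apply/derivable1_diffP; have [] := dF (lt_trans a0 ab).
- move=> t; rewrite in_itv/= => /andP[ta _].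
  by rewrite derive1E; have [_] := dF (lt_trans a0 ta).
Qed.

Let int_h : (\int[leb]_(t in `]0%R, +oo[) (h t)%:E <= (p^-1 * pi)%:E)%E.
Proof.
(* Starting at [k + 2] keeps the left end strictly below 1 and the right end strictly above, as
   [int_h_itv] needs [a < b]. *)
pose G (k : nat) : set (measurableTypeR R) := `[(k.+2%:R^-1 : R), k.+2%:R]%classic.
have GE : `]0, +oo[%classic = \bigcup_k G k.
  apply/seteqP; split=> t /=; rewrite ?in_itv/= ?andbT.
    move=> t0; pose N := maxn (Num.bound t) (Num.bound t^-1).
    have N1 : t <= N.+2%:R.
      apply: (le_trans (ltW (archi_boundP (ltW t0)))).
      by rewrite ler_nat !leqW// leq_maxl.
    have N2 : t^-1 <= N.+2%:R.
      have ti0 : 0 <= t^-1 by rewrite invr_ge0 ltW.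
      apply: (le_trans (ltW (archi_boundP ti0))).
      by rewrite ler_nat !leqW// leq_maxr.
    exists N => //; rewrite /G/= in_itv/= N1 andbT.
    by rewrite -(invrK t) lef_pV2 ?posrE ?invr_gt0.
  by move=> [k _]; rewrite /G/= in_itv/= => /andP[+ _]; apply: lt_le_trans; rewrite invr_gt0.
have mhE : measurable_fun setT (EFin \o h) by exact/measurable_EFinP.
have H := @ge0_nondecreasing_set_cvg_integral _ _ _ G (EFin \o h)
  (lebesgue_measure : {measure set (measurableTypeR R) -> \bar R}).
rewrite GE; have {}H : (\int[leb]_(x in G i) (EFin \o h) x)%E @[i --> \oo] -->
    (\int[leb]_(x in \bigcup_i G i) (EFin \o h) x)%E.
  apply: H.
  - move=> k l kl; apply/subsetPset => t; rewrite /G/= !in_itv/= => /andP[h1 h2].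
    rewrite (le_trans _ h1) ?lef_pV2 ?posrE ?ler_nat ?ltnS//.
    by rewrite (le_trans h2)// ler_nat !ltnS.
  - by move=> k; exact: measurable_itv.
  - by move=> k; apply: measurable_funS mhE.
  - by move=> k t _; rewrite lee_fin.
rewrite -(cvg_lim _ H)//; apply: lime_le; first by apply/cvg_ex; eexists; exact: H.
apply: nearW => k; apply: int_h_itv; rewrite ?invr_gt0//.
by rewrite (@lt_trans _ _ 1) ?invf_lt1 ?ltr1n.
Qed.

Lemma integral_spike_lty : (\int[leb]_t (spike t)%:E < +oo)%E.
Proof.
pose f := (EFin \o h) \_ (`]0%R, +oo[%classic : set (measurableTypeR R)).
have f0 t : (0 <= f t)%E by rewrite /f patchE; case: ifP => // _; rewrite lee_fin.
have mf : measurable_fun setT f.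
  apply/(measurable_restrictT _ _).1 => //.
  by apply: measurable_funS (_ : measurable_fun setT _) => //; exact/measurable_EFinP.
have mfN : measurable_fun setT (fun t : measurableTypeR R => f (- 1 * t + 0)).
  apply: measurableT_comp => //.
  by apply: measurable_funD => //; exact: measurable_funM.
have m0 : measurable_fun setT (fun t : measurableTypeR R => (\1_[set 0] t)%:E : \bar R).
  by apply/measurable_EFinP; exact: measurable_indic.
have If : (\int[leb]_t f t <= (p^-1 * pi)%:E)%E by rewrite -integral_mkcond; exact: int_h.
(* The two half-lines are covered by [f] and its reflection, whose argument has the affine form of
   [ge0_integral_affine1]; the indicator accounts for the value at 0 and has integral 0. *)
have le3 t : ((spike t)%:E <= f t + f (- 1 * t + 0)%R + (\1_[set 0%R] t)%:E)%E.
  rewrite mulN1r addr0 /spike; have [->|t0] := eqVneq t 0.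
    by rewrite indicE mem_set//= leeDr// adde_ge0.
  have ft u : 0 < u -> f u = (h u)%:E.
    by move=> u0; rewrite /f patchE mem_set//= in_itv/= u0.
  have i0 : (0 <= (\1_[set 0%R] t)%:E :> \bar R)%E by rewrite lee_fin.
  have [tn|tp|/eqP] := ltgtP t 0; last by rewrite (negbTE t0).
    rewrite (ft (- t)) ?oppr_gt0// ltr0_norm//.
    by rewrite -[leLHS]add0e -[leLHS]adde0 !leeD.
  by rewrite (ft t)// gtr0_norm// -addeA -[leLHS]adde0 leeD// adde_ge0.
apply: (@le_lt_trans _ _ (\int[leb]_t (f t + f (- 1 * t + 0)%R + (\1_[set 0%R] t)%:E))%E).
  apply: ge0_le_integral => //.
  - by move=> t _; rewrite lee_fin spike_ge0.
  - by apply/measurable_EFinP; exact: measurable_spike.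
  - by apply: emeasurable_funD => //; exact: emeasurable_funD.
rewrite ge0_integralD//; first last.
- by apply: emeasurable_funD.
- by move=> t _; rewrite adde_ge0.
rewrite ge0_integralD// integral_indic// setIT.
rewrite [X in (_ + _ + X)%E](@lebesgue_measure_set1 R) adde0.
have N10 : (- 1 : R) != 0 by rewrite oppr_eq0 oner_eq0.
have := ge0_integral_affine1 0 N10 mf f0; rewrite normrN1 mul1e => <-.
by rewrite lte_add_pinfty// (le_lt_trans If)// ltry.
Qed.

End spike.

(** * Integrability from decay, affine changes of variables *)

Section decay.
Variables (R : realType) (n : nat).
Local Notation mu := (lebesgue_rV R n).
Implicit Types (f : 'rV[R]_n -> R[i]) (x : 'rV[R]_n).

Lemma measurable_dotp d (T : measurableType d) (u v : T -> 'rV[R]_n) :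
  measurable_fun setT u -> measurable_fun setT v ->
  measurable_fun setT (fun t => dotp (u t) (v t)).
Proof.
move=> mu_ mv; apply: measurable_sum => i.
by apply: measurable_funM; [exact: (measurableT_comp (measurable_rV_coord i) mu_)|
  exact: (measurableT_comp (measurable_rV_coord i) mv)].
Qed.

Lemma measurable_japanese : measurable_fun setT (@japanese R n).
Proof.
apply: (measurableT_comp (continuous_measurable_fun (@sqrt_continuous R))).
by apply: measurable_funD => //; exact: measurable_dotp.
Qed.

Lemma measurable_japanese_powR s : measurable_fun setT (fun x => @japanese R n x `^ s).
Proof.
exact: (measurableT_comp (measurable_powR s) measurable_japanese).
Qed.

(** Since [<x>] is at least 1 and at least each [|x_i|], the power [<x> ^ (- n (1 + p))] lies below
    a product of one-variable spikes; no polar coordinates are used. *)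
Lemma integrable_japanese (s : R) : n%:R < s ->
  mu.-integrable setT (fun x => (japanese x `^ (- s))%:E).
Proof.
move=> ns.
(* The minimum with 1 gives [p < 1], and the division by [2 (n + 1)] gives [n p <= s - n]. *)
pose p : R := Num.min 1 (s - n%:R) / (2 * n.+1%:R).
have m0 : 0 < Num.min 1 (s - n%:R) by rewrite lt_min ltr01 subr_gt0.
have n1 : (0 : R) < n.+1%:R by rewrite ltr0n.
have p0 : 0 < p by rewrite divr_gt0// mulr_gt0.
have p1 : p < 1.
  rewrite ltr_pdivrMr ?mulr_gt0// mul1r (@le_lt_trans _ _ 1)//.
    by rewrite ge_min lexx.
  by rewrite -natrM ltr1n mulnS.
have p01 : 0 < p < 1 by rewrite p0 p1.
have nps : n%:R * (1 + p) <= s.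
  rewrite mulrDr mulr1 -lerBrDl.
  apply: (@le_trans _ _ (Num.min 1 (s - n%:R))); last by rewrite ge_min lexx orbT.
  rewrite /p mulrCA ler_piMr ?(ltW m0)// ler_pdivrMr ?mulr_gt0// mul1r.
  by rewrite -natrM ler_nat mulnS mulSn mul1n leqW// leqW// leq_addr.
have := @integrable_prod_rV R n (fun t => 2 * spike p t).
move=> H; have {}H : mu.-integrable setT (fun x => (\prod_i (2 * spike p (x ord0 i)))%:E).
  apply: H.
  - by apply: measurable_funM => //; exact: measurable_spike.
  - by move=> t; rewrite mulr_ge0// spike_ge0.
  - under eq_integral do rewrite EFinM.
    rewrite ge0_integralZl//.
    + by rewrite lte_mul_pinfty// integral_spike_lty.
    + by apply/measurable_EFinP; exact: measurable_spike.
    + by move=> t _; rewrite lee_fin spike_ge0.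
apply: le_integrable H => //.
- by apply/measurable_EFinP; exact: measurable_japanese_powR.
move=> x _; rewrite !abse_EFin lee_fin ger0_norm ?powR_ge0// ger0_norm; last first.
  by apply: prodr_ge0 => i _; rewrite mulr_ge0// spike_ge0.
have jx := japanese_ge1 x.
apply: (@le_trans _ _ (japanese x `^ (- (n%:R * (1 + p))))).
  by rewrite ler_powR// lerN2.
rewrite mulrC -mulNr powRrM powR_mulrn ?powR_ge0//.
rewrite -[X in _ ^+ X](card_ord n) -prodr_const; apply: ler_prod => i _.
rewrite powR_ge0/=.
have j1 : japanese x `^ (- (1 + p)) <= 1.
  by rewrite -[leRHS](powRr0 (japanese x)) ler_powR// oppr_le0 addr_ge0// ltW.
(* Here the separate value 1 of [spike] at 0 matters: the general formula would give the inverse of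
   0, that is 0, and the domination would fail. *)
have [x0|x0] := eqVneq (x ord0 i) 0.
  by rewrite (le_trans j1)// /spike x0 eqxx mulr1 ler1n.
have nx0 : 0 < `|x ord0 i| by rewrite normr_gt0.
have -> : spike p (x ord0 i) = spike p `|x ord0 i|.
  by rewrite /spike normr_eq0 normr_id.
have [x1|x1] := leP `|x ord0 i| 1.
  apply: le_trans (spike_ge_small p01 nx0 x1).
  rewrite (le_trans j1)// -(opprB 1 p) powRN invf_ge1 ?powR_gt0//.
  have e1 : 1 `^ (1 - p) = 1 :> R by rewrite powR1.
  by rewrite -[leRHS]e1 ge0_ler_powR ?nnegrE ?subr_ge0// ltW.
apply: le_trans (spike_ge_large p01 (ltW x1)).
rewrite !powRN lef_pV2 ?posrE ?powR_gt0 ?japanese_gt0//.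
rewrite ge0_ler_powR ?nnegrE ?(ltW nx0) ?(ltW (japanese_gt0 x))// ?addr_ge0 ?(ltW p0)//.
exact: coord_le_jap.
Qed.

Lemma cintegrable_decay f (B s : R) : cmeasurable_fun f -> n%:R < s ->
  (forall x, normc (f x) <= B * japanese x `^ (- s)) -> cintegrable mu f.
Proof.
move=> mf ns fB; apply: (cintegrable_le mf fB).
exact: (integrableZl measurableT B (integrable_japanese ns)).
Qed.

Lemma rapid_powR f (s : R) : rapid f ->
  exists2 B, 0 <= B & forall x, normc (f x) <= B * japanese x `^ (- s).
Proof.
move=> [_ rf].
have [B HB] := rf (Num.bound `|s|); exists `|B| => // x.
have jx := japanese_ge1 x; have j0 := japanese_gt0 x.
rewrite powRN ler_pdivlMr ?powR_gt0// mulrC.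
rewrite (le_trans _ (ler_norm B))// (le_trans _ (HB x))//.
rewrite ler_wpM2r ?normc_ge0// -powR_mulrn ?(ltW j0)// ler_powR//.
by rewrite (le_trans (ler_norm _))// ltW// archi_boundP.
Qed.

Lemma rapid_cmeasurable f : rapid f -> cmeasurable_fun f.
Proof. by move=> [df _]; exact: cmeasurable_cderivable. Qed.

Lemma rapid_cintegrable f : rapid f -> cintegrable mu f.
Proof.
move=> rf; have [B _ HB] := rapid_powR (n%:R + 1) rf.
apply: cintegrable_decay HB; first exact: rapid_cmeasurable.
by rewrite ltrDl.
Qed.

Lemma cintegralE f : cintegral f = cint mu f.
Proof. by []. Qed.

Lemma measurable_affine (l : R) (c : 'rV[R]_n) : measurable_fun setT (fun x => l *: x + c).
Proof.
apply: measurable_fun_rVP => i; under eq_fun do rewrite !mxE.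
apply: measurable_funD => //; apply: measurable_funM => //.
exact: measurable_rV_coord.
Qed.

Lemma integrable_affine (l : R) (c : 'rV[R]_n) (g : 'rV[R]_n -> R) : l != 0 ->
  mu.-integrable setT (EFin \o g) -> mu.-integrable setT (EFin \o (fun x => g (l *: x + c))).
Proof.
move=> l0 /integrableP[mg ig]; apply/integrableP; split.
  exact: (measurableT_comp mg (measurable_affine l c)).
move: ig; rewrite (ge0_integral_affine c l0)//; last exact: measurableT_comp.
have : 0 < `|l| ^+ n by rewrite exprn_gt0// normr_gt0.
move: (`|l| ^+ n) => r r0 ig.
rewrite ltNge leye_eq; apply/negP => /eqP E; move: ig.
by rewrite [X in (_ * X)%E]E gt0_muley// ltxx.
Qed.

Lemma Rintegral_affine (l : R) (c : 'rV[R]_n) (g : 'rV[R]_n -> R) : l != 0 ->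
  mu.-integrable setT (EFin \o g) ->
  \int[mu]_x g x = `|l| ^+ n * \int[mu]_x g (l *: x + c).
Proof.
move=> l0 ig; have ig' := integrable_affine c l0 ig.
rewrite /Rintegral -[X in X * _]/(fine (`|l| ^+ n)%:E) -fineM//; last exact: integrable_fin_num ig'.
congr fine.
pose A := (\int[mu]_x (EFin \o (fun x => g (l *: x + c)%R))^\+%E x)%E.
pose B := (\int[mu]_x (EFin \o (fun x => g (l *: x + c)%R))^\-%E x)%E.
have mg := measurable_int mu ig.
have EA : (\int[mu]_x (EFin \o g)^\+%E x)%E = ((`|l| ^+ n)%:E * A)%E.
  rewrite (ge0_integral_affine c l0 (measurable_funepos mg) (funepos_ge0 _)).
  by congr (_ * _)%E; apply: eq_integral => x _; rewrite ?funeposE ?funenegE.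
have EB : (\int[mu]_x (EFin \o g)^\-%E x)%E = ((`|l| ^+ n)%:E * B)%E.
  rewrite (ge0_integral_affine c l0 (measurable_funeneg mg) (funeneg_ge0 _)).
  by congr (_ * _)%E; apply: eq_integral => x _; rewrite ?funeposE ?funenegE.
transitivity ((`|l| ^+ n)%:E * A - (`|l| ^+ n)%:E * B)%E.
  by rewrite -EA -EB -integralE.
rewrite -muleBr//.
  by rewrite (integralE mu setT (EFin \o (fun x => g (l *: x + c)))).
by apply: fin_num_adde_defr; exact: integrable_pos_fin_num ig'.
Qed.

Lemma cint_affine (l : R) (c : 'rV[R]_n) f : l != 0 -> cintegrable mu f ->
  cint mu f = (`|l| ^+ n)%:C * cint mu (fun x => f (l *: x + c)).
Proof.
move=> l0 fi; apply: complexE_eq; rewrite ?ReM ?ImM /cint/= mul0r ?subr0 ?addr0.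
  exact: (Rintegral_affine c l0 (cintegrable_Re fi)).
exact: (Rintegral_affine c l0 (cintegrable_Im fi)).
Qed.

Lemma cintegrable_affine (l : R) (c : 'rV[R]_n) f : l != 0 -> cintegrable mu f ->
  cintegrable mu (fun x => f (l *: x + c)).
Proof.
move=> l0 [mf fi]; split.
  exact: (cmeasurable_comp (measurable_affine l c) mf).
exact: (integrable_affine c l0 fi).
Qed.

End decay.

(** * Fourier transform *)

Section mean_value.
Variable R : realType.

Lemma mean_value (f f' : R -> R) : (forall x : R, is_derive x (1 : R) f (f' x)) ->
  forall a b : R, exists c, `|c - a| <= `|b - a| /\ f b - f a = f' c * (b - a).
Proof.
move=> df.
have cf x y : {within `[x, y], continuous f}.
  by apply: derivable_within_continuous => z _; have [] := df z.
have H x y : x <= y -> exists2 c, c \in `[x, y]%R & f y - f x = f' c * (y - x).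
  by move=> xy; apply: MVT_segment => // z _; exact: df.
move=> a b; have [ab|/ltW ba] := leP a b.
  have [c + E] := H a b ab; rewrite in_itv/= => /andP[ac cb].
  by exists c; split => //; rewrite !ger0_norm ?subr_ge0 ?lerB.
have [c + E] := H b a ba; rewrite in_itv/= => /andP[bc ca]; exists c; split.
  by rewrite !ler0_norm ?subr_le0// lerN2 lerB.
by rewrite -[LHS]opprB E -mulrN opprB.
Qed.

Lemma normr_sin_le (t : R) : `|sin t| <= `|t|.
Proof.
have [c [_]] := mean_value (fun x => is_derive_sin x) 0 t.
rewrite sin0 !subr0 => ->; rewrite normrM ler_piMl//.
by rewrite ler_norml cos_geN1 cos_le1.
Qed.

Lemma normr_cos1_le (t : R) : `|cos t - 1| <= `|t| ^+ 2.
Proof.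
have [c [ct]] := mean_value (fun x => is_derive_cos x) 0 t.
rewrite cos0 => ->; rewrite !subr0 in ct *.
by rewrite normrM normrN expr2 ler_wpM2r// (le_trans (normr_sin_le c)).
Qed.

Lemma normr_cos1_le1 (t : R) : `|cos t - 1| <= `|t|.
Proof.
have [c [ct]] := mean_value (fun x => is_derive_cos x) 0 t.
rewrite cos0 => ->; rewrite !subr0 in ct *.
rewrite normrM normrN ler_piMl//.
by rewrite ler_norml sin_geN1 sin_le1.
Qed.

Lemma normr_sinB_le (t : R) : `|sin t - t| <= `|t| ^+ 2.
Proof.
have ds (x : R) : is_derive x (1 : R) (fun x => sin x - x) (cos x - 1).
  exact: (is_deriveB (is_derive_sin x) (is_derive_id x 1)).
have [c [ct]] := mean_value ds 0 t.
rewrite sin0 !subr0 => ->; rewrite !subr0 in ct.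
by rewrite normrM expr2 ler_wpM2r// (le_trans (normr_cos1_le1 c)).
Qed.

Lemma normc_expi1 (t : R) : normc (expi t - 1) <= 2 * `|t|.
Proof.
apply: (le_trans (ler_normcD_ReIm _)).
rewrite ReD ImD ReN ImN/= subr0 mulrDl mul1r lerD//.
  exact: normr_cos1_le1.
exact: normr_sin_le.
Qed.

Lemma normc_expi1_2 (t : R) : normc (expi t - 1) <= 2.
Proof. by rewrite (le_trans (normcD _ _))// normc_N normc1 normc_expi. Qed.

(** This second-order remainder becomes the quadratic remainder of a Fourier transform in
    [FT_derive]. *)
Lemma normc_expi_taylor (t : R) : normc (expi t - 1 - 'i * t%:C) <= 2 * `|t| ^+ 2.
Proof.
apply: (le_trans (ler_normcD_ReIm _)).
rewrite !ReD !ImD !ReN !ImN ReM ImM /= !(mul0r, mul1r, mulr0, subr0, addr0, add0r, oppr0).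
by rewrite mulrDl mul1r lerD ?normr_cos1_le ?normr_sinB_le.
Qed.

End mean_value.
Section line_derivative.
Variables (R : realType) (n : nat).
Local Notation mu := (lebesgue_rV R n).
Implicit Types (f F : 'rV[R]_n -> R[i]) (g : 'rV[R]_n -> R) (x : 'rV[R]_n).
Local Notation e_ j := (delta_mx ord0 j : 'rV[R]_n).

Lemma is_derive_line g x (v : 'rV[R]_n) (t : R) : differentiable g (x + t *: v) ->
  is_derive t (1 : R) (fun t => g (x + t *: v)) ('D_v g (x + t *: v)).
Proof.
move=> dg; have dv : derivable g (x + t *: v) v by exact: diff_derivable.
have E : (fun h : R => h^-1 *: (((fun t => g (x + t *: v)) \o shift t) (h *: 1) - g (x + t *: v))) =
    (fun h : R => h^-1 *: ((g \o shift (x + t *: v)) (h *: v) - g (x + t *: v))).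
  apply/funext => h /=; congr (_ *: (g _ - _)).
  by rewrite /shift/= scalerDl addrCA /GRing.scale/= mulr1.
split; first by rewrite /derivable E.
by rewrite /derive E.
Qed.

Lemma mean_value_line g j x (t : R) : (forall y, differentiable g y) ->
  exists c, `|c| <= `|t| /\ g (t *: e_ j + x) - g x = 'D_(e_ j) g (x + c *: e_ j) * t.
Proof.
move=> dg.
have [c []] := mean_value (fun t => is_derive_line (dg (x + t *: e_ j))) 0 t.
rewrite !subr0 scale0r addr0 => ct E; exists c; split=> //.
by rewrite [t *: _ + x]addrC.
Qed.

(** Transfers the weight from the unknown intermediate point of the mean value theorem back to [x].
    Coordinatewise it is [a^2 <= 2 (a + b)^2 + 2 b^2]. *)
Lemma japanese_shift j x (c : R) : `|c| <= 1 -> japanese x <= 2 * japanese (x + c *: e_ j).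
Proof.
move=> c1; rewrite -(@ler_pXn2r _ 2)// ?nnegrE ?mulr_ge0 ?(ltW (japanese_gt0 _))//.
rewrite exprMn !jap_sqr//.
have c2 : c ^+ 2 <= 1 by rewrite -real_normK ?num_real// exprn_ile1.
have H : dotp x x <= 2 * dotp (x + c *: e_ j) (x + c *: e_ j) + 2 * c ^+ 2.
  rewrite /dotp mulr_sumr.
  have -> : 2 * c ^+ 2 = \sum_(i < n) 2 * (c * (e_ j) ord0 i) ^+ 2.
    rewrite (bigD1 j)//= big1 ?addr0 => [|i ij].
      by rewrite mxE !eqxx mulr1.
    by rewrite mxE eqxx (negbTE ij) mulr0 expr0n mulr0.
  rewrite -big_split/=; apply: ler_sum => i _; rewrite !mxE.
  set a := x ord0 i; set b := c * _.
  rewrite -subr_ge0 (_ : _ - _ = (a + 2 * b) ^+ 2) ?sqr_ge0//; ring.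
by have := dotp_ge0 (x + c *: e_ j); lra.
Qed.

Lemma japanese_powR_shift j x (c s : R) : `|c| <= 1 -> 0 <= s ->
  japanese (x + c *: e_ j) `^ (- s) <= 2 `^ s * japanese x `^ (- s).
Proof.
move=> c1 s0; rewrite !powRN mulrC ler_pdivlMl ?powR_gt0 ?japanese_gt0//.
rewrite ler_pdivrMr ?powR_gt0 ?japanese_gt0//.
rewrite -powRM ?(ltW (japanese_gt0 _))//.
by rewrite ge0_ler_powR ?nnegrE ?mulr_ge0 ?(ltW (japanese_gt0 _))// japanese_shift.
Qed.

(* By translation invariance the difference quotients of [F] have integral 0. *)
Lemma cint_partial F j (B s : R) : (forall x, cderivable F x) ->
  (forall x, cderivable (partial j F) x) -> n%:R < s ->
  (forall x, normc (F x) <= B * japanese x `^ (- s)) ->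
  (forall x, normc (partial j F x) <= B * japanese x `^ (- s)) ->
  cint mu (partial j F) = 0.
Proof.
move=> dF dF' ns bF bF'.
have s0 : 0 <= s by rewrite (le_trans _ (ltW ns)).
have mF := cmeasurable_cderivable dF.
have iF := cintegrable_decay mF ns bF.
pose t (k : nat) : R := k.+1%:R^-1.
have t0 k : 0 < t k by rewrite invr_gt0.
have t1 k : t k <= 1 by rewrite invf_le1 ?ler1n.
pose D k x : R[i] := ((t k)^-1)%:C * (F (1 *: x + t k *: e_ j) - F x).
have iS k : cintegrable mu (fun x => F (1 *: x + t k *: e_ j)).
  by apply: cintegrable_affine => //; exact: oner_neq0.
have D0 k : cint mu (D k) = 0.
  rewrite cintZl; last exact: cintegrableB.
  rewrite cintB//.
  by rewrite [X in _ - X](cint_affine (t k *: e_ j) (oner_neq0 _) iF) normr1 expr1n mul1r subrr mulr0.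
have B0 : 0 <= B.
  have := le_trans (normc_ge0 _) (bF 0).
  by rewrite pmulr_lge0// powR_gt0// japanese_gt0.
have DE k x : complex.Re (D k x) = (t k)^-1 * (complex.Re (F (t k *: e_ j + x)) - complex.Re (F x)) /\
    complex.Im (D k x) = (t k)^-1 * (complex.Im (F (t k *: e_ j + x)) - complex.Im (F x)).
  by rewrite /D ReM ImM /= !mul0r subr0 addr0 ReD ImD ReN ImN scale1r [x + _]addrC.
(* The steps [t k] being at most 1, the mean value theorem and [japanese_powR_shift] dominate all
   difference quotients by one integrable weight. *)
have bD k x : normc (D k x) <= 2 * (B * 2 `^ s) * japanese x `^ (- s).
  have aux g : (forall y, differentiable g y) ->
      (forall y, `|'D_(e_ j) g y| <= normc (partial j F y)) ->
      `|(t k)^-1 * (g (t k *: e_ j + x) - g x)| <= B * 2 `^ s * japanese x `^ (- s).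
    move=> dg gF; have [c [ct ->]] := mean_value_line j x (t k) dg.
    rewrite mulrCA mulVf ?mulr1 ?gt_eqF//.
    apply: (le_trans (gF _)); apply: (le_trans (bF' _)).
    rewrite -mulrA ler_wpM2l// japanese_powR_shift// (le_trans ct)//.
    by rewrite gtr0_norm.
  apply: (le_trans (ler_normcD_ReIm _)); rewrite (DE k x).1 (DE k x).2.
  rewrite -mulrA mulrDl mul1r lerD//.
    apply: (aux (fun y => complex.Re (F y))) => y; first by case: (dF y).
    exact: le_trans (ler_Re_normc _).
  apply: (aux (fun y => complex.Im (F y))) => y; first by case: (dF y).
  exact: le_trans (ler_Im_normc _).
have t_cvg0 : t k @[k --> \oo] --> (0 : R) by exact: cvg_harmonic.
have cD x : normc (D k x - partial j F x) @[k --> \oo] --> 0.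
  have aux g : differentiable g x ->
      (t k)^-1 * (g (t k *: e_ j + x) - g x) - 'D_(e_ j) g x @[k --> \oo] --> 0.
    move=> dg; have := @diff_derivable _ _ _ g x (e_ j) dg.
    move=> /cvg_ex[/= l gl].
    have -> : 'D_(e_ j) g x = l by apply: cvg_lim.
    have /cvgr_dnbhsP := gl => /(_ t) H.
    rewrite -(subrr l); apply: cvgB; last exact: cvg_cst.
    by apply: H; split => // k; rewrite gt_eqF.
  apply: (@squeeze_cvgr _ _ _ _ (cst 0) (fun k =>
    `|(t k)^-1 * (complex.Re (F (t k *: e_ j + x)) - complex.Re (F x)) -
       'D_(e_ j) (fun y => complex.Re (F y)) x| +
    `|(t k)^-1 * (complex.Im (F (t k *: e_ j + x)) - complex.Im (F x)) -
       'D_(e_ j) (fun y => complex.Im (F y)) x|)).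
  - apply: nearW => k; rewrite normc_ge0/=.
    apply: (le_trans (ler_normcD_ReIm _)).
    by rewrite ReD ImD ReN ImN (DE k x).1 (DE k x).2.
  - exact: cvg_cst.
  - rewrite -(addr0 0); have [d1 d2] := dF x; apply: cvgD.
      by rewrite -(@normr0 _ R); apply: cvg_norm; exact: (aux _ d1).
    by rewrite -(@normr0 _ R); apply: cvg_norm; exact: (aux _ d2).
have mD k : cmeasurable_fun (D k).
  apply: cmeasurableM; first exact: cmeasurable_cst.
  by apply: cmeasurableB => //; case: (iS k).
have H := cint_dominated (mu := mu) mD (cmeasurable_cderivable dF') cD bD
  (integrableZl measurableT _ (integrable_japanese ns)).
have {}H : (fun k : nat => normc (cint mu (partial j F))) @ \oo --> (0 : R).
  apply: cvg_trans H; apply: near_eq_cvg; apply: nearW => k.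
  by rewrite D0 sub0r normc_N.
by apply: eq0_normc; rewrite -(cvg_lim _ H)// lim_cst.
Qed.

End line_derivative.

(** * The Fourier transform at scale [s] *)

Section fourier.
Variables (R : realType) (n : nat).
Local Notation mu := (lebesgue_rV R n).
Implicit Types (f g : 'rV[R]_n -> R[i]) (x y xi : 'rV[R]_n).
Local Notation e_ j := (delta_mx ord0 j : 'rV[R]_n).

Lemma integrable_scale (c : R) (g : 'rV[R]_n -> R) :
  mu.-integrable setT (EFin \o g) -> mu.-integrable setT (EFin \o (fun x => c * g x)).
Proof. exact: integrableZl. Qed.

Lemma dotpC x y : dotp x y = dotp y x.
Proof. by apply: eq_bigr => i _; rewrite mulrC. Qed.

Lemma dotpDl x y z : dotp (x + y) z = dotp x z + dotp y z.
Proof. by rewrite -big_split; apply: eq_bigr => i _; rewrite !mxE mulrDl. Qed.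

Lemma dotpZl c x z : dotp (c *: x) z = c * dotp x z.
Proof. by rewrite mulr_sumr; apply: eq_bigr => i _; rewrite !mxE mulrA. Qed.

Lemma dotpDr x y z : dotp z (x + y) = dotp z x + dotp z y.
Proof. by rewrite !(dotpC z) dotpDl. Qed.

Lemma dotpZr c x z : dotp z (c *: x) = c * dotp z x.
Proof. by rewrite !(dotpC z) dotpZl. Qed.

Lemma dotpBl x y z : dotp (x - y) z = dotp x z - dotp y z.
Proof. by rewrite dotpDl -scaleN1r dotpZl mulN1r. Qed.

Lemma coord_le_norm x i : `|x ord0 i| <= `|x|.
Proof.
rewrite [leRHS]mx_normrE (bigD1 (ord0, i))//= le_max lexx//.
Qed.

Lemma dotp_le_norm x y : `|dotp x y| <= n%:R * `|x| * japanese y.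
Proof.
apply: (le_trans (ler_norm_sum _ _ _)).
apply: (@le_trans _ _ (\sum_(i < n) `|x| * japanese y)).
  apply: ler_sum => i _; rewrite normrM ler_pM ?coord_le_norm//.
  exact: coord_le_jap.
by rewrite sumr_const card_ord -mulrA mulr_natl.
Qed.

(** Unnormalised, with the scale and the sign of the phase in [s]: [FT h^-1] is the inner integral
    of [Op], [FT (- h^-1)] the outer one, and [s = -1] yields the kernels. *)
Definition FT (s : R) f xi : R[i] := cint mu (fun y => expi (s * dotp y xi) * f y).

Lemma measurable_phase (s : R) xi : measurable_fun setT (fun y => s * dotp y xi).
Proof. by apply: measurable_funM => //; exact: measurable_dotp. Qed.

Lemma cmeasurable_phase (s : R) xi : cmeasurable_fun (fun y => expi (s * dotp y xi)).
Proof. exact: cmeasurable_expi (measurable_phase s xi). Qed.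

Lemma cintegrable_phase (s : R) xi f : cintegrable mu f ->
  cintegrable mu (fun y => expi (s * dotp y xi) * f y).
Proof.
apply: (cintegrableMl (B := 1)); first exact: cmeasurable_phase.
by move=> y; rewrite normc_expi.
Qed.

(** The phase is unimodular and symmetric in the two variables, so [cint_swap] exchanges the
    integrals. *)
Lemma FT_mult (s : R) f g : cintegrable mu f -> cintegrable mu g ->
  cint mu (fun xi => g xi * FT s f xi) = cint mu (fun y => f y * FT s g y).
Proof.
move=> fi gi.
have mK : cmeasurable_fun (fun z : 'rV[R]_n * 'rV[R]_n => expi (s * dotp z.2 z.1)).
  apply: cmeasurable_expi; apply: measurable_funM => //.
  by apply: measurable_dotp; [exact: measurable_snd|exact: measurable_fst].
have K1 (z : 'rV[R]_n * 'rV[R]_n) : normc (expi (s * dotp z.2 z.1)) <= 1.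
  by rewrite normc_expi.
have := cint_swap mK K1 gi fi; rewrite /= /FT => ->.
congr cint; apply/funext => y; congr (_ * _); congr cint.
by apply/funext => x; rewrite dotpC.
Qed.

Lemma normc_FT_le (s : R) f : cintegrable mu f ->
  forall xi, normc (FT s f xi) <= \int[mu]_y normc (f y).
Proof.
move=> fi xi; apply: (le_trans (normc_cint (cintegrable_phase s xi fi))).
rewrite le_eqVlt; apply/orP; left; apply/eqP; apply: eq_Rintegral => y _.
by rewrite normcM normc_expi mul1r.
Qed.

(* [expi] is expanded to second order, the remainder being controlled by the
   second moment of [f]. *)
Lemma FT_derive (s : R) f (B : R) : cmeasurable_fun f ->
  (forall y, normc (f y) <= B * japanese y `^ (- (n%:R + 3))) ->
  forall xi, cderivable (FT s f) xi /\
    forall j, partial j (FT s f) xi = FT s (fun y => 'i * s%:C * ((y ord0 j)%:C * f y)) xi.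
Proof.
move=> mf fB xi.
have jn y : 0 <= japanese y by exact: ltW (japanese_gt0 y).
have fi : cintegrable mu f.
  by apply: cintegrable_decay fB => //; rewrite ltrDl.
have jS y (a : R) : japanese y * japanese y `^ a = japanese y `^ (1 + a).
  by rewrite powRD ?powRr1// (gt_eqF (japanese_gt0 y)) implybT.
have mc j : cmeasurable_fun (fun y : 'rV[R]_n => (y ord0 j)%:C).
  by apply: cmeasurable_real; exact: measurable_rV_coord.
have B0 y : 0 <= B * japanese y `^ (- (n%:R + 3)).
  exact: le_trans (normc_ge0 _) (fB y).
have fj j : cintegrable mu (fun y => 'i * s%:C * ((y ord0 j)%:C * f y)).
  apply: cintegrableZl.
  apply: (@cintegrable_decay _ _ _ B (n%:R + 2)).
  - exact: cmeasurableM.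
  - by rewrite ltrDl.
  - move=> y; rewrite normcM normcr.
    apply: (le_trans (ler_pM _ _ (@coord_le_jap _ _ 1 y j _) (fB y))) => //.
      exact: normc_ge0.
    by rewrite mulrCA jS; rewrite (_ : 1 + - (n%:R + 3) = - (n%:R + 2))//; ring.
(* Two of the [n + 3] powers of decay pay for the second moment, and [n + 1] remain for
   integrability. The factor [n] comes from bounding [<y, u>] by the sup norm of [u]. *)
have f2 : mu.-integrable setT (EFin \o (fun y => 2 * (`|s| * n%:R) ^+ 2 * (B * japanese y `^ (- (n%:R + 1))))).
  do 2 apply: integrable_scale.
  by apply: integrable_japanese; rewrite ltrDl.
pose L j := FT s (fun y => 'i * s%:C * ((y ord0 j)%:C * f y)) xi.
pose K := \int[mu]_y (2 * (`|s| * n%:R) ^+ 2 * (B * japanese y `^ (- (n%:R + 1)))).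
have key u : normc (FT s f (u + xi) - FT s f xi - \sum_j (u ord0 j)%:C * L j) <= K * `|u| ^+ 2.
  have iL j : cintegrable mu (fun y => expi (s * dotp y xi) * ('i * s%:C * ((y ord0 j)%:C * f y))).
    exact: cintegrable_phase.
  rewrite /FT /L -cintB; [|exact: cintegrable_phase..].
  have -> : \sum_j (u ord0 j)%:C * FT s (fun y => 'i * s%:C * ((y ord0 j)%:C * f y)) xi =
     cint mu (fun y => \sum_j (u ord0 j)%:C * (expi (s * dotp y xi) * ('i * s%:C * ((y ord0 j)%:C * f y)))).
    rewrite cint_sum; last by move=> j; exact: cintegrableZl.
    by apply: eq_bigr => j _; rewrite cintZl.
  rewrite -cintB; last 2 first.
  - by apply: cintegrableB; exact: cintegrable_phase.
  - by apply: cintegrable_sum => j; exact: cintegrableZl.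
  rewrite [leRHS]mulrC -RintegralZl//.
  apply: normc_cint_le.
  - apply: cmeasurableB.
      by apply: cmeasurableB; apply: cmeasurableM => //; exact: cmeasurable_phase.
    apply: cmeasurable_sum => j; apply: cmeasurableM; first exact: cmeasurable_cst.
    exact: cintegrable_measurable (iL j).
  - move=> y.
    rewrite (_ : _ - _ = expi (s * dotp y xi) *
      (expi (s * dotp y u) - 1 - 'i * (s * dotp y u)%:C) * f y); last first.
      rewrite dotpDr mulrDr expiD.
      rewrite (_ : \sum_j _ = 'i * (s * dotp y u)%:C * expi (s * dotp y xi) * f y); first by ring.
      rewrite /dotp !rmorphM rmorph_sum/= !(mulr_suml, mulr_sumr).
      by apply: eq_bigr => j _; rewrite rmorphM/=; ring.
    rewrite !normcM normc_expi mul1r.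
    apply: (le_trans (ler_wpM2r (normc_ge0 _) (normc_expi_taylor _))).
    apply: (le_trans (ler_wpM2l _ (fB y))); first by rewrite mulr_ge0.
    have H : `|s * dotp y u| ^+ 2 <= (`|s| * n%:R) ^+ 2 * `|u| ^+ 2 * japanese y `^ 2.
      rewrite (powR_mulrn 2 (jn y)) -!exprMn lerXn2r ?nnegrE ?mulr_ge0// normrM dotpC -!mulrA.
      by rewrite ler_wpM2l// mulrA dotp_le_norm.
    apply: (le_trans (ler_wpM2r (B0 y) (ler_wpM2l _ H))) => //.
    rewrite le_eqVlt; apply/orP; left; apply/eqP.
    rewrite (_ : - (n%:R + 1) = 2 + - (n%:R + 3)); last by ring.
    rewrite (@powRD _ (japanese y) 2); last by rewrite (gt_eqF (japanese_gt0 y)) implybT.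
    by ring.
  - exact: (integrable_scale (`|u| ^+ 2) f2).
have reL j (u : R) : complex.Re (u%:C * L j) = u * complex.Re (L j).
  by rewrite ReM mul0r subr0.
have imL j (u : R) : complex.Im (u%:C * L j) = u * complex.Im (L j).
  by rewrite ImM mul0r addr0.
have [d1 p1] : differentiable (fun y => complex.Re (FT s f y)) xi /\
    forall i, 'D_(e_ i) (fun y => complex.Re (FT s f y)) xi = complex.Re (L i).
  apply: (frechet_of_quadratic (B := K)) => u.
  apply: le_trans (key u); apply: le_trans (ler_Re_normc _).
  rewrite !ReD !ReN (raddf_sum (@complex.Re R : {additive _ -> _}))/=.
  by under eq_bigr do rewrite -reL.
have [d2 p2] : differentiable (fun y => complex.Im (FT s f y)) xi /\
    forall i, 'D_(e_ i) (fun y => complex.Im (FT s f y)) xi = complex.Im (L i).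
  apply: (frechet_of_quadratic (B := K)) => u.
  apply: le_trans (key u); apply: le_trans (ler_Im_normc _).
  rewrite !ImD !ImN (raddf_sum (@complex.Im R : {additive _ -> _}))/=.
  by under eq_bigr do rewrite -imL.
split; first by split.
by move=> j; rewrite /partial p1 p2; apply: complexE_eq.
Qed.

End fourier.

(** * Derivatives and decay of Fourier transforms *)

Section fourier_schwartz.
Variables (R : realType) (n : nat).
Local Notation mu := (lebesgue_rV R n).
Implicit Types (f g : 'rV[R]_n -> R[i]) (x y xi : 'rV[R]_n).
Local Notation e_ j := (delta_mx ord0 j : 'rV[R]_n).

Lemma partial_phase (s : R) xi y :
  cderivable (fun y => expi (s * dotp y xi)) y /\
  forall j, partial j (fun y => expi (s * dotp y xi)) y =
    'i * (s * xi ord0 j)%:C * expi (s * dotp y xi).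
Proof.
have [dq pq] : differentiable (fun y => s * dotp y xi) y /\
    forall i, 'D_(e_ i) (fun y => s * dotp y xi) y = s * xi ord0 i.
  apply: (frechet_of_quadratic (B := 0)) => u.
  rewrite dotpDl mulrDr addrK mul0r normr_le0 /dotp mulr_sumr subr_eq0.
  by apply/eqP; apply: eq_bigr => i _; ring.
have dc j := derive_comp j (is_derive_cos (s * dotp y xi)) dq.
have ds j := derive_comp j (is_derive_sin (s * dotp y xi)) dq.
split; first split.
- apply: differentiable_comp => //; apply/derivable1_diffP.
  by have [] := is_derive_cos (s * dotp y xi).
- apply: differentiable_comp => //; apply/derivable1_diffP.
  by have [] := is_derive_sin (s * dotp y xi).
move=> j; apply: complexE_eq; rewrite /partial/=.
  by rewrite [LHS](dc j).2 pq; ring.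
by rewrite [LHS](ds j).2 pq; ring.
Qed.

(** Integration by parts: the derivative of phase times [f] has integral 0 by [cint_partial], and
    the Leibniz rule splits it into the two sides. *)
Lemma FT_partial (s : R) f (B r : R) j xi : (forall x, cderivable f x) ->
  (forall x, cderivable (partial j f) x) -> n%:R < r ->
  (forall x, normc (f x) <= B * japanese x `^ (- r)) ->
  (forall x, normc (partial j f x) <= B * japanese x `^ (- r)) ->
  FT s (partial j f) xi = - ('i * (s * xi ord0 j)%:C) * FT s f xi.
Proof.
move=> df df' nr bf bf'.
pose c := 'i * (s * xi ord0 j)%:C : R[i].
pose e y := expi (s * dotp y xi).
have pE : partial j (fun y => e y * f y) = (fun y => c * (e y * f y) + e y * partial j f y).
  apply/funext => y; have [de pe] := partial_phase s xi y.
  by rewrite partialM// pe mulrA.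
have if_ : cintegrable mu (fun y => e y * f y).
  by apply: cintegrable_phase; apply: cintegrable_decay bf => //; exact: cmeasurable_cderivable.
have if' : cintegrable mu (fun y => e y * partial j f y).
  by apply: cintegrable_phase; apply: cintegrable_decay bf' => //; exact: cmeasurable_cderivable.
have B0 : 0 <= B.
  have := le_trans (normc_ge0 _) (bf 0).
  by rewrite pmulr_lge0// powR_gt0// japanese_gt0.
have : cint mu (partial j (fun y => e y * f y)) = 0.
  have de x : cderivable e x by have [] := partial_phase s xi x.
  (* A single constant must bound both the product and its derivative: [B] for the first,
     [|c| B + B] for the second. *)
  apply: (@cint_partial _ _ _ _ ((normc c + 1) * B) r) => //.
  - by move=> x; exact: cderivableM.
  - rewrite pE => x; apply: cderivableD; last exact: cderivableM.
    by apply: cderivableM; [exact: cderivable_cst|exact: cderivableM].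
  - move=> x; rewrite normcM normc_expi mul1r (le_trans (bf x))//.
    by rewrite ler_wpM2r ?powR_ge0// mulrDl mul1r lerDr mulr_ge0// normc_ge0.
  - rewrite pE => x; rewrite (le_trans (normcD _ _))//.
    rewrite (normcM c) !(normcM (e x)) normc_expi !mul1r.
    by rewrite -mulrA mulrDl mul1r lerD// ler_wpM2l// normc_ge0.
rewrite pE cintD//; last exact: cintegrableZl.
rewrite cintZl// => /eqP; rewrite addrC addr_eq0 => /eqP E.
by rewrite /FT [LHS]E mulNr.
Qed.

Lemma FT_iter_partial (s : R) f i m xi : psch f ->
  FT s (iter m (partial i) f) xi = (- ('i * (s * xi ord0 i)%:C)) ^+ m * FT s f xi.
Proof.
move=> pf; elim: m => [|m ih]; first by rewrite expr0 mul1r.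
rewrite exprS -mulrA -ih iterS.
have [B B0 HB] := rapid_powR (n%:R + 1) (pf i m).
have [B' B'0 HB'] := rapid_powR (n%:R + 1) (pf i m.+1).
apply: (@FT_partial _ _ (Num.max B B') (n%:R + 1)).
- by case: (pf i m).
- by case: (pf i m.+1).
- by rewrite ltrDl.
- by move=> x; rewrite (le_trans (HB x))// ler_wpM2r ?powR_ge0// le_max lexx.
- by move=> x; rewrite (le_trans (HB' x))// ler_wpM2r ?powR_ge0// le_max lexx orbT.
Qed.

Lemma normcX (z : R[i]) m : normc (z ^+ m) = normc z ^+ m.
Proof. by elim: m => [|m ih]; rewrite ?expr0 ?normc1// !exprS normcM ih. Qed.

(** Lets decay in every direction be read off from derivatives along one axis: outside a bounded
    region some coordinate is comparable with [<x>]. *)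
Lemma japanese_le_coord x : japanese x <= n.+1%:R \/
  exists i, japanese x <= n.+1%:R * `|x ord0 i|.
Proof.
have j0 := japanese_gt0 x; have n1 : (1 : R) <= n.+1%:R by rewrite ler1n.
have [|J] := leP (japanese x) n.+1%:R; [by left|right].
apply: contrapT => H.
have H' i : n.+1%:R * `|x ord0 i| < japanese x.
  by rewrite ltNge; apply/negP => h; apply: H; exists i.
(* If no coordinate were comparable, [(n + 1) <x>^2 = (n + 1) + (n + 1) |x|^2] would be less than
   [<x>^2 + n <x>^2]. *)
have : n.+1%:R * japanese x ^+ 2 < n.+1%:R * japanese x ^+ 2; last by rewrite ltxx.
rewrite {1}jap_sqr// mulrDr mulr1.
apply: (@lt_le_trans _ _ (japanese x ^+ 2 + \sum_(i < n) japanese x ^+ 2)); last first.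
  by rewrite sumr_const card_ord -mulrS mulr_natl.
apply: ltr_leD.
  by rewrite (lt_le_trans J)// expr2 ler_peMr ?(ltW j0)// japanese_ge1.
rewrite /dotp mulr_sumr; apply: ler_sum => i _.
apply: (@le_trans _ _ ((n.+1%:R * `|x ord0 i|) ^+ 2)).
  rewrite exprMn real_normK ?num_real// -expr2 ler_wpM2r ?sqr_ge0//.
  by rewrite expr2 ler_peMr// (le_trans _ n1).
by rewrite lerXn2r ?nnegrE ?mulr_ge0 ?(ltW j0)// ltW.
Qed.

Lemma psch_coordM f j : psch f -> psch (fun x => (x ord0 j)%:C * f x).
Proof. by apply: psch_slowM; exact: pslow_coord. Qed.

(** Where [<xi>] is bounded the L^1 norm of [f] suffices; elsewhere [N] integrations by parts along
    a coordinate comparable with [<xi>] yield [<xi> ^ (- N)]. *)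
Lemma FT_rapid (s : R) f : s != 0 -> (0 < n)%N -> psch f -> rapid (FT s f).
Proof.
move=> s0 n0 pf.
(* [psch] is vacuous in dimension 0, so a coordinate is needed to extract any information from
   it. *)
have rf : rapid f by exact: (pf (Ordinal n0) 0%N).
have [B B0 HB] := rapid_powR (n%:R + 3) rf.
split=> [xi|N].
  by have [] := FT_derive s (rapid_cmeasurable rf) HB xi.
pose I m i := \int[mu]_y normc (iter m (partial i) f y).
have I0 m i : 0 <= I m i by apply: Rintegral_ge0 => y _; exact: normc_ge0.
(* The coordinate used depends on [xi], hence the sum over all of them. *)
exists (n.+1%:R ^+ N * (I 0%N (Ordinal n0) + (`|s| ^+ N)^-1 * \sum_i I N i)) => xi.
have j0 := japanese_gt0 xi.
have sN : 0 <= (`|s| ^+ N)^-1 by rewrite invr_ge0 exprn_ge0.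
have [jx|[i jx]] := japanese_le_coord xi.
  apply: ler_pM; rewrite ?exprn_ge0 ?(ltW j0) ?normc_ge0//.
    by rewrite lerXn2r ?nnegrE ?(ltW j0).
  rewrite (le_trans (normc_FT_le s (rapid_cintegrable rf) xi))// lerDl mulr_ge0//.
  exact: sumr_ge0.
apply: (@le_trans _ _ ((n.+1%:R * `|xi ord0 i|) ^+ N * normc (FT s f xi))).
  by rewrite ler_wpM2r ?normc_ge0// lerXn2r ?nnegrE ?mulr_ge0 ?(ltW j0).
rewrite exprMn -mulrA ler_wpM2l ?exprn_ge0//.
rewrite -[leLHS]add0r lerD// ler_pdivlMl ?exprn_gt0 ?normr_gt0// mulrA -exprMn.
have := normc_FT_le s (rapid_cintegrable (pf i N)) xi.
rewrite FT_iter_partial// normcM.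
have -> : normc ((- ('i * (s * xi ord0 i)%:C)) ^+ N) = (`|s| * `|xi ord0 i|) ^+ N.
  rewrite normcX; congr (_ ^+ _).
  by rewrite normc_N normcM normcr normrM /normc/= expr0n expr1n add0r sqrtr1 mul1r.
move=> /le_trans; apply; rewrite (bigD1 i)//= lerDl.
exact: sumr_ge0.
Qed.

(** A derivative of a transform is the transform of [f] times a coordinate, so transforms of [psch]
    functions form a class closed under [partial]. The transform thereby upgrades pure derivatives
    to mixed ones. *)
Lemma FT_schwartz (s : R) f : s != 0 -> (0 < n)%N -> psch f -> schwartz (FT s f).
Proof.
move=> s0 n0 pf.
apply: (@schwartz_stable _ _ (fun g => exists2 f, psch f & g = FT s f)); last by exists f.
  by move=> _ [g pg ->]; exact: FT_rapid.
move=> _ i [g pg ->]; exists (fun y => 'i * s%:C * ((y ord0 i)%:C * g y)).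
  by apply: psch_Z; exact: psch_coordM.
have rg : rapid g by exact: (pg (Ordinal n0) 0%N).
have [B B0 HB] := rapid_powR (n%:R + 3) rg.
by apply/funext => xi; have [_ ->] := FT_derive s (rapid_cmeasurable rg) HB xi.
Qed.

End fourier_schwartz.

(** * Fourier inversion *)

Section poisson_kernel.
Variable R : realType.
Local Notation leb := (@lebesgue_measure R).

Lemma is_derive_continuous (f f' : R -> R) :
  (forall t : R, is_derive t (1 : R) f (f' t)) -> continuous f.
Proof.
move=> df t; apply: differentiable_continuous; apply/derivable1_diffP.
by have [] := df t.
Qed.

(* The primitive of [expR (- t) * (1 + cos (w * t))]; adding 1 to the cosine
   keeps the integrand nonnegative. *)
Let F (w t : R) := expR (- t) * ((w * sin (w * t) - cos (w * t)) / (1 + w ^+ 2) - 1).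

Let dlin (w t : R) : is_derive t (1 : R) (fun t : R => w * t) w.
Proof.
have := is_deriveZ w (is_derive_id t (1 : R)).
by rewrite /GRing.scale/= mulr1.
Qed.

Let dexpN (t : R) : is_derive t (1 : R) (fun t => expR (- t)) (- expR (- t)).
Proof.
have dn : is_derive t (1 : R) (fun t : R => - t) (- 1).
  exact: is_deriveN (is_derive_id t (1 : R)).
have := is_derive1_comp (is_derive_expR (- t)) dn.
by rewrite mulrN1.
Qed.

Let dcosw (w t : R) : is_derive t (1 : R) (fun t => cos (w * t)) (- sin (w * t) * w).
Proof. exact: is_derive1_comp (is_derive_cos (w * t)) (dlin w t). Qed.

Let dsinw (w t : R) : is_derive t (1 : R) (fun t => sin (w * t)) (cos (w * t) * w).
Proof. exact: is_derive1_comp (is_derive_sin (w * t)) (dlin w t). Qed.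

Let is_derive_F (w t : R) : is_derive t (1 : R) (F w) (expR (- t) * (1 + cos (w * t))).
Proof.
have w1 : 1 + w ^+ 2 != 0 by rewrite gt_eqF// ltr_wpDr// sqr_ge0.
have dq := is_deriveB (is_deriveZ (1 + w ^+ 2)^-1 (is_deriveB (is_deriveZ w (dsinw w t)) (dcosw w t)))
  (is_derive_cst (1 : R) t (1 : R)).
have E : F w = (fun t => expR (- t)) * ((1 + w ^+ 2)^-1 \*: (w \*: (fun t => sin (w * t)) - (fun t => cos (w * t))) - cst 1).
  by apply/funext => u; rewrite /F; congr (_ * (_ - _)); exact: mulrC.
have H := is_deriveM (dexpN t) dq; rewrite E; apply: is_derive_eq H _.
rewrite /GRing.scale/= -[X in _ + X * _ = _]/((1 + w ^+ 2)^-1 * (w * sin (w * t) - cos (w * t)) - 1).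
by move: (expR _) (sin _) (cos _) => a b c; field.
Qed.

Let continuous_h (w : R) : continuous (fun t : R => expR (- t) * (1 + cos (w * t))).
Proof. exact: is_derive_continuous. Qed.

Let F_cvg0 w : F w x @[x --> +oo%R] --> (0 : R).
Proof.
pose C := (`|w| + 1) / (1 + w ^+ 2) + 1.
have w1 : 0 < 1 + w ^+ 2 by rewrite ltr_wpDr// sqr_ge0.
have H : expR (- x) * C @[x --> +oo%R] --> (0 : R).
  by rewrite -(mul0r C); apply: cvgM; [exact: cvgr_expR|exact: cvg_cst].
have H' : - (expR (- x) * C) @[x --> +oo%R] --> (0 : R) by rewrite -oppr0; exact: cvgN.
apply: (squeeze_cvgr _ H' H); apply: nearW => x.
rewrite -ler_norml /F normrM ger0_norm ?expR_ge0// ler_wpM2l ?expR_ge0//.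
apply: (le_trans (ler_normB _ _)); rewrite normr1 lerD2r normrM normfV (gtr0_norm w1).
rewrite ler_wpM2r ?invr_ge0 ?(ltW w1)// (le_trans (ler_normB _ _))// lerD//.
  by rewrite normrM ler_piMr// ler_norml sin_geN1 sin_le1.
by rewrite ler_norml cos_geN1 cos_le1.
Qed.

Lemma integral_laplace_cos (w : R) :
  (\int[leb]_(t in `[0%R, +oo[) (expR (- t) * (1 + cos (w * t)))%:E =
   (1 + (1 + w ^+ 2)^-1)%:E)%E.
Proof.
have dF t : is_derive t (1 : R) (F w) (expR (- t) * (1 + cos (w * t))) := is_derive_F w t.
rewrite (@ge0_continuous_FTC2y _ _ (F w) 0 0).
- rewrite /F oppr0 expR0 !mulr0 sin0 cos0; congr EFin; ring.
- by move=> t _; rewrite mulr_ge0 ?expR_ge0// -lerBlDl sub0r cos_geN1.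
- by apply: continuous_subspaceT; exact: continuous_h.
- exact: F_cvg0.
- by move=> t _; have [] := dF t.
- by apply: cvg_at_right_filter; exact: (is_derive_continuous dF).
- by move=> t _; rewrite derive1E; have [] := dF t.
Qed.

Lemma integral_cos_expR (w : R) :
  (\int[leb]_t (expR (- `|t|) * (1 + cos (w * t)))%:E =
   (2 * (1 + (1 + w ^+ 2)^-1))%:E)%E.
Proof.
rewrite ge0_symfun_integralT.
- rewrite EFinM -integral_laplace_cos; congr (_ * _)%E.
  rewrite (_ : [set x | 0 <= x] = `[0, +oo[%classic); last first.
    by apply/seteqP; split=> t /=; rewrite in_itv/= andbT.
  apply: eq_integral => t; rewrite inE/= in_itv/= andbT => t0.
  by rewrite ger0_norm.
- by move=> t; rewrite mulr_ge0 ?expR_ge0// -lerBlDl sub0r cos_geN1.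
- move=> t; apply: (@continuousM _ _ (fun t : R => expR (- `|t|)) (fun t => 1 + cos (w * t))).
    apply: (@continuous_comp _ _ _ (fun t : R => `|t|) (fun t => expR (- t))).
      exact: norm_continuous.
    exact: (is_derive_continuous dexpN).
  by apply: (is_derive_continuous (f' := fun t => 0 + - sin (w * t) * w)) => u;
     exact: (is_deriveD (is_derive_cst (1 : R) u (1 : R)) (dcosw w u)).
- by move=> t /=; rewrite normrN mulrN cosN.
Qed.

Let mE : measurable_fun setT (fun t : R => expR (- `|t|)).
Proof.
apply: (measurableT_comp (g := fun t : R => - `|t|)).
  exact: continuous_measurable_fun (@continuous_expR R).
by apply: measurable_funN; exact: (continuous_measurable_fun (@norm_continuous R R)).
Qed.

Lemma integrable_expR_norm : leb.-integrable setT (fun t : R => (expR (- `|t|))%:E).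
Proof.
apply/integrableP; split; first by apply/measurable_EFinP.
under eq_integral do rewrite abse_EFin ger0_norm ?expR_ge0//.
apply: (@le_lt_trans _ _ (\int[leb]_t (expR (- `|t|) * (1 + cos (0 * t)))%:E)%E).
  apply: ge0_le_integral => //.
  - by apply/measurable_EFinP.
  - apply/measurable_EFinP; apply: measurable_funM => //.
    by under eq_fun do rewrite mul0r cos0; exact: measurable_cst.
  - by move=> t _; rewrite lee_fin mul0r cos0 ler_peMr ?expR_ge0// lerDl.
by rewrite integral_cos_expR ltry.
Qed.

Lemma integral_odd (g : R -> R) : leb.-integrable setT (EFin \o g) ->
  (forall t, g (- t) = - g t) -> \int[leb]_t g t = 0.
Proof.
move=> ig og; have mg := measurable_int leb ig.
have N10 : (- 1 : R) != 0 by rewrite oppr_eq0 oner_eq0.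
rewrite /Rintegral integralE.
have H : (\int[leb]_t (EFin \o g)^\+%E t = \int[leb]_t (EFin \o g)^\-%E t)%E.
  have := ge0_integral_affine1 0 N10 (measurable_funepos mg) (funepos_ge0 _).
  rewrite normrN1 mul1e => ->; apply: eq_integral => t _.
  by rewrite funeposE funenegE /= mulN1r addr0 og EFinN.
by rewrite H subee//; exact: integrable_neg_fin_num ig.
Qed.

Lemma cintegrable_poisson (w : R) :
  cintegrable leb (fun t => expi (w * t) * (expR (- `|t|))%:C).
Proof.
apply: (@cintegrable_le _ (measurableTypeR R) R leb _ (fun t => expR (- `|t|))).
- apply: cmeasurableM; last exact: cmeasurable_real.
  by apply: cmeasurable_expi; exact: measurable_funM.
- by move=> t; rewrite normcM normc_expi normcr mul1r ger0_norm// expR_ge0.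
- exact: integrable_expR_norm.
Qed.

Lemma cint_poisson (w : R) :
  cint leb (fun t => expi (w * t) * (expR (- `|t|))%:C) = (2 / (1 + w ^+ 2))%:C.
Proof.
have ip := cintegrable_poisson w.
apply: complexE_eq.
  have iR := cintegrable_Re ip.
  (* At [w = 0] the integrand is [2 exp (- |t|)]; half of that integral removes the 1 added to the
     cosine. The imaginary part is odd and vanishes. *)
  transitivity (\int[leb]_t (expR (- `|t|) * (1 + cos (w * t))) - \int[leb]_t (expR (- `|t|) * (1 + cos (0 * t))) / 2).
    have i1 : leb.-integrable setT (EFin \o (fun t => 2^-1 * (expR (- `|t|) * (1 + cos (0 * t))))).
      apply: eq_integrable integrable_expR_norm => // t _ /=.
      by congr EFin; rewrite mul0r cos0; field.
    have E2 : \int[leb]_t (expR (- `|t|) * (1 + cos (0 * t))) / 2 = \int[leb]_t (expR (- `|t|)).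
      rewrite mulrC -RintegralZl//.
        by apply: eq_Rintegral => t _; rewrite mul0r cos0; field.
      have := integrableZl measurableT 2 i1; apply: eq_integrable => // t _ /=.
      by rewrite -EFinM mulrA mulfV ?pnatr_eq0// mul1r.
    have E1 : \int[leb]_t (expR (- `|t|) * (1 + cos (w * t))) = \int[leb]_t expR (- `|t|) +
       \int[leb]_t complex.Re (expi (w * t) * (expR (- `|t|))%:C).
      rewrite -RintegralD//; last exact: integrable_expR_norm.
      by apply: eq_Rintegral => t _; rewrite ReM/=; ring.
    by rewrite E1 E2 addrC addKr.
  rewrite /Rintegral !integral_cos_expR/= expr0n/= addr0 invr1; field.
  by rewrite gt_eqF// ltr_wpDr// sqr_ge0.
apply: integral_odd; first exact: cintegrable_Im ip.
by move=> t; rewrite !ImM/= normrN mulrN sinN; ring.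
Qed.

(** This total mass produces the constant [(2 pi) ^ n] of the inversion formula. *)
Lemma integral_oneDsqr : (\int[leb]_t (2 / (1 + t ^+ 2))%:E = (2 * pi)%:E)%E.
Proof.
rewrite ge0_symfun_integralT.
- rewrite (_ : [set x | 0 <= x] = `[0, +oo[%classic); last first.
    by apply/seteqP; split=> t /=; rewrite in_itv/= andbT.
  under eq_integral do rewrite EFinM.
  rewrite ge0_integralZl//.
  + by rewrite integral0y_oneDsqr -!EFinM; congr EFin; field.
  + apply/measurable_EFinP; apply: measurable_funTS.
    exact: continuous_measurable_fun (@continuous_oneDsqrV R).
  + by move=> t _; rewrite lee_fin invr_ge0 addr_ge0// sqr_ge0.
- by move=> t; rewrite divr_ge0// addr_ge0// sqr_ge0.
- move=> t; apply: (@continuousM _ _ (fun=> 2) (fun t : R => (oneDsqr t)^-1) t).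
    exact: cst_continuous.
  exact: continuous_oneDsqrV.
- by move=> t /=; rewrite sqrrN.
Qed.

End poisson_kernel.
Section fourier_inversion.
Variable R : realType.
Local Notation leb := (@lebesgue_measure R).

Lemma cint_rV0 (f : 'rV[R]_0 -> R[i]) : cmeasurable_fun f ->
  cintegrable (lebesgue_rV R 0) f /\ cint (lebesgue_rV R 0) f = f 0.
Proof.
move=> mf; have E (g : 'rV[R]_0 -> R) : measurable_fun setT g ->
    (\int[lebesgue_rV R 0]_x (g x)%:E = (g 0)%:E)%E.
  by move=> mg; rewrite ge0_integral_rV0//; exact/measurable_EFinP.
split.
  split=> //; apply/integrableP; split.
    by apply/measurable_EFinP; exact: measurable_normc.
  under eq_integral do rewrite abse_EFin ger0_norm ?normc_ge0//.
  by rewrite E ?ltry//; exact: measurable_normc.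
by case: mf => m1 m2; apply: complexE_eq; rewrite /cint/= /Rintegral E.
Qed.

Lemma cint_rVS n (F : 'rV[R]_n.+1 -> R[i]) : cmeasurable_fun F ->
  cintegrable (leb \x lebesgue_rV R n)%E (fun z => F (cons_rV z)) ->
  cintegrable (lebesgue_rV R n.+1) F /\
  cint (lebesgue_rV R n.+1) F = cint (leb \x lebesgue_rV R n)%E (fun z => F (cons_rV z)).
Proof.
move=> mF iF; have mc := @measurable_cons_rV R n.
split.
  split=> //; apply/integrableP; split.
    by apply/measurable_EFinP; exact: measurable_normc.
  rewrite ge0_integral_pushforward//.
    by case: iF => _ /integrableP[_].
  by apply: measurableT_comp => //; apply/measurable_EFinP; exact: measurable_normc.
have [m1 m2] := mF.
apply: complexE_eq; rewrite /cint/= /Rintegral; congr fine.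
  apply: (integral_pushforward mc _ (cintegrable_Re iF) measurableT).
  exact/measurable_EFinP.
apply: (integral_pushforward mc _ (cintegrable_Im iF) measurableT).
exact/measurable_EFinP.
Qed.

Lemma cint_prod_rV n (u : 'I_n -> R -> R[i]) : (forall i, cintegrable leb (u i)) ->
  cintegrable (lebesgue_rV R n) (fun x => \prod_i u i (x ord0 i)) /\
  cint (lebesgue_rV R n) (fun x => \prod_i u i (x ord0 i)) = \prod_i cint leb (u i).
Proof.
have mprod m (p : 'I_m -> R -> R[i]) : (forall i, cintegrable leb (p i)) ->
    cmeasurable_fun (fun x : 'rV[R]_m => \prod_i p i (x ord0 i)).
  move=> ip; elim: (index_enum _) => [|i s ih].
    by under eq_fun do rewrite big_nil; exact: cmeasurable_cst.
  under eq_fun do rewrite big_cons.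
  apply: cmeasurableM => //.
  exact: (cmeasurable_comp (measurable_rV_coord i) (cintegrable_measurable (ip i))).
elim: n u => [|n ih] u iu.
  have [h1 h2] := cint_rV0 (mprod _ _ iu); split=> //.
  by rewrite h2 !big_ord0.
have [ih1 ih2] := ih (fun i => u (lift ord0 i)) (fun i => iu (lift ord0 i)).
set G := (fun x : 'rV[R]_n => _) in ih1 ih2.
have FE : (fun z => \prod_i u i (cons_rV z ord0 i)) =
    (fun z : measurableTypeR R * 'rV[R]_n => u ord0 z.1 * G z.2).
  apply/funext => z; rewrite big_ord_recl cons_rV0; congr (_ * _).
  by apply: eq_bigr => i _; rewrite cons_rVS.
have iF : cintegrable (leb \x lebesgue_rV R n)%E (fun z => \prod_i u i (cons_rV z ord0 i)).
  rewrite FE; apply: (@cintegrable_prod _ _ (measurableTypeR R) _ R leb (lebesgue_rV R n) _ (u ord0) G) => //.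
    apply: cmeasurableM.
      exact: (cmeasurable_comp measurable_fst (cintegrable_measurable (iu ord0))).
    exact: (cmeasurable_comp measurable_snd (cintegrable_measurable ih1)).
  by move=> z; rewrite normcM.
have [h1 h2] := cint_rVS (mprod _ _ iu) iF; split=> //.
rewrite h2 FE in iF *; rewrite cint_fubini1//=; last first.
  by move=> t; exact: cintegrableZl.
rewrite big_ord_recl -ih2.
transitivity (cint leb (fun t => cint (lebesgue_rV R n) G * u ord0 t)).
  by congr cint; apply/funext => t; rewrite cintZl// mulrC.
by rewrite cintZl// mulrC.
Qed.

Lemma expi_sum n (a : 'I_n -> R) : expi (\sum_i a i) = \prod_i expi (a i).
Proof. by rewrite (big_morph _ (@expiD R) (expi0 R)). Qed.

Section inversion.
Variable n : nat.
Local Notation mu := (lebesgue_rV R n).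
Implicit Types (x y xi w : 'rV[R]_n) (f : 'rV[R]_n -> R[i]).

(** The regularising factor of the inversion formula. A product of one-dimensional exponentials is
    chosen because its transform [P] follows from elementary primitives. *)
Let Phi x : R := \prod_i expR (- `|x ord0 i|).
Let P w : R := \prod_i (2 / (1 + w ord0 i ^+ 2)).

Let PhiE w x : expi (1 * dotp x w) * (Phi x)%:C =
  \prod_i (expi (w ord0 i * x ord0 i) * (expR (- `|x ord0 i|))%:C).
Proof.
rewrite mul1r big_split/= -expi_sum rmorph_prod/= dotpC.
by [].
Qed.

Let FT_Phi w : FT 1 (fun x => (Phi x)%:C) w = (P w)%:C.
Proof.
rewrite /FT (eq_cint mu (PhiE w)).
have [_ ->] := cint_prod_rV (fun i => cintegrable_poisson (w ord0 i)).
by under eq_bigr do rewrite cint_poisson; rewrite rmorph_prod.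
Qed.

Let Phi_ge0 x : 0 <= Phi x.
Proof. by apply: prodr_ge0 => i _; exact: expR_ge0. Qed.

Let Phi_le1 x : Phi x <= 1.
Proof.
apply: prodr_ile1 => i _.
by rewrite expR_ge0/= -expR0 ler_expR oppr_le0.
Qed.

Let mPhi : measurable_fun setT Phi.
Proof.
apply: measurable_prod => i _.
apply: (measurableT_comp (continuous_measurable_fun (@continuous_expR R))).
apply: measurable_funN.
exact: (measurableT_comp (continuous_measurable_fun (@norm_continuous R R)) (measurable_rV_coord i)).
Qed.

Let iPhi : cintegrable mu (fun x => (Phi x)%:C).
Proof.
have [+ _] := cint_prod_rV (fun i : 'I_n => cintegrable_poisson 0).
congr cintegrable; apply/funext => x; rewrite /Phi rmorph_prod.
by apply: eq_bigr => i _; rewrite mul0r expi0 mul1r.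
Qed.

Let P_ge0 w : 0 <= P w.
Proof. by apply: prodr_ge0 => i _; rewrite divr_ge0// addr_ge0// sqr_ge0. Qed.

Let measurable_oneDsqr : measurable_fun setT (fun t : R => 2 / (1 + t ^+ 2)).
Proof.
apply: measurable_funM => //.
exact: (continuous_measurable_fun (@continuous_oneDsqrV R)).
Qed.

Let iP : mu.-integrable setT (EFin \o P).
Proof.
apply: (@integrable_prod_rV R n (fun t => 2 / (1 + t ^+ 2)) measurable_oneDsqr).
  by move=> t; rewrite divr_ge0// addr_ge0// sqr_ge0.
by rewrite integral_oneDsqr ltry.
Qed.

Let intP : \int[mu]_w P w = (2 * pi) ^+ n.
Proof.
rewrite /Rintegral (ge0_integral_prod_rV (q := fun _ t => 2 / (1 + t ^+ 2)))//; last first.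
  by move=> _ t; rewrite divr_ge0// addr_ge0// sqr_ge0.
under eq_bigr do rewrite integral_oneDsqr.
rewrite prodEFin/= prodr_const card_ord.
by [].
Qed.

Let PhiZ (t : R) x : 0 <= t -> Phi (t *: x) = expR (- (t * \sum_i `|x ord0 i|)).
Proof.
move=> t0; rewrite mulr_sumr -sumrN expR_sum; apply: eq_bigr => i _.
by rewrite mxE normrM ger0_norm.
Qed.

Let P_le w : P w <= 2 ^+ n.
Proof.
rewrite -[X in _ ^+ X](card_ord n) -prodr_const; apply: ler_prod => i _.
rewrite divr_ge0/= ?addr_ge0 ?sqr_ge0//.
by rewrite ler_piMr// invf_le1 ?lerDl ?sqr_ge0// ltr_wpDr// sqr_ge0.
Qed.

Let mP : measurable_fun setT P.
Proof. by have /measurable_EFinP := measurable_int mu iP. Qed.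

(** Abel summation. With the factor [Phi (e k xi)] inserted, the integral tends to the double
    transform by domination; by the multiplication formula it is also an average of [f] near [x]
    against [P], which tends to [f x] times the mass of [P] by continuity of [f]. *)
Lemma fourier_inversion (s : R) f (B : R) : s != 0 -> cintegrable mu f ->
  (forall x, cderivable f x) -> (forall x, normc (f x) <= B) ->
  cintegrable mu (FT s f) ->
  forall x, FT (- s) (FT s f) x = ((2 * pi / `|s|) ^+ n)%:C * f x.
Proof.
move=> s0 fi df fB iF x.
pose e (k : nat) : R := k.+1%:R^-1.
have e0 k : 0 < e k by rewrite invr_gt0.
have ecvg : e k @[k --> \oo] --> (0 : R) by exact: cvg_harmonic.
have mf := cintegrable_measurable fi.
pose A k := cint mu (fun xi => expi (- s * dotp xi x) * ((Phi (e k *: xi))%:C * FT s f xi)).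
have mPhik k : measurable_fun setT (fun xi => Phi (e k *: xi)).
  have := measurableT_comp mPhi (measurable_affine (e k) 0).
  by congr measurable_fun; apply/funext => xi /=; rewrite addr0.
have claim1 : normc (A k - FT (- s) (FT s f) x) @[k --> \oo] --> 0.
  have mFT := cintegrable_measurable iF.
  apply: (@cint_dominated _ _ _ mu _ _ (fun xi => normc (FT s f xi))).
  - move=> k; apply: cmeasurableM; first exact: cmeasurable_phase.
    by apply: cmeasurableM => //; exact: cmeasurable_real.
  - by apply: cmeasurableM => //; exact: cmeasurable_phase.
  - move=> xi.
    have E k : normc (expi (- s * dotp xi x) * ((Phi (e k *: xi))%:C * FT s f xi) -
        expi (- s * dotp xi x) * FT s f xi) = `|Phi (e k *: xi) - 1| * normc (FT s f xi).
      rewrite -mulrBr normcM normc_expi mul1r -{2}(mul1r (FT s f xi)) -mulrBl normcM.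
      by rewrite -normcr; congr (normc _ * _); apply: complexE_eq; rewrite /= ?subr0.
    under eq_fun do rewrite E.
    rewrite -(mul0r (normc (FT s f xi))); apply: cvgM; last exact: cvg_cst.
    rewrite -(@normr0 _ R); apply: cvg_norm; rewrite -(subrr 1); apply: cvgB; last exact: cvg_cst.
    under eq_fun do rewrite PhiZ ?(ltW (e0 _))//.
    rewrite -expR0; apply: continuous_cvg; first exact: continuous_expR.
    move: (\sum_i `|xi ord0 i|) => S.
    have eS : e k * S @[k --> \oo] --> (0 : R).
      by rewrite -(mul0r S); apply: cvgM => //; exact: cvg_cst.
    by rewrite -[X in _ --> X]oppr0; exact: cvgN eS.
  - move=> k xi; rewrite normcM normc_expi mul1r normcM normcr ger0_norm//.
    by rewrite ler_piMl ?normc_ge0.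
  - by case: iF.
pose D k := cint mu (fun z => f ((e k / s) *: z + x) * (P z)%:C).
have claim2 k : A k = ((`|s| ^- n))%:C * D k.
  have ek0 : e k != 0 by rewrite gt_eqF.
  have es0 : e k / s != 0 by rewrite mulf_neq0// invr_eq0.
  pose g xi := expi (- s * dotp xi x) * (Phi (e k *: xi))%:C.
  have ig : cintegrable mu g.
    apply: cintegrable_phase.
    have := cintegrable_affine 0 ek0 iPhi.
    by congr cintegrable; apply/funext => xi; rewrite addr0.
  (* The transform of the regularised phase is [P] centred at [x] and concentrated at scale
     [e k / |s|]. *)
  have FTg y : FT s g y = ((e k) ^- n)%:C * (P ((s / e k) *: (y - x)))%:C.
    rewrite -FT_Phi /FT.
    rewrite [X in _ * X](cint_affine 0 ek0); last exact: cintegrable_phase.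
    rewrite gtr0_norm// mulrA -rmorphM mulVf ?expf_neq0// mul1r.
    congr cint; apply/funext => xi; rewrite addr0 /g mulrA -expiD; congr (expi _ * _).
    by rewrite mul1r dotpZl dotpZr (dotpC xi (y - x)) dotpBl (dotpC y) (dotpC x); field.
  have -> : A k = cint mu (fun xi => g xi * FT s f xi).
    by congr cint; apply/funext => xi; rewrite mulrA.
  (* Zooming in at [x] by [z -> (e k / s) z + x] makes the kernel independent of [k]; the powers of
     [e k] cancel and [|s| ^ (- n)] is left. *)
  rewrite FT_mult// (cint_affine x es0); last first.
    have -> : (fun y => f y * FT s g y) = (fun y => (((e k) ^- n)%:C * (P ((s / e k) *: (y - x)))%:C) * f y).
      by apply/funext => y; rewrite FTg mulrC.
    apply: (cintegrableMl (B := e k ^- n * 2 ^+ n)) => //.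
      apply: cmeasurableM; first exact: cmeasurable_cst.
      apply: cmeasurable_real.
      have := measurableT_comp mP (measurable_affine (s / e k) (- ((s / e k) *: x))).
      by congr measurable_fun; apply/funext => y /=; rewrite scalerBr.
    move=> y; rewrite normcM !normcr !ger0_norm ?invr_ge0 ?exprn_ge0 ?(ltW (e0 k))//.
    by rewrite ler_wpM2l// invr_ge0 exprn_ge0// ltW.
  have -> : (fun z => f ((e k / s) *: z + x) * FT s g ((e k / s) *: z + x)) =
      (fun z => ((e k) ^- n)%:C * (f ((e k / s) *: z + x) * (P z)%:C)).
    apply/funext => z; rewrite FTg addrK scalerA.
    by rewrite (_ : s / e k * (e k / s) = 1) ?scale1r; [ring|field; rewrite s0].
  rewrite cintZl; last first.
    under eq_fun do rewrite mulrC.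
    apply: (cintegrableMl (B := 2 ^+ n)).
    - exact: cmeasurable_real.
    - by move=> z; rewrite normcr ger0_norm.
    - exact: cintegrable_affine.
  rewrite mulrA -rmorphM; congr (_%:C * _).
  move: (e k) (e0 k) => t t0; rewrite normrM (normfV s) (gtr0_norm t0) exprMn exprVn.
  by rewrite mulrAC mulfV ?mul1r// expf_neq0// gt_eqF.
have claim3 : normc (D k - ((2 * pi) ^+ n)%:C * f x) @[k --> \oo] --> 0.
  have -> : ((2 * pi) ^+ n)%:C * f x = cint mu (fun z => f x * (P z)%:C).
    have iPc : cintegrable mu (fun z => (P z)%:C).
      apply: (cintegrable_le (g := P)).
      - exact: cmeasurable_real.
      - by move=> z; rewrite normcr ger0_norm.
      - exact: iP.
    rewrite cintZl// mulrC; congr (_ * _).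
    by apply: complexE_eq; rewrite /cint/= ?intP// /Rintegral integral0.
  apply: (@cint_dominated _ _ _ mu _ _ (fun z => B * P z)).
  - move=> k; apply: cmeasurableM; last exact: cmeasurable_real.
    exact: (cmeasurable_comp (measurable_affine _ _) mf).
  - by apply: cmeasurableM; [exact: cmeasurable_cst|exact: cmeasurable_real].
  - move=> z.
    have E k : normc (f ((e k / s) *: z + x) * (P z)%:C - f x * (P z)%:C) =
        normc (f ((e k / s) *: z + x) - f x) * P z.
      by rewrite -mulrBl normcM normcr ger0_norm.
    under eq_fun do rewrite E.
    rewrite -(mul0r (P z)); apply: cvgM; last exact: cvg_cst.
    have zcvg : ((e k / s) *: z + x) @[k --> \oo] --> x.
      rewrite -[X in _ --> X]add0r -(scale0r z) -(mul0r s^-1).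
      apply: cvgD; last exact: cvg_cst.
      by apply: cvgZr_tmp; apply: cvgM => //; exact: cvg_cst.
    have c1 : complex.Re (f ((e k / s) *: z + x)) @[k --> \oo] --> complex.Re (f x).
      have := continuous_cderivable_Re df (x := x).
      exact: (@cvg_comp _ _ _ (fun k => (e k / s) *: z + x) (fun y => complex.Re (f y)) _ _ _ zcvg).
    have c2 : complex.Im (f ((e k / s) *: z + x)) @[k --> \oo] --> complex.Im (f x).
      have := continuous_cderivable_Im df (x := x).
      exact: (@cvg_comp _ _ _ (fun k => (e k / s) *: z + x) (fun y => complex.Im (f y)) _ _ _ zcvg).
    apply: (@squeeze_cvgr _ _ _ _ (cst 0) (fun k =>
      `|complex.Re (f ((e k / s) *: z + x)) - complex.Re (f x)| +
      `|complex.Im (f ((e k / s) *: z + x)) - complex.Im (f x)|)).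
    + apply: nearW => k; rewrite normc_ge0/=.
      by apply: (le_trans (ler_normcD_ReIm _)); rewrite ReD ImD ReN ImN.
    + exact: cvg_cst.
    + rewrite -(addr0 0); apply: cvgD.
        rewrite -(@normr0 _ R); apply: cvg_norm.
        by rewrite -(subrr (complex.Re (f x))); apply: cvgB; [exact: c1|exact: cvg_cst].
      rewrite -(@normr0 _ R); apply: cvg_norm.
      by rewrite -(subrr (complex.Im (f x))); apply: cvgB; [exact: c2|exact: cvg_cst].
  - move=> k z; rewrite normcM normcr ger0_norm// ler_wpM2r//.
  - exact: integrable_scale.
have claim4 : normc (A k - ((2 * pi / `|s|) ^+ n)%:C * f x) @[k --> \oo] --> 0.
  have E k : normc (A k - ((2 * pi / `|s|) ^+ n)%:C * f x) =
      `|s| ^- n * normc (D k - ((2 * pi) ^+ n)%:C * f x).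
    rewrite claim2 exprMn exprVn (mulrC (_ ^+ n)) rmorphM -mulrA -mulrBr normcM normcr.
    by rewrite ger0_norm// invr_ge0 exprn_ge0.
  under eq_fun do rewrite E.
  by rewrite -(mulr0 (`|s| ^- n)); apply: cvgM => //; exact: cvg_cst.
(* A constant sequence squeezed between 0 and a null sequence is zero. *)
have H : normc (FT (- s) (FT s f) x - ((2 * pi / `|s|) ^+ n)%:C * f x) @[_ --> \oo] --> (0 : R).
  apply: (@squeeze_cvgr _ _ _ _ (cst 0) (fun k => normc (A k - FT (- s) (FT s f) x) +
      normc (A k - ((2 * pi / `|s|) ^+ n)%:C * f x))).
  - apply: nearW => k; rewrite normc_ge0/=.
    rewrite (normc_sub (A k) (FT _ _ _)) (le_trans _ (normcD _ _))//.
    by rewrite addrA subrK.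
  - exact: cvg_cst.
  - by rewrite -(addr0 0); apply: cvgD.
apply/eqP; rewrite -subr_eq0; apply/eqP; apply: eq0_normc.
by rewrite -(cvg_lim _ H)// lim_cst.
Qed.

End inversion.

End fourier_inversion.

(** * The space L^2 *)

Section ereal_squares.
Variable R : realType.
Implicit Types x y : \bar R.
Local Open Scope ereal_scope.

Lemma mule_poweR_half x : 0 <= x -> x `^ 2^-1 * x `^ 2^-1 = x.
Proof.
by move=> x0; rewrite poweR12_sqrt// -expe2 sqr_sqrte.
Qed.

(** L^2 norms are compared through their squares, where the roots disappear, without first checking
    that they are finite. *)
Lemma lee_mul_self x y : 0 <= x -> 0 <= y -> (x * x <= y * y) = (x <= y).
Proof.
move=> x0 y0; apply/idP/idP => [|xy]; last exact: lee_pmul.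
apply: contraTT; rewrite -!ltNge => yx.
case: x y x0 y0 yx => [x| |]// [y| |]//.
  by rewrite -!EFinM !lee_fin !lte_fin => x0 y0 yx; exact: ltr_pM.
by move=> _ y0 _; rewrite mulyy -EFinM ltry.
Qed.

End ereal_squares.

Section L2.
Variables (R : realType) (n : nat).
Local Notation mu := (@lebesgue_rV R n).
Implicit Types (f g : 'rV[R]_n -> R[i]).
Local Open Scope ereal_scope.

Lemma L2norm_ge0 f : 0 <= L2norm f.
Proof. exact: Lnorm_ge0. Qed.

Lemma L2norm_sqr f : L2norm f * L2norm f = \int[mu]_x (normc (f x) ^+ 2)%:E.
Proof.
rewrite /L2norm unlock mule_poweR_half; last by apply: integral_ge0 => x _; exact: poweR_ge0.
apply: eq_integral => x _; rewrite abse_EFin ger0_norm ?normc_ge0// poweR_EFin.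
by rewrite powR_mulrn// normc_ge0.
Qed.

Lemma le_L2norm f g : cmeasurable_fun f -> cmeasurable_fun g ->
  (forall x, normc (f x) <= normc (g x))%R -> L2norm f <= L2norm g.
Proof.
move=> mf mg fg; rewrite -lee_mul_self ?L2norm_ge0// !L2norm_sqr.
apply: ge0_le_integral => //.
- by move=> x _; rewrite lee_fin exprn_ge0// normc_ge0.
- by apply/measurable_EFinP/measurable_funX; exact: measurable_normc.
- by apply/measurable_EFinP/measurable_funX; exact: measurable_normc.
- by move=> x _; rewrite lee_fin lerXn2r// nnegrE normc_ge0.
Qed.

Lemma eq_L2norm f g : (forall x, normc (f x) = normc (g x)) -> L2norm f = L2norm g.
Proof. by move=> fg; apply: eq_Lnorm => x; rewrite fg. Qed.

Lemma L2normN f : L2norm (fun x => - f x)%R = L2norm f.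
Proof. by apply: eq_L2norm => x; rewrite normc_N. Qed.

Lemma L2normC f g : L2norm (fun x => f x - g x)%R = L2norm (fun x => g x - f x)%R.
Proof. by apply: eq_L2norm => x; rewrite normc_sub. Qed.

Lemma L2norm0 : L2norm (fun _ : 'rV[R]_n => 0%R : R[i]) = 0.
Proof.
by rewrite /L2norm normc0; apply: Lnorm0; rewrite eqe.
Qed.

Lemma L2normD f g : cmeasurable_fun f -> cmeasurable_fun g ->
  L2norm (fun x => f x + g x)%R <= L2norm f + L2norm g.
Proof.
move=> mf mg.
pose F x := normc (f x); pose G x := normc (g x).
apply: (@le_trans _ _ (Lnorm mu 2%:E (EFin \o (F \+ G)%R))); last first.
  by apply: minkowski_EFin; rewrite ?ler1n//; exact: measurable_normc.
have -> : Lnorm mu 2%:E (EFin \o (F \+ G)%R) = L2norm (fun x => (F x + G x)%:C%C).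
  by apply: eq_Lnorm => x /=; rewrite normcr ger0_norm// addr_ge0// normc_ge0.
apply: le_L2norm.
- exact: cmeasurableD.
- by apply: cmeasurable_real; apply: measurable_funD; exact: measurable_normc.
- by move=> x; rewrite normcr ger0_norm ?addr_ge0 ?normc_ge0// normcD.
Qed.

Lemma L2normB f g : cmeasurable_fun f -> cmeasurable_fun g ->
  L2norm f <= L2norm g + L2norm (fun x => f x - g x)%R.
Proof.
move=> mf mg; rewrite -[in X in X <= _](_ : (fun x => g x + (f x - g x))%R = f).
  by apply: L2normD => //; exact: cmeasurableB.
by apply/funext => x; rewrite addrC subrK.
Qed.

Lemma L2normB_trans f g w : cmeasurable_fun f -> cmeasurable_fun g -> cmeasurable_fun w ->
  L2norm (fun x => f x - w x)%R <=
  L2norm (fun x => f x - g x)%R + L2norm (fun x => g x - w x)%R.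
Proof.
move=> mf mg mw.
rewrite -[in X in X <= _](_ : (fun x => (f x - g x) + (g x - w x))%R = (fun x => f x - w x)%R).
  by apply: L2normD; exact: cmeasurableB.
by apply/funext => x; rewrite addrA subrK.
Qed.

Lemma L2normZ (c : R[i]) f : cmeasurable_fun f ->
  L2norm (fun x => c * f x)%R = (normc c)%:E * L2norm f.
Proof.
move=> mf; apply/eqP.
have nn : 0 <= (normc c)%:E * L2norm f by rewrite mule_ge0 ?L2norm_ge0// lee_fin normc_ge0.
have : L2norm (fun x => c * f x)%R * L2norm (fun x => c * f x)%R =
    ((normc c)%:E * L2norm f) * ((normc c)%:E * L2norm f).
  rewrite muleACA !L2norm_sqr -EFinM -ge0_integralZl//.
  - by apply: eq_integral => x _; rewrite -EFinM normcM exprMn expr2.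
  - by apply/measurable_EFinP/measurable_funX; exact: measurable_normc.
  - by move=> x _; rewrite lee_fin exprn_ge0// normc_ge0.
  - by rewrite lee_fin mulr_ge0// normc_ge0.
move=> E; rewrite eq_le -(lee_mul_self (L2norm_ge0 _) nn) -(lee_mul_self nn (L2norm_ge0 _)).
by rewrite E lexx.
Qed.

Lemma in_L2B f g : in_L2 f -> in_L2 g -> in_L2 (fun x => f x - g x)%R.
Proof.
move=> [mf f2] [mg g2]; split; first exact: cmeasurableB.
have := L2normD mf (cmeasurableN mg); rewrite L2normN => /le_lt_trans -> //.
exact: lte_add_pinfty.
Qed.

Lemma in_L2D f g : in_L2 f -> in_L2 g -> in_L2 (fun x => f x + g x)%R.
Proof.
move=> [mf f2] [mg g2]; split; first exact: cmeasurableD.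
by rewrite (le_lt_trans (L2normD mf mg))// lte_add_pinfty.
Qed.

End L2.

Section cauchy_schwarz.
Context d (T : measurableType d) (R : realType) (m : {measure set T -> \bar R}).
Local Open Scope ereal_scope.

Lemma cauchy_schwarz_integral (f g : T -> R) :
  measurable_fun setT f -> measurable_fun setT g ->
  (forall x, 0 <= f x)%R -> (forall x, 0 <= g x)%R ->
  (\int[m]_x (f x * g x)%:E) * (\int[m]_x (f x * g x)%:E) <=
  (\int[m]_x (f x ^+ 2)%:E) * (\int[m]_x (g x ^+ 2)%:E).
Proof.
move=> mf mg f0 g0.
have N2 (u : T -> R) : (forall x, 0 <= u x)%R ->
    Lnorm m 2%:E (EFin \o u) * Lnorm m 2%:E (EFin \o u) = \int[m]_x (u x ^+ 2)%:E.
  move=> u0; rewrite unlock mule_poweR_half; last by apply: integral_ge0 => x _; exact: poweR_ge0.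
  by apply: eq_integral => x _; rewrite abse_EFin ger0_norm// poweR_EFin powR_mulrn.
have := @hoelder _ T R m f g 2 2 mf mg; rewrite Lnorm1.
have -> : \int[m]_x `|(EFin \o (f \* g)%R) x| = \int[m]_x (f x * g x)%:E.
  by apply: eq_integral => x _; rewrite /= ger0_norm// mulr_ge0.
rewrite -(N2 f)// -(N2 g)// muleACA => H.
by rewrite lee_mul_self ?mule_ge0 ?Lnorm_ge0//; [apply: H; lra|apply: integral_ge0 => x _; rewrite lee_fin mulr_ge0].
Qed.

End cauchy_schwarz.

(** * Young's inequality for a kernel dominated by a convolution *)

Section convolution.
Variables (R : realType) (n : nat).
Local Notation mu := (@lebesgue_rV R n).
Local Open Scope ereal_scope.

Lemma measurable_integral_param (F : 'rV[R]_n * 'rV[R]_n -> R) :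
  measurable_fun setT F -> (forall z, 0 <= F z)%R ->
  measurable_fun setT (fun x => \int[mu]_y (F (x, y))%:E).
Proof.
move=> mF F0; have mF' : measurable_fun setT (EFin \o F) by exact/measurable_EFinP.
by apply: (@measurable_fun_fubini_tonelli_F _ _ _ _ R mu _ mF') => z; rewrite lee_fin.
Qed.

(* Cauchy-Schwarz for the measure [G(x - y) dy], then Tonelli. *)
Lemma L2norm_convolution (G : 'rV[R]_n -> R) (g w : 'rV[R]_n -> R[i]) :
  measurable_fun setT G -> (forall z, 0 <= G z)%R ->
  cmeasurable_fun g -> cmeasurable_fun w ->
  (forall x, (normc (w x))%:E <= \int[mu]_y (G (x - y)%R * normc (g y))%:E) ->
  L2norm w <= (\int[mu]_z (G z)%:E) * L2norm g.
Proof.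
move=> mG G0 mg mw wG.
have mGE : measurable_fun setT (EFin \o G) by exact/measurable_EFinP.
have mng := measurable_normc mg.
have I0 : 0 <= \int[mu]_z (G z)%:E by apply: integral_ge0 => z _; rewrite lee_fin.
rewrite -lee_mul_self ?mule_ge0 ?L2norm_ge0// muleACA !L2norm_sqr.
have mdiff : measurable_fun [set: 'rV[R]_n * 'rV[R]_n] (fun z => (z.1 - z.2)%R).
  apply: measurable_fun_rVP => i.
  rewrite (_ : (fun t => _) = (fun z : 'rV[R]_n * 'rV[R]_n => z.1 ord0 i - z.2 ord0 i)%R); last first.
    by apply/funext => z; rewrite !mxE.
  by apply: measurable_funB; apply: measurableT_comp (measurable_rV_coord _) _.
have mGd : measurable_fun [set: 'rV[R]_n * 'rV[R]_n] (fun z => G (z.1 - z.2)%R).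
  exact: (measurableT_comp mG mdiff).
have mGg : measurable_fun [set: 'rV[R]_n * 'rV[R]_n]
    (fun z => G (z.1 - z.2) * normc (g z.2) ^+ 2)%R.
  apply: measurable_funM => //; apply: measurable_funX.
  exact: (measurableT_comp mng measurable_snd).
have mslice x : measurable_fun setT (fun y : 'rV[R]_n => G (x - y)%R).
  have := measurableT_comp mG (measurable_affine (-1)%R x).
  by congr measurable_fun; apply/funext => y /=; rewrite scaleN1r addrC.
have mslice' y : measurable_fun setT (fun x : 'rV[R]_n => G (x - y)%R).
  have := measurableT_comp mG (measurable_affine 1%R (- y)%R).
  by congr measurable_fun; apply/funext => x /=; rewrite scale1r.
have intl x : \int[mu]_y (G (x - y)%R)%:E = \int[mu]_z (G z)%:E.
  rewrite [RHS](@ge0_integral_affine _ _ (-1)%R x (EFin \o G))// ?oppr_eq0 ?oner_eq0//.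
  rewrite normrN1 expr1n mul1e; apply: eq_integral => y _.
  by rewrite /= scaleN1r addrC.
have intr y : \int[mu]_x (G (x - y)%R)%:E = \int[mu]_z (G z)%:E.
  rewrite [RHS](@ge0_integral_affine _ _ 1%R (- y)%R (EFin \o G))// ?oner_eq0//.
  rewrite normr1 expr1n mul1e; apply: eq_integral => x _.
  by rewrite /= scale1r.
have pt x : (normc (w x) ^+ 2)%:E <=
    (\int[mu]_z (G z)%:E) * \int[mu]_y (G (x - y) * normc (g y) ^+ 2)%:E.
  rewrite expr2 EFinM.
  apply: (le_trans (lee_pmul _ _ (wG x) (wG x))); rewrite ?lee_fin ?normc_ge0//.
  have mS : measurable_fun setT (fun y : 'rV[R]_n => Num.sqrt (G (x - y)%R)).
    exact: (measurableT_comp (continuous_measurable_fun (@sqrt_continuous R)) (mslice x)).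
  have := @cauchy_schwarz_integral _ _ _ mu (fun y : 'rV[R]_n => Num.sqrt (G (x - y)%R))
    (fun y : 'rV[R]_n => Num.sqrt (G (x - y)) * normc (g y))%R mS (measurable_funM mS mng) (fun y => sqrtr_ge0 _).
  have E1 : \int[mu]_y (Num.sqrt (G (x - y)) * (Num.sqrt (G (x - y)) * normc (g y)))%:E =
      \int[mu]_y (G (x - y)%R * normc (g y))%:E.
    by apply: eq_integral => y _; rewrite mulrA -expr2 sqr_sqrtr.
  have E2 : \int[mu]_y (Num.sqrt (G (x - y)%R) ^+ 2)%:E = \int[mu]_z (G z)%:E.
    by rewrite -(intl x); apply: eq_integral => y _; rewrite sqr_sqrtr.
  have E3 : \int[mu]_y ((Num.sqrt (G (x - y)) * normc (g y)) ^+ 2)%:E =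
      \int[mu]_y (G (x - y) * normc (g y) ^+ 2)%:E.
    by apply: eq_integral => y _; rewrite exprMn sqr_sqrtr.
  by rewrite E1 E2 E3; apply=> y; rewrite mulr_ge0 ?normc_ge0 ?sqrtr_ge0.
have nn z : 0 <= (G (z.1 - z.2) * normc (g z.2) ^+ 2)%:E by rewrite lee_fin mulr_ge0// sqr_ge0.
apply: (@le_trans _ _ (\int[mu]_x ((\int[mu]_z (G z)%:E) *
    \int[mu]_y (G (x - y) * normc (g y) ^+ 2)%:E))).
  apply: ge0_le_integral => //.
  - by move=> x _; rewrite lee_fin sqr_ge0.
  - by apply/measurable_EFinP/measurable_funX; exact: measurable_normc.
  - apply: emeasurable_funM; first exact: measurable_cst.
    exact: (@measurable_integral_param (fun z => G (z.1 - z.2) * normc (g z.2) ^+ 2)%R).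
rewrite ge0_integralZl//; last 2 first.
- exact: (@measurable_integral_param (fun z => G (z.1 - z.2) * normc (g z.2) ^+ 2)%R).
- by move=> x _; apply: integral_ge0 => y _; exact: (nn (x, y)).
rewrite -muleA; apply: lee_wpmul2l => //.
rewrite (@fubini_tonelli _ _ _ _ _ mu mu (fun z => (G (z.1 - z.2) * normc (g z.2) ^+ 2)%:E))//; last first.
  exact/measurable_EFinP.
rewrite -ge0_integralZl//; last 2 first.
- by apply/measurable_EFinP/measurable_funX.
- by move=> x _; rewrite lee_fin sqr_ge0.
rewrite le_eqVlt; apply/orP; left; apply/eqP; apply: eq_integral => y _ /=.
rewrite muleC -(intr y) -ge0_integralZl//.
- by apply: eq_integral => x _; rewrite -EFinM mulrC.
- exact/measurable_EFinP.
- by move=> x _; rewrite lee_fin.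
- by rewrite lee_fin sqr_ge0.
Qed.

End convolution.

(** * Kernel estimates *)

Section kernel.
Variables (R : realType) (n : nat).
Local Notation mu := (@lebesgue_rV R n).
Implicit Types (b : 'rV[R]_n -> R[i]).

(** Interpolates between the bound 2, used for [|t| >= 1], and [2 |t|], used for [|t| < 1]; a full
    power of [t] could cost more decay than a symbol of order [- e] offers. *)
Lemma normc_expi1_powR (q t : R) : 0 <= q <= 1 -> normc (expi t - 1) <= 2 * `|t| `^ q.
Proof.
case/andP=> q0 q1; have [t1|t1] := leP 1 `|t|.
  by rewrite (le_trans (normc_expi1_2 t))// ler_peMr// -(powRr0 `|t|); exact: ler_powR.
have [->|t0] := eqVneq t 0; first by rewrite expi0 subrr normc0 mulr_ge0 ?powR_ge0.
rewrite (le_trans (normc_expi1 t))// ler_pM2l// -[leLHS]powRr1//.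
by apply: ger_powR => //; rewrite normr_gt0 t0 ltW.
Qed.

Lemma symb_B_ge0 i M w s B b : 0 < w 0 -> @symb R n i M w s B b -> 0 <= B.
Proof.
move=> w0 sb; have H := symb_bound 0 sb.
by rewrite -(pmulr_lge0 B (powR_gt0 s w0)) (le_trans (normc_ge0 _) H).
Qed.

Lemma FT_symb (s r B : R) b i M m xi : n%:R < r ->
  symb i M (@japanese R n) (- r) B b -> (m <= M)%N ->
  FT s (iter m (partial i) b) xi = (- ('i * (s * xi ord0 i)%:C)) ^+ m * FT s b xi.
Proof.
move=> nr sb; have B0 := symb_B_ge0 (japanese_gt0 0) sb.
have bnd k x : (k <= M)%N -> normc (iter k (partial i) b x) <= B * japanese x `^ (- r).
  move=> kM; have [_ /(_ x) H] := sb k kM; apply: (le_trans H).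
  by rewrite ler_wpM2l// ler_powR ?japanese_ge1// lerBlDr lerDl.
elim: m => [|m ih] mM; first by rewrite expr0 mul1r.
rewrite iterS (@FT_partial _ _ s _ B r)//; first by rewrite ih ?exprS ?mulrA// ltnW.
- by case: (sb m (ltnW mM)).
- by case: (sb _ mM).
- by move=> x; exact/bnd/ltnW.
- by move=> x; have := bnd m.+1 x mM.
Qed.

Lemma spike_norm (p u : R) : spike p `|u| = spike p u.
Proof. by rewrite /spike normr_eq0 normr_id. Qed.

(* With [t] the largest [|z_j|], [bound1] and [bound2] come from [n + 1] and [n]
   integrations by parts in [xi_j]; [spike] being decreasing, they are compared
   with [spike t ^+ n]. *)
Lemma kernel_bound (q e : R) : (0 < n)%N -> 0 < q -> q < e -> q < 1 ->
  exists2 C, 0 <= C & forall b B r B', n%:R < r ->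
    (forall i, symb i n.+1 (@japanese R n) (- e) B b) ->
    (forall i, symb i n.+1 (@japanese R n) (- r) B' b) ->
    forall z : 'rV[R]_n, (forall i, z ord0 i != 0) ->
    normc (FT (-1) b z) <= C * B * \prod_i spike (q / n%:R) (z ord0 i).
Proof.
move=> n0 q0 qe q1.
have nR0 : 0 < n%:R :> R by rewrite ltr0n.
have n1 : 1 <= n%:R :> R by rewrite ler1n.
set p := q / n%:R.
have p01 : 0 < p < 1.
  by rewrite divr_gt0//= ltr_pdivrMr// mul1r (lt_le_trans q1).
have pn : p * n%:R = q by rewrite divfK// gt_eqF.
pose I1 := \int[mu]_x japanese x `^ (- (n%:R + 1 + e)).
pose I2 := \int[mu]_x japanese x `^ (- (n%:R + (e - q))).
have e0 : 0 < e by exact: lt_trans qe.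
have int1 : mu.-integrable setT (fun x => (japanese x `^ (- (n%:R + 1 + e)))%:E).
  by apply: integrable_japanese; rewrite -addrA ltrDl addr_gt0.
have int2 : mu.-integrable setT (fun x => (japanese x `^ (- (n%:R + (e - q))))%:E).
  by apply: integrable_japanese; rewrite ltrDl subr_gt0.
have I1_ge0 : 0 <= I1 by apply: Rintegral_ge0 => x _; exact: powR_ge0.
have I2_ge0 : 0 <= I2 by apply: Rintegral_ge0 => x _; exact: powR_ge0.
pose c2 := 2 * n%:R `^ q * I2.
have c2_ge0 : 0 <= c2 by rewrite !mulr_ge0// powR_ge0.
(* [I1] and [c2] come from the two bounds below, [2 ^ n] from one factor 2 per coordinate in the
   comparison with [spike]. The estimate of order [- r] secures integrability, and its constant [B']
   does not reach the result. *)
exists (2 ^+ n * (I1 + c2)) => [|b B r B' nr sb sb' z z0].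
  by rewrite mulr_ge0 ?exprn_ge0 ?addr_ge0.
pose i0 := Ordinal n0.
have B0 := symb_B_ge0 (japanese_gt0 0) (sb i0).
have [j _ Hj] := @Order.TotalTheory.arg_maxP _ _ 'I_n i0 predT (fun i => `|z ord0 i|) erefl.
pose t := `|z ord0 j|; have t0 : 0 < t by rewrite normr_gt0.
have zt i : `|z ord0 i| <= t by exact: Hj.
have mb m : (m <= n.+1)%N -> cintegrable mu (iter m (partial j) b).
  move=> mn; have [dm bm] := sb' j m mn.
  apply: (cintegrable_decay (B := B') (s := r + m%:R)).
  - exact: cmeasurable_cderivable.
  - by rewrite (lt_le_trans nr)// lerDl.
  - by move=> x; rewrite opprD; exact: bm.
have key m : (m <= n.+1)%N ->
    t ^+ m * normc (FT (-1) b z) = normc (FT (-1) (iter m (partial j) b) z).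
  move=> mn; rewrite (FT_symb _ _ nr (sb' j) mn) normcM normcX normc_N normcM.
  by rewrite normcr normrM normrN1 mul1r /normc/= expr0n expr1n add0r sqrtr1 mul1r.
have bound1 : t ^+ n.+1 * normc (FT (-1) b z) <= B * I1.
  rewrite key//; have [dm bm] := sb j n.+1 (leqnn _).
  rewrite /I1 -RintegralZl//; apply: normc_cint_le.
  - by case: (cintegrable_phase (-1) z (mb n.+1 (leqnn _))).
  - move=> x; rewrite normcM normc_expi mul1r (le_trans (bm x))//.
    by rewrite le_eqVlt; apply/orP; left; apply/eqP; congr (_ * _ `^ _); rewrite -natr1; ring.
  - exact: integrable_scale.
have bound2 : t ^+ n * normc (FT (-1) b z) <= B * c2 * t `^ q.
  rewrite key//; have [dm bm] := sb j n (leqnSn _).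
  have im := mb n (leqnSn _).
  (* [FT_symb] at frequency 0: the factor is [0 ^ n], which vanishes because [n > 0]. *)
  have E0 : cint mu (iter n (partial j) b) = 0.
    have := FT_symb (-1) 0 nr (sb' j) (leqnSn n).
    rewrite mxE !mulr0 oppr0 expr0n gtn_eqF//= mul0r => <-.
    by congr cint; apply/funext => y; rewrite dotpC -(scale0r 0) dotpZl mul0r mulr0 expi0 mul1r.
  (* Subtracting the vanishing integral replaces the phase by phase minus 1, at most
     [2 (n t <x>) ^ q]: a factor [t ^ q] is gained at the price of [q] powers of [<x>]. *)
  have -> : FT (-1) (iter n (partial j) b) z =
      cint mu (fun y => (expi (-1 * dotp y z) - 1) * iter n (partial j) b y).
    rewrite -[LHS]subr0 -E0 -cintB//; last exact: cintegrable_phase.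
    by congr cint; apply/funext => y; rewrite mulrBl mul1r.
  have -> : B * c2 * t `^ q = \int[mu]_x ((2 * n%:R `^ q * t `^ q * B) * japanese x `^ (- (n%:R + (e - q)))).
    by rewrite RintegralZl// -/I2 /c2; ring.
  apply: normc_cint_le.
  - apply: cmeasurableM; last exact: cmeasurable_cderivable.
    by apply: cmeasurableB; [exact: cmeasurable_phase|exact: cmeasurable_cst].
  - move=> x; rewrite normcM.
    have dz : `|-1 * dotp x z| <= n%:R * t * japanese x.
      rewrite normrM normrN1 mul1r (le_trans (ler_norm_sum _ _ _))//.
      rewrite (le_trans (y := \sum_(i < n) t * japanese x))//.
        apply: ler_sum => i _; rewrite normrM mulrC ler_pM//.
        by rewrite (coord_le_jap _ _ ltr01).
      by rewrite sumr_const card_ord -mulrA mulr_natl.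
    have q01 : 0 <= q <= 1 by rewrite (ltW q0) (ltW q1).
    apply: (le_trans (ler_pM (normc_ge0 _) (normc_ge0 _) (normc_expi1_powR (-1 * dotp x z) q01) (bm x))).
    have : `|-1 * dotp x z| `^ q <= n%:R `^ q * t `^ q * japanese x `^ q.
      rewrite -!powRM ?mulr_ge0 ?(ltW t0) ?(ltW (japanese_gt0 _))//.
      by apply: ge0_ler_powR; rewrite ?nnegrE ?mulr_ge0 ?(ltW t0) ?(ltW (japanese_gt0 _)) ?(ltW q0).
    move=> H; apply: (le_trans (y := 2 * (n%:R `^ q * t `^ q * japanese x `^ q) *
        (B * japanese x `^ (- e - n%:R)))).
      by rewrite ler_wpM2r ?mulr_ge0 ?powR_ge0// ler_wpM2l.
    have -> : - (n%:R + (e - q)) = q + (- e - n%:R) by ring.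
    rewrite powRD ?(gt_eqF (japanese_gt0 _)) ?implybT//.
    by rewrite le_eqVlt; apply/orP; left; apply/eqP; ring.
  - exact: integrable_scale.
move: (normc (FT (-1) b z)) bound1 bound2 {key} => kap bound1 bound2.
have spike_t : (spike p t) ^+ n <= \prod_i spike p (z ord0 i).
  rewrite -[leLHS](_ : \prod_(i < n) spike p t = _); last by rewrite prodr_const card_ord.
  apply: ler_prod => i _; rewrite spike_ge0//= -(spike_norm p (z ord0 i)).
  by apply: spike_le => //; rewrite normr_gt0.
(* Common end of both regimes, with [X = p - 1] for [t <= 1] and [X = - (1 + p)] for [t > 1]. As
   [n p = q], the power [(t ^ X) ^ n] is [t ^ (q - n)], respectively [t ^ (- n - q)]. *)
have final X : (t `^ X / 2) <= spike p t ->
    kap <= (I1 + c2) * B * (t `^ X) ^+ n ->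
    kap <= 2 ^+ n * (I1 + c2) * B * \prod_i spike p (z ord0 i).
  have H2 : spike p t ^+ n <= \prod_i spike p (z ord0 i) -> t `^ X / 2 <= spike p t ->
      (t `^ X) ^+ n <= 2 ^+ n * \prod_i spike p (z ord0 i).
    move=> H1 H2; apply: le_trans (ler_wpM2l (exprn_ge0 n (ler0n R 2)) H1).
    rewrite -exprMn lerXn2r ?nnegrE ?powR_ge0 ?mulr_ge0 ?spike_ge0//.
    by rewrite -ler_pdivrMl// mulrC.
  move: (\prod_i _) spike_t H2 => P H1 H2 H3 /le_trans; apply.
  have -> : 2 ^+ n * (I1 + c2) * B * P = (I1 + c2) * B * (2 ^+ n * P) by ring.
  by apply: ler_wpM2l; [rewrite mulr_ge0 ?addr_ge0|exact: H2].
have tn0 m : 0 < t ^+ m by rewrite exprn_gt0.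
have [t1|t1] := leP t 1.
  apply: (final (p - 1)); first by rewrite ler_pdivrMr// mulrC; exact: spike_ge_small.
  apply: (le_trans (y := B * c2 * t `^ q / t ^+ n)).
    by rewrite ler_pdivlMr// mulrC.
  have -> : (t `^ (p - 1)) ^+ n = t `^ q / t ^+ n.
    rewrite -powR_mulrn ?powR_ge0// -powRrM mulrBl pn mul1r powRD ?(gt_eqF t0) ?implybT//.
    by rewrite powRN powR_mulrn// ltW.
  rewrite -mulrA; apply: ler_wpM2r; first by rewrite divr_ge0 ?powR_ge0 ?(ltW (tn0 _)).
  by rewrite mulrC ler_wpM2r// lerDr.
apply: (final (- (1 + p))).
  by rewrite ler_pdivrMr// mulrC; exact: spike_ge_large (ltW t1).
apply: (le_trans (y := B * I1 / t ^+ n.+1)).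
  by rewrite ler_pdivlMr// mulrC.
have -> : (t `^ (- (1 + p))) ^+ n = t `^ (- (n%:R + q)).
  by rewrite -powR_mulrn ?powR_ge0// -powRrM mulNr mulrDl mul1r pn.
apply: (ler_pM); rewrite ?mulr_ge0 ?invr_ge0 ?(ltW (tn0 _))//.
  by rewrite mulrC ler_wpM2r// lerDl.
(* For [t > 1], [q < 1] gives [t ^ (- n - 1) <= t ^ (- n - q)]. *)
rewrite -powR_mulrn ?(ltW t0)// -powRN; apply: ler_powR; first exact: ltW.
by rewrite lerN2 -natr1 lerD2l ltW.
Qed.

End kernel.

(** * A cutoff with uniform symbol constants *)

Section cutoff.
Variables (R : realType) (n : nat).
Local Notation mu := (@lebesgue_rV R n).

(* Makes the symbol integrable; the symbol constants of order 0 are uniform in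
   [A >= 1], and the cutoff tends to 1 as [A] tends to infinity. *)
Definition cutoff (A : R) (xi : 'rV[R]_n) : R[i] :=
  (A ^+ n)%:C * (jap_ A xi `^ (- (2 * n%:R)))%:C.

Lemma cutoffE A (xi : 'rV[R]_n) : 0 < A -> cutoff A xi = ((A / (A + dotp xi xi)) ^+ n)%:C.
Proof.
move=> A0; rewrite /cutoff -rmorphM; congr (_%:C).
have j0 := jap_gt0 xi A0.
rewrite powRN -natrM powR_mulrn ?(ltW j0)// exprM jap_sqr//.
by rewrite expr_div_n.
Qed.

Lemma cutoff_ratio A (xi : 'rV[R]_n) : 0 < A -> 0 <= A / (A + dotp xi xi) <= 1.
Proof.
move=> A0; have D0 := dotp_ge0 xi.
by rewrite divr_ge0 ?addr_ge0 ?(ltW A0)//= ler_pdivrMr ?ltr_wpDr// mul1r lerDl.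
Qed.

Lemma normc_cutoff A (xi : 'rV[R]_n) : 0 < A -> normc (cutoff A xi) <= 1.
Proof.
move=> A0; have /andP[r0 r1] := cutoff_ratio xi A0.
by rewrite cutoffE// normcr ger0_norm ?exprn_ge0// exprn_ile1.
Qed.

Lemma cutoff_cvg (xi : 'rV[R]_n) : normc (cutoff k.+1%:R xi - 1) @[k --> \oo] --> 0.
Proof.
have k0 (k : nat) : 0 < k.+1%:R :> R by rewrite ltr0n.
have D0 := dotp_ge0 xi.
have E (k : nat) : normc (cutoff k.+1%:R xi - 1) = `|(k.+1%:R / (k.+1%:R + dotp xi xi)) ^+ n - 1|.
  by rewrite cutoffE// -normcr rmorphB.
under eq_fun do rewrite E.
rewrite -(@normr0 _ R); apply: cvg_norm; rewrite -(subrr 1); apply: cvgB; last exact: cvg_cst.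
rewrite -[X in _ --> X](expr1n R n).
apply: (@cvg_comp _ _ _ (fun k : nat => k.+1%:R / (k.+1%:R + dotp xi xi)) (fun x : R => x ^+ n) _ (nbhs (1 : R))); last exact: exprn_continuous.
have : (fun k : nat => dotp xi xi * k.+1%:R^-1) @ \oo --> (0 : R).
  by rewrite -(mulr0 (dotp xi xi)); apply: cvgM; [exact: cvg_cst|exact: cvg_harmonic].
move=> H; apply: (@squeeze_cvgr _ _ _ _ (fun k : nat => 1 - dotp xi xi * k.+1%:R^-1) (cst 1)).
- apply: nearW => k /=; have /andP[_ ->] := cutoff_ratio xi (k0 k); rewrite andbT.
  rewrite lerBlDr -lerBlDl -[X in X - _](divff (x := k.+1%:R + dotp xi xi)); last first.
    by rewrite gt_eqF// ltr_wpDr.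
  rewrite -mulrBl addrAC subrr add0r ler_wpM2l// lef_pV2 ?posrE ?ltr_wpDr//.
  by rewrite lerDl.
- by rewrite -[X in _ --> X]subr0; apply: cvgB; [exact: cvg_cst|exact: H].
- exact: cvg_cst.
Qed.

Lemma jap_powR_le A (xi : 'rV[R]_n) t : 1 <= A -> 0 <= t ->
  jap_ A xi `^ (- t) <= japanese xi `^ (- t).
Proof.
move=> A1 t0; have A0 : 0 < A by exact: lt_le_trans A1.
rewrite !powRN lef_pV2 ?posrE ?powR_gt0 ?jap_gt0 ?japanese_gt0//.
by apply: ge0_ler_powR; rewrite ?nnegrE ?sqrtr_ge0//; exact: ler_jap.
Qed.

(** Absorbing [A ^ n] by [A ^ n jap_ A ^ (- 2 n) <= 1] gives order 0 uniformly in [A]; leaving it in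
    the constant gives order [- 2 n], which provides integrability for each fixed [A]. *)
Lemma symb_cutoff M : exists2 C, 0 <= C & forall A i, 1 <= A ->
  symb i M (@japanese R n) 0 C (cutoff A) /\
  symb i M (@japanese R n) (- (2 * n%:R)) (A ^+ n * C) (cutoff A).
Proof.
have [C0 H] := symb_jap n M (- (2 * n%:R) : R).
exists (2 ^+ M * `|C0|) => [|A i A1]; first by rewrite mulr_ge0// exprn_ge0.
have A0 : 0 < A by exact: lt_le_trans A1.
have An0 : 0 <= A ^+ n by rewrite exprn_ge0// ltW.
have S := symbZ (A ^+ n)%:C (fun x => jap_gt0 x A0) (H A i A1).
(* The common source of both estimates, still in the weight [jap_ A]; negative powers of [jap_ A]
   lie below those of [japanese] as [A >= 1]. *)
have B m x : (m <= M)%N -> normc (iter m (partial i) (cutoff A) x) <=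
    A ^+ n * (2 ^+ M * `|C0|) * jap_ A x `^ (- (2 * n%:R) - m%:R).
  move=> mM; have [_ /(_ x) bm] := S m mM; apply: (le_trans bm).
  rewrite normcr ger0_norm// ler_wpM2r ?powR_ge0//.
  by rewrite mulrCA ler_wpM2l// ler_wpM2l ?exprn_ge0// ler_norm.
split=> m mM; have [dm _] := S m mM; split=> // x; apply: (le_trans (B m x mM)).
  rewrite sub0r powRD ?(gt_eqF (jap_gt0 x A0)) ?implybT//.
  have -> : A ^+ n * (2 ^+ M * `|C0|) * (jap_ A x `^ (- (2 * n%:R)) * jap_ A x `^ (- m%:R)) =
      2 ^+ M * `|C0| * ((A ^+ n * jap_ A x `^ (- (2 * n%:R))) * jap_ A x `^ (- m%:R)) by ring.
  rewrite ler_wpM2l ?mulr_ge0 ?exprn_ge0// -[leRHS]mul1r ler_pM ?powR_ge0 ?mulr_ge0 ?powR_ge0//.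
    have := normc_cutoff x A0; rewrite /cutoff -rmorphM normcr ger0_norm//.
    by rewrite mulr_ge0 ?powR_ge0.
  exact: jap_powR_le.
rewrite -opprD ler_wpM2l ?mulr_ge0 ?exprn_ge0// ?(ltW A0)//.
by apply: jap_powR_le => //; rewrite addr_ge0// mulr_ge0.
Qed.

End cutoff.

Section integral_param.
Context d (T : measurableType d) (R : realType) (n : nat).
Local Notation mu := (@lebesgue_rV R n).

(** Tonelli makes the integrals of the positive and negative parts measurable in the parameter, even
    where they are infinite, and [fine] of their difference is the real integral. *)
Lemma measurable_Rintegral_param (F : T * 'rV[R]_n -> R) :
  measurable_fun setT F -> measurable_fun setT (fun t => \int[mu]_y F (t, y)).
Proof.
move=> mF; have mF' : measurable_fun setT (EFin \o F) by exact/measurable_EFinP.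
pose f1 t := (\int[mu]_y ((EFin \o F)^\+ (t, y)))%E.
pose f2 t := (\int[mu]_y ((EFin \o F)^\- (t, y)))%E.
have -> : (fun t => \int[mu]_y F (t, y)) = (fun t => fine (f1 t - f2 t)%E).
  by apply/funext => t; rewrite /Rintegral integralE; congr (fine (_ - _)%E);
    apply: eq_integral => y _; rewrite ?funeposE ?funenegE.
apply: (measurableT_comp (@fine_measurable R setT measurableT)).
apply: emeasurable_funB.
  apply: (@measurable_fun_fubini_tonelli_F _ _ _ _ R mu (EFin \o F)^\+)%E.
    exact: measurable_funepos.
  by move=> z; exact: funepos_ge0.
apply: (@measurable_fun_fubini_tonelli_F _ _ _ _ R mu (EFin \o F)^\-)%E.
  exact: measurable_funeneg.
by move=> z; exact: funeneg_ge0.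
Qed.

Lemma cmeasurable_cint_param (F : T * 'rV[R]_n -> R[i]) :
  cmeasurable_fun F -> cmeasurable_fun (fun t => cint mu (fun y => F (t, y))).
Proof.
by move=> [F1 F2]; split; apply: (measurable_Rintegral_param (F := fun z => _ (F z))).
Qed.

End integral_param.

(** * L^2 bounds for symbols depending on [x] *)

Section multiplier.
Variables (R : realType) (n : nat).
Local Notation mu := (@lebesgue_rV R n).
Local Notation japn := (@japanese R n).
Implicit Types (b g : 'rV[R]_n -> R[i]) (x y z : 'rV[R]_n).

(** Joint measurability of the symbol makes [Op_h(a) f] measurable in [x], where the frequency
    integral and its integrand move together. *)
Lemma cmeasurable_FT_param (a : 'rV[R]_n * 'rV[R]_n -> R[i]) (s : R) :
  cmeasurable_fun a -> cmeasurable_fun (fun x => FT s (fun xi => a (x, xi)) x).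
Proof.
move=> ma.
refine (@cmeasurable_cint_param _ 'rV[R]_n R n (fun v => expi (s * dotp v.2 v.1) * a v) _).
apply: cmeasurableM => //; apply: cmeasurable_expi.
apply: measurable_funM; first exact: measurable_cst.
by apply: measurable_dotp.
Qed.

Lemma cmeasurable_FT (s : R) g : cmeasurable_fun g -> cmeasurable_fun (FT s g).
Proof.
move=> mg; refine (@cmeasurable_FT_param (fun v => g v.2) s _).
exact: (cmeasurable_comp measurable_snd mg).
Qed.

Lemma measurable_spikes (p s : R) : 0 < p < 1 ->
  measurable_fun setT (fun z : 'rV[R]_n => \prod_i spike p (s * z ord0 i)).
Proof.
move=> p01; apply: measurable_prod => i _.
apply: (@measurableT_comp _ _ _ _ _ _ (spike p) _ (fun x : 'rV[R]_n => s * x ord0 i)).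
  exact: measurable_spike.
by apply: measurable_funM; [exact: measurable_cst|exact: measurable_rV_coord].
Qed.

Lemma ae_neq_coord x : {ae mu, forall y : 'rV[R]_n, forall i : 'I_n, y ord0 i != x ord0 i}.
Proof.
apply: filter_forall => i; exists [set y : 'rV[R]_n | y ord0 i = x ord0 i]; split.
- have := @measurable_rV_coord R n i measurableT [set x ord0 i] (measurable_set1 _).
  by rewrite setTI.
- exact: lebesgue_rV_hyperplane.
- by move=> y /= /negP; rewrite negbK => /eqP.
Qed.

(** With the cutoff inserted the integrals can be exchanged and the kernel of [bk k] appears,
    bounded uniformly in [k]. The point [x] is fixed, so that [b] may later be replaced by [a x]. *)
Lemma multiplier_pointwise (e : R) : (0 < n)%N -> 0 < e ->
  exists p C : R, [/\ 0 < p < 1, 0 <= C &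
  forall b B s g x, 0 < s ->
    (forall i, symb i n.+1 japn (- e) B b) ->
    cintegrable mu g -> cintegrable mu (FT s g) ->
    ((normc (FT (- s) (fun xi => b xi * FT s g xi) x))%:E <=
     \int[mu]_y (C * B * \prod_i spike p (s * (x - y) ord0 i) * normc (g y))%:E)%E].
Proof.
(* The midpoint of the range [0 < q < min e 1] that [kernel_bound] admits. *)
move=> n0 e0; pose q := Num.min e 1 / 2.
have m0 : 0 < Num.min e 1 by rewrite lt_min e0 ltr01.
have qm : q < Num.min e 1 by rewrite /q ltr_pdivrMr// ltr_pMr// ltr1n.
have q0 : 0 < q by rewrite divr_gt0.
have [qe q1] : q < e /\ q < 1 by move: qm; rewrite lt_min => /andP.
have nR0 : 0 < n%:R :> R by rewrite ltr0n.
pose p := q / n%:R.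
have p01 : 0 < p < 1.
  by rewrite divr_gt0//= ltr_pdivrMr// mul1r (lt_le_trans q1)// ler1n.
have [C1 C1_ge0 kb] := kernel_bound n0 q0 qe q1.
have [C2 C2_ge0 cb] := symb_cutoff R n n.+1.
exists p, (C1 * (2 ^+ n.+1 * C2)); split=> //.
  by rewrite mulr_ge0// mulr_ge0// exprn_ge0.
move=> b B s g x s0 sb ig iFg; pose i0 := Ordinal n0.
have B0 := symb_B_ge0 (japanese_gt0 0) (sb i0).
set RHS := (X in (_ <= X)%E).
pose bk k xi := b xi * cutoff k.+1%:R xi.
have k1 (k : nat) : 1 <= k.+1%:R :> R by rewrite ler1n.
have k0 (k : nat) : 0 < k.+1%:R :> R by rewrite ltr0n.
have mb : cmeasurable_fun b by apply: cmeasurable_cderivable => xi; exact: symb_der (sb i0).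
have mcut k : cmeasurable_fun (@cutoff R n k.+1%:R).
  by apply: cmeasurable_cderivable => xi; exact: symb_der (cb _ i0 (k1 k)).1.
have bB xi : normc (b xi) <= B.
  rewrite (le_trans (symb_bound xi (sb i0)))// ler_piMr// -(powRr0 (japanese xi)).
  by rewrite ler_powR ?japanese_ge1// oppr_le0 ltW.
have sk1 k i : symb i n.+1 japn (- e) (2 ^+ n.+1 * (B * C2)) (bk k).
  by rewrite -[- e]addr0; exact: (@symbM _ _ _ _ _ _ _ _ _ _ _ (@japanese_gt0 R n) (sb i) (cb _ i (k1 k)).1).
(* This constant grows with [k]; the estimate makes [bk k] integrable and justifies the integrations
   by parts, while [sk1] controls the final bound. *)
have sk2 k i : symb i n.+1 japn (- (e + 2 * n%:R)) (2 ^+ n.+1 * (B * (k.+1%:R ^+ n * C2))) (bk k).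
  by rewrite opprD; exact: (@symbM _ _ _ _ _ _ _ _ _ _ _ (@japanese_gt0 R n) (sb i) (cb _ i (k1 k)).2).
have nr : n%:R < e + 2 * n%:R :> R by lra.
have mFg := cintegrable_measurable iFg.
have ibk k : cintegrable mu (bk k).
  apply: (cintegrable_decay (s := e + 2 * n%:R) _ nr); first exact: cmeasurableM.
  by move=> xi; exact: symb_bound (sk2 k i0).
have step k : ((normc (FT (- s) (fun xi => bk k xi * FT s g xi) x))%:E <= RHS)%E.
  pose h xi := expi (- s * dotp xi x) * bk k xi.
  have ih : cintegrable mu h by exact: cintegrable_phase.
  have -> : FT (- s) (fun xi => bk k xi * FT s g xi) x = cint mu (fun xi => h xi * FT s g xi).
    by congr cint; apply/funext => xi; rewrite mulrA.
  rewrite FT_mult//.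
  (* After the exchange, [g y] is paired with the kernel of [bk k] at the rescaled difference
     [s (x - y)]. *)
  have Fh y : FT s h y = FT (-1) (bk k) (s *: (x - y)).
    congr cint; apply/funext => xi; rewrite /h mulrA -expiD; congr (expi _ * _).
    by rewrite dotpZr (dotpC xi (x - y)) dotpBl (dotpC x) (dotpC y); ring.
  have igh : cintegrable mu (fun y => g y * FT s h y).
    have [M HM] : exists M, forall y, normc (FT s h y) <= M.
      by exists (\int[mu]_y normc (h y)); exact: normc_FT_le.
    have := cintegrableMl (c := FT s h) _ HM ig.
    move=> /(_ (cmeasurable_FT s (cintegrable_measurable ih)));
    by congr cintegrable; apply/funext => y; rewrite mulrC.
  have := normc_cint igh; rewrite -lee_fin => /le_trans; apply.
  have [mgh /integrable_fin_num fgh] := igh.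
  rewrite /Rintegral fineK; last exact: fgh.
  apply: ae_ge0_le_integral => //.
  - by move=> y _; rewrite lee_fin normc_ge0.
  - by apply/measurable_EFinP; exact: measurable_normc.
  - move=> y _; rewrite lee_fin mulr_ge0 ?normc_ge0//.
    by rewrite mulr_ge0 ?mulr_ge0 ?exprn_ge0// prodr_ge0// => i _; exact: spike_ge0.
  - apply/measurable_EFinP/measurable_funM; last by apply: measurable_normc; exact: cintegrable_measurable ig.
    apply: measurable_funM; first exact: measurable_cst.
    have := measurableT_comp (measurable_spikes s p01) (measurable_affine (-1) x).
    by congr measurable_fun; apply/funext => y /=; rewrite scaleN1r addrC.
  - apply: filterS (ae_neq_coord x) => y yx _.
    rewrite lee_fin normcM mulrC ler_wpM2r ?normc_ge0// Fh.
    have := kb (bk k) _ _ _ nr (sk1 k) (sk2 k) (s *: (x - y)).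
    have -> : C1 * (2 ^+ n.+1 * C2) * B = C1 * (2 ^+ n.+1 * (B * C2)) by ring.
    have -> : \prod_i spike (q / n%:R) ((s *: (x - y)) ord0 i) = \prod_i spike p (s * (x - y) ord0 i).
      by apply: eq_bigr => i _; rewrite mxE.
    by apply=> i; rewrite !mxE mulf_neq0 ?(gt_eqF s0)// subr_eq0 eq_sym.
have lim : normc (FT (- s) (fun xi => bk k xi * FT s g xi) x -
    FT (- s) (fun xi => b xi * FT s g xi) x) @[k --> \oo] --> 0.
  apply: (@cint_dominated _ _ _ mu _ _ (fun xi => B * normc (FT s g xi))).
  - move=> k; apply: cmeasurableM; first exact: cmeasurable_phase.
    by apply: cmeasurableM => //; exact: cmeasurableM.
  - by apply: cmeasurableM; [exact: cmeasurable_phase|exact: cmeasurableM].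
  - move=> xi.
    have E k : normc (expi (- s * dotp xi x) * (bk k xi * FT s g xi) -
        expi (- s * dotp xi x) * (b xi * FT s g xi)) =
        normc (cutoff k.+1%:R xi - 1) * normc (b xi * FT s g xi).
      rewrite -mulrBr normcM normc_expi mul1r -normcM; congr (normc _).
      by rewrite /bk; ring.
    under eq_fun do rewrite E.
    rewrite -(mul0r (normc (b xi * FT s g xi))); apply: cvgM; last exact: cvg_cst.
    exact: cutoff_cvg.
  - move=> k xi; rewrite normcM normc_expi mul1r normcM ler_wpM2r ?normc_ge0//.
    rewrite /bk normcM (le_trans _ (bB xi))// ler_piMr ?normc_ge0//.
    exact: normc_cutoff.
  - by apply: integrable_scale; case: iFg.
(* The majorant may be infinite: [+oo] is trivial, [-oo] is excluded by [step], and only the finite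
   case needs the limit in [k]. *)
move: RHS step => [r| |] step; [|by rewrite leey|by have := step 0%N].
rewrite lee_fin.
apply: (@ler_cvg_to nat \oo _ R (fun k => normc (FT (- s) (fun xi => b xi * FT s g xi) x))
   (fun k => r + normc (FT (- s) (fun xi => bk k xi * FT s g xi) x -
    FT (- s) (fun xi => b xi * FT s g xi) x))).
- exact: cvg_cst.
- by rewrite -[X in _ --> X]addr0; apply: cvgD; [exact: cvg_cst|exact: lim].
- apply: nearW => k.
  have := step k; rewrite lee_fin => sk.
  rewrite -lerBlDr (le_trans _ sk)// lerBlDr normc_sub.
  by rewrite -[X in normc X <= _](subrK (FT (- s) (fun xi => bk k xi * FT s g xi) x)) addrC normcD.
Qed.

(** The pointwise bound for [a x] is used at [x] itself; its majorant depends on [x - y] only, so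
    [L2norm_convolution] applies. Rescaling the majorant by [s] yields [s ^ (- n)]. *)
Lemma multiplier_L2 (e : R) : (0 < n)%N -> 0 < e ->
  exists2 C : R, 0 <= C & forall (a : 'rV[R]_n -> 'rV[R]_n -> R[i]) B s g, 0 < s -> 0 <= B ->
    cmeasurable_fun (fun v : 'rV[R]_n * 'rV[R]_n => a v.1 v.2) ->
    (forall x i, symb i n.+1 japn (- e) B (a x)) ->
    cintegrable mu g -> cintegrable mu (FT s g) ->
    (L2norm (fun x => FT (- s) (fun xi => a x xi * FT s g xi)%R x) <=
     (C * B * s ^- n)%:E * L2norm g)%E.
Proof.
move=> n0 e0; have [p [C [p01 C0 H]]] := multiplier_pointwise n0 e0.
pose F z := \prod_i spike p (z ord0 i).
have mF s : measurable_fun setT (fun z => \prod_i spike p (s * z ord0 i)) by exact: measurable_spikes.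
have F0 z : 0 <= F z by apply: prodr_ge0 => i _; exact: spike_ge0.
have mF1 : measurable_fun setT F.
  by have := mF 1; congr measurable_fun; apply/funext => z; apply: eq_bigr => i _; rewrite mul1r.
have iF : mu.-integrable setT (EFin \o F).
  apply: integrable_prod_rV; [exact: measurable_spike| |exact: integral_spike_lty].
  by move=> t; exact: spike_ge0.
have finF := integrable_fin_num measurableT iF.
pose K := fine (\int[mu]_z (F z)%:E)%E.
have K0 : 0 <= K by apply: fine_ge0; apply: integral_ge0 => z _; rewrite lee_fin.
exists (C * K) => [|a B s g s0 B0 ma sa ig iFg]; first exact: mulr_ge0.
pose G z := C * B * \prod_i spike p (s * z ord0 i).
have sp0 z : 0 <= \prod_i spike p (s * z ord0 i) by apply: prodr_ge0 => i _; exact: spike_ge0.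
have intG : (\int[mu]_z (G z)%:E = (C * K * B * s ^- n)%:E)%E.
  under eq_integral do rewrite EFinM.
  rewrite ge0_integralZl//; last 3 first.
  - exact/measurable_EFinP.
  - by move=> z _; rewrite lee_fin.
  - by rewrite lee_fin mulr_ge0.
  have := @ge0_integral_affine R n s 0 (EFin \o F).
  rewrite (gt_eqF s0) => /(_ isT) E.
  have -> : (\int[mu]_z (\prod_i spike p (s * z ord0 i))%:E =
      \int[mu]_z (EFin \o F) (s *: z + 0)%R)%E.
    by apply: eq_integral => z _ /=; congr (_%:E); apply: eq_bigr => i _; rewrite addr0 mxE.
  have {}E : (\int[mu]_z (F z)%:E = (`|s| ^+ n)%:E * \int[mu]_z (EFin \o F) (s *: z + 0)%R)%E.
    by apply: E => [|z]; [exact/measurable_EFinP|rewrite lee_fin].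
  have fin0 : (\int[mu]_z (F z)%:E)%E = K%:E by rewrite fineK.
  (* [s ^ n] times the rescaled integral equals the finite number [K], which excludes infinite
     values. *)
  move: E; rewrite fin0 gtr0_norm//; move: (\int[mu]_z _)%E => [r| |] E.
  - move: E; rewrite -EFinM => -[->]; rewrite -EFinM; congr (_%:E).
    by field; rewrite expf_neq0 ?gt_eqF.
  - by move: E; rewrite mulry gtr0_sg ?exprn_gt0// mul1e.
  - by move: E; rewrite mulrNy gtr0_sg ?exprn_gt0// mul1e.
rewrite -intG; apply: L2norm_convolution.
- by apply: measurable_funM; [exact: measurable_cst|exact: mF].
- by move=> z; rewrite mulr_ge0 ?mulr_ge0.
- exact: cintegrable_measurable ig.
- refine (@cmeasurable_FT_param (fun v => a v.1 v.2 * FT s g v.2) (- s) _).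
  apply: cmeasurableM => //.
  apply: (cmeasurable_comp measurable_snd); exact: cintegrable_measurable iFg.
- by move=> x; apply: H => // i; exact: sa.
Qed.

End multiplier.

(** * Pseudodifferential operators on Schwartz functions *)

Section Op_schwartz.
Variables (R : realType) (n : nat).
Local Notation mu := (@lebesgue_rV R n).
Implicit Types (f g phi : 'rV[R]_n -> R[i]) (x y : 'rV[R]_n).

Lemma OpE (h : R) (a : 'rV[R]_n -> 'rV[R]_n -> R[i]) f x : cintegrable mu f ->
  Op h a f x = ((2 * pi * h) ^- n)%:C *
    FT (- h^-1) (fun xi => a x xi * FT h^-1 f xi) x.
Proof.
move=> fi; rewrite /Op cintegralE; congr (_ * _); congr cint; apply/funext => xi.
rewrite cintegralE mulrA.
transitivity (cint mu (fun y => (expi (- h^-1 * dotp xi x) * a x xi) * (expi (h^-1 * dotp y xi) * f y))).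
  apply: eq_cint => y; rewrite [RHS]mulrA -[X in _ = X * _]mulrA (mulrC (a x xi)).
  rewrite [X in _ = X * _]mulrA -expiD; congr (expi _ * _ * _).
  by rewrite dotpBl (dotpC xi); ring.
by rewrite cintZl//; exact: cintegrable_phase.
Qed.

Lemma FTN (s : R) f x : cintegrable mu f -> FT s (fun y => f (- y)) x = FT (- s) f x.
Proof.
move=> fi; rewrite /FT.
have N1 : (-1 : R) != 0 by rewrite oppr_eq0 oner_eq0.
rewrite [RHS](cint_affine 0 N1); last exact: cintegrable_phase.
rewrite normrN1 expr1n mul1r; apply: eq_cint => y.
rewrite addr0 scaleN1r; congr (expi _ * _).
by rewrite -scaleN1r dotpZl; ring.
Qed.

Lemma FT_opp (s : R) f x : FT s f (- x) = FT (- s) f x.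
Proof.
by apply: eq_cint => y; congr (expi _ * _); rewrite dotpC -scaleN1r dotpZl (dotpC x); ring.
Qed.

Hypothesis n0 : (0 < n)%N.

Lemma psch_rapid f : psch f -> rapid f.
Proof. by move=> pf; exact: (pf (Ordinal n0) 0%N). Qed.

Lemma psch_cintegrable f : psch f -> cintegrable mu f.
Proof. by move=> /psch_rapid; exact: rapid_cintegrable. Qed.

Lemma psch_bounded f : psch f -> exists B, forall x, normc (f x) <= B.
Proof.
move=> /psch_rapid[_ /(_ 0%N)[B HB]]; exists B => x.
by have := HB x; rewrite expr0 mul1r.
Qed.

Lemma psch_cmeasurable f : psch f -> cmeasurable_fun f.
Proof. by move=> /psch_rapid; exact: rapid_cmeasurable. Qed.

Lemma psch_cintegrableM f g : psch f -> psch g -> cintegrable mu (fun x => f x * g x).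
Proof.
move=> pf pg; have [B HB] := psch_bounded pf.
exact: cintegrableMl (psch_cmeasurable pf) HB (psch_cintegrable pg).
Qed.

Lemma FT_psch (s : R) f : s != 0 -> psch f -> psch (FT s f).
Proof. by move=> s0 pf; exact/schwartz_psch/FT_schwartz. Qed.

Lemma FT_inversion_psch (s : R) f x : s != 0 -> psch f ->
  FT (- s) (FT s f) x = ((2 * pi / `|s|) ^+ n)%:C * f x.
Proof.
move=> s0 pf; have [df bf] := psch_rapid pf; have [B HB] := bf 0%N.
apply: (@fourier_inversion _ _ _ _ B) => //.
- exact: psch_cintegrable.
- by move=> y; have := HB y; rewrite expr0 mul1r.
- exact/psch_cintegrable/FT_psch.
Qed.

Lemma schwartzZ (c : R[i]) f : schwartz f -> schwartz (fun x => c * f x).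
Proof.
move=> sf; have := schwartz_lin (c - 1) sf sf; congr schwartz.
by apply/funext => x; ring.
Qed.

Lemma psch_japanese_pow k f : psch f -> psch (fun x => japanese_pow k x * f x).
Proof. by move=> pf; exact: psch_slowM (pslow_jap k) pf. Qed.

Variable h : R.
Hypothesis h0 : 0 < h.

Let s0 : h^-1 != 0. Proof. by rewrite invr_eq0 gt_eqF. Qed.
Let ns0 : - h^-1 != 0. Proof. by rewrite oppr_eq0. Qed.

Let hE : `|h^-1| = h^-1. Proof. by rewrite gtr0_norm ?invr_gt0. Qed.

Local Notation Opk k := (Op h (fun=> japanese_pow k)).

Lemma Op_japE k f : psch f -> Opk k f = (fun x => ((2 * pi * h) ^- n)%:C *
  FT (- h^-1) (fun xi => japanese_pow k xi * FT h^-1 f xi) x).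
Proof. by move=> pf; apply/funext => x; rewrite OpE//; exact: psch_cintegrable. Qed.

Lemma Op_jap_schwartz k f : psch f -> schwartz (Opk k f).
Proof.
move=> pf; rewrite Op_japE//; apply: schwartzZ; apply: FT_schwartz => //.
exact/psch_japanese_pow/FT_psch.
Qed.

(** The prefactor of [Op] inverts the constant of [FT_inversion_psch] at [|s| = h^-1]. *)
Let cc : (2 * pi * h) ^- n * (2 * pi / h^-1) ^+ n = 1.
Proof.
by rewrite invrK mulVf// expf_neq0// !mulf_neq0// ?gt_eqF// pi_gt0.
Qed.

Lemma FT_Op_jap k f : psch f ->
  FT h^-1 (Opk k f) = (fun xi => japanese_pow k xi * FT h^-1 f xi).
Proof.
move=> pf; rewrite Op_japE//; apply/funext => xi.
pose F xi := japanese_pow k xi * FT h^-1 f xi.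
have pF : psch F by exact/psch_japanese_pow/FT_psch.
have := FT_inversion_psch xi ns0 pF; rewrite opprK normrN hE => E.
transitivity (((2 * pi * h) ^- n)%:C * FT h^-1 (FT (- h^-1) F) xi).
  rewrite /FT -cintZl; first by apply: eq_cint => y; ring.
  by apply: cintegrable_phase; apply: psch_cintegrable; exact: FT_psch.
by rewrite E mulrA -rmorphM cc mul1r.
Qed.

(** On the Fourier side the two weights cancel. This supplies preimages of Schwartz functions, from
    which approximations in the Sobolev space are built. *)
Lemma Op_japK k f : psch f -> Opk (- k) (Opk k f) = f.
Proof.
move=> pf; have pO := schwartz_psch (Op_jap_schwartz k pf).
rewrite Op_japE// FT_Op_jap//; apply/funext => x.
have -> : (fun xi => japanese_pow (- k) xi * (japanese_pow k xi * FT h^-1 f xi)) = FT h^-1 f.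
  apply/funext => xi; rewrite mulrA -rmorphM -powRD.
    by rewrite addNr powRr0 mul1r.
  by rewrite (gt_eqF (japanese_gt0 _)) implybT.
by rewrite FT_inversion_psch// mulrA -rmorphM hE cc mul1r.
Qed.

Lemma japanese_powN k x : japanese_pow k (- x) = japanese_pow k x :> R[i].
Proof.
rewrite /japanese_pow /japanese (_ : dotp (- x) (- x) = dotp x x)//.
by apply: eq_bigr => i _; rewrite !mxE mulrNN.
Qed.

(** Two applications of the multiplication formula show that the operator is its own transpose,
    because the weight is even. *)
Lemma Op_jap_dual k f phi : psch f -> psch phi ->
  cint mu (fun x => f x * Opk k phi x) = cint mu (fun x => Opk k f x * phi x).
Proof.
move=> pf pp; rewrite !Op_japE//.
pose G xi := japanese_pow k xi * FT (- h^-1) f xi.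
have pG : psch G by exact/psch_japanese_pow/FT_psch.
pose Fp xi := japanese_pow k xi * FT h^-1 phi xi.
have pFp : psch Fp by exact/psch_japanese_pow/FT_psch.
pose F xi := japanese_pow k xi * FT h^-1 f xi.
have pF : psch F by exact/psch_japanese_pow/FT_psch.
(* By evenness of the weight [G] is the reflection of [F], and reflecting a function flips the sign
   of [s]. *)
have EG : FT h^-1 G = FT (- h^-1) F.
  apply/funext => x; rewrite -(FTN _ _ (psch_cintegrable pF)).
  by congr (FT _ _ x); apply/funext => y; rewrite /G /F japanese_powN FT_opp.
pose c : R[i] := ((2 * pi * h) ^- n)%:C.
have iFp := psch_cintegrable pFp; have if_ := psch_cintegrable pf.
have iphi := psch_cintegrable pp; have iG := psch_cintegrable pG.
transitivity (c * cint mu (fun x => f x * FT (- h^-1) Fp x)).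
  rewrite -cintZl; first by apply: eq_cint => x; rewrite mulrCA.
  exact (psch_cintegrableM pf (FT_psch ns0 pFp)).
rewrite (FT_mult (- h^-1) iFp if_).
transitivity (c * cint mu (fun x => phi x * FT h^-1 G x)).
  congr (_ * _); apply: etrans _ (esym (FT_mult h^-1 iG iphi)).
  by apply: eq_cint => x; rewrite /G /Fp; ring.
rewrite EG -cintZl; first by apply: eq_cint => x; ring.
exact (psch_cintegrableM pp (FT_psch ns0 pF)).
Qed.

End Op_schwartz.

(** * Distributions given by L^2 functions *)

Section L2_pairing.
Variables (R : realType) (n : nat).
Local Notation mu := (@lebesgue_rV R n).
Implicit Types (f g G phi : 'rV[R]_n -> R[i]) (u : Defs.distribution R n).

Lemma L2norm_lty f : (\int[mu]_x (normc (f x) ^+ 2)%:E < +oo)%E -> (L2norm f < +oo)%E.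
Proof.
rewrite -L2norm_sqr; have := L2norm_ge0 f.
by case: (L2norm f) => [r _ _| |]//; rewrite ltry.
Qed.

Lemma L2_cauchy_schwarz f g : cmeasurable_fun f -> cmeasurable_fun g ->
  (\int[mu]_x (normc (f x * g x))%:E <= L2norm f * L2norm g)%E.
Proof.
move=> mf mg.
have I0 : (0 <= \int[mu]_x (normc (f x * g x))%:E)%E.
  by apply: integral_ge0 => x _; rewrite lee_fin normc_ge0.
rewrite -lee_mul_self ?mule_ge0 ?L2norm_ge0// muleACA !L2norm_sqr.
have E : (\int[mu]_x (normc (f x * g x))%:E = \int[mu]_x (normc (f x) * normc (g x))%:E)%E.
  by apply: eq_integral => x _; rewrite normcM.
rewrite E.
apply: (cauchy_schwarz_integral mu (measurable_normc mf) (measurable_normc mg)) => x;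
  exact: normc_ge0.
Qed.

Lemma in_L2_cintegrableM f g : in_L2 f -> in_L2 g -> cintegrable mu (fun x => f x * g x).
Proof.
move=> [mf f2] [mg g2]; have mfg := cmeasurableM mf mg; split=> //.
apply/integrableP; split; first by apply/measurable_EFinP; exact: measurable_normc.
have -> : (\int[mu]_x `|(EFin \o (fun x => normc (f x * g x)%R)) x| =
    \int[mu]_x (normc (f x * g x))%:E)%E.
  by apply: eq_integral => x _; rewrite abse_EFin ger0_norm// normc_ge0.
rewrite (le_lt_trans (L2_cauchy_schwarz mf mg))//.
by rewrite lte_mul_pinfty ?L2norm_ge0// ge0_fin_numE ?L2norm_ge0.
Qed.

Hypothesis n0 : (0 < n)%N.

Lemma psch_in_L2 f : psch f -> in_L2 f.
Proof.
move=> pf; have mf := psch_cmeasurable n0 pf; split=> //; apply: L2norm_lty.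
have [B HB] := psch_bounded n0 pf.
have [_ /(integrable_scale B) /integrableP[_]] := psch_cintegrable n0 pf.
apply: le_lt_trans; apply: ge0_le_integral => //.
- by move=> x _; rewrite lee_fin sqr_ge0.
- by apply/measurable_EFinP/measurable_funX; exact: measurable_normc.
- apply/measurable_EFinP/measurableT_comp => //.
  by apply: measurable_funM; [exact: measurable_cst|exact: measurable_normc].
- move=> x _; rewrite abse_EFin lee_fin (le_trans _ (ler_norm _))// expr2.
  by rewrite ler_wpM2r ?normc_ge0.
Qed.

(* Test the equality of distributions against the conjugate of [g]. *)
Lemma L2norm_le_of_eq_dist g G : schwartz g -> in_L2 G ->
  eq_dist (regular_dist g) (regular_dist G) -> (L2norm g <= L2norm G)%E.
Proof.
move=> sg [mG G2] gG; have pg := schwartz_psch sg.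
have [mg g2] := psch_in_L2 pg.
have pcg := schwartz_psch (schwartz_conj sg).
have := gG _ (schwartz_conj sg); rewrite /regular_dist !cintegralE => E.
have iG : cintegrable mu (fun x => G x * (g x)^*).
  by apply: in_L2_cintegrableM => //; exact: psch_in_L2.
have Enorm : (L2norm g * L2norm g <= L2norm G * L2norm g)%E.
  rewrite L2norm_sqr.
  have Eg : L2norm g = L2norm (fun x => (g x)^*).
    by apply: eq_L2norm => x; rewrite normc_conj.
  rewrite [in X in (_ <= _ * X)%E]Eg.
  apply: le_trans (L2_cauchy_schwarz mG (cmeasurable_conj mg)).
  have [miG iG'] := iG.
  have := normc_cint iG; rewrite -lee_fin /Rintegral fineK; last exact: integrable_fin_num.
  apply: le_trans; rewrite -E.
  have -> : cint mu (fun x => g x * (g x)^*) = (\int[mu]_x (normc (g x) ^+ 2))%:C.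
    rewrite /cint; apply: complexE_eq => /=.
      by apply: eq_Rintegral => x _; rewrite normc_sqr; case: (g x) => a b /=; ring.
    rewrite /Rintegral integral0_eq// => x _; congr (_%:E).
    by case: (g x) => a b /=; ring.
  rewrite normcr; apply: le_trans (_ : ((\int[mu]_x (normc (g x) ^+ 2))%:E <= _)%E); last first.
    by rewrite lee_fin ler_norm.
  rewrite /Rintegral fineK// ge0_fin_numE; last by apply: integral_ge0 => x _; rewrite lee_fin sqr_ge0.
  by rewrite -L2norm_sqr lte_mul_pinfty ?L2norm_ge0// ge0_fin_numE ?L2norm_ge0.
have fg : L2norm g \is a fin_num by rewrite ge0_fin_numE ?L2norm_ge0.
have [g0|g0] := eqVneq (L2norm g) 0%E; first by rewrite g0 L2norm_ge0.
rewrite -(@lee_pmul2r _ (L2norm g))// lt_neqAle eq_sym g0 L2norm_ge0//.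
Qed.

Lemma dist_L2norm_lt u (c : \bar R) : (dist_L2norm u < c)%E ->
  exists G, [/\ in_L2 G, eq_dist u (regular_dist G) & (L2norm G < c)%E].
Proof. by move=> /ereal_inf_lt[_ [G [G2 uG] <-] Gc]; exists G. Qed.

Lemma dist_L2norm_le u G : in_L2 G -> eq_dist u (regular_dist G) ->
  (dist_L2norm u <= L2norm G)%E.
Proof. by move=> G2 uG; apply: ereal_inf_lbound; exists G. Qed.

Lemma dist_L2norm_ge0 u : (0 <= dist_L2norm u)%E.
Proof. by apply: le_ereal_inf_tmp => _ [G _ <-]; exact: L2norm_ge0. Qed.

Lemma regular_distD f g phi : in_L2 f -> in_L2 g -> schwartz phi ->
  regular_dist (fun x => f x + g x) phi = regular_dist f phi + regular_dist g phi.
Proof.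
move=> f2 g2 /schwartz_psch/psch_in_L2 p2; rewrite /regular_dist !cintegralE -cintD.
- by apply: eq_cint => x; rewrite mulrDl.
- exact: in_L2_cintegrableM.
- exact: in_L2_cintegrableM.
Qed.

Lemma regular_distB f g phi : in_L2 f -> in_L2 g -> schwartz phi ->
  regular_dist (fun x => f x - g x) phi = regular_dist f phi - regular_dist g phi.
Proof.
move=> f2 g2 /schwartz_psch/psch_in_L2 p2; rewrite /regular_dist !cintegralE -cintB.
- by apply: eq_cint => x; rewrite mulrBl.
- exact: in_L2_cintegrableM.
- exact: in_L2_cintegrableM.
Qed.

Variables (h k : R).
Hypothesis h0 : 0 < h.

Lemma Op_dist_japE u phi : Op_dist h (japanese_pow k) u phi =
  u (Op h (fun=> japanese_pow k) phi).
Proof.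
rewrite /Op_dist; suff -> : (fun xi : 'rV[R]_n => japanese_pow k (- xi)) = japanese_pow k by [].
by apply/funext => xi; exact: japanese_powN.
Qed.

Lemma Op_dist_regular f phi : schwartz f -> schwartz phi ->
  Op_dist h (japanese_pow k) (regular_dist f) phi =
  regular_dist (Op h (fun=> japanese_pow k) f) phi.
Proof.
move=> /schwartz_psch pf /schwartz_psch pp; rewrite Op_dist_japE /regular_dist !cintegralE.
exact: Op_jap_dual.
Qed.

(** [G1 + G2] represents the Schwartz function [Op f], whose norm is at most that of any
    representative; uniqueness of representatives is never invoked. *)
Lemma L2norm_Op_jap_le f u G1 G2 : schwartz f -> in_L2 G1 -> in_L2 G2 ->
  eq_dist (Op_dist h (japanese_pow k) (fun phi => regular_dist f phi - u phi)) (regular_dist G1) ->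
  eq_dist (Op_dist h (japanese_pow k) u) (regular_dist G2) ->
  (L2norm (Op h (fun=> japanese_pow k) f) <= L2norm G1 + L2norm G2)%E.
Proof.
move=> sf i1 i2 e1 e2; have pf := schwartz_psch sf.
apply: le_trans (L2normD i1.1 i2.1).
apply: L2norm_le_of_eq_dist; [exact: Op_jap_schwartz|exact: in_L2D|].
move=> phi sphi; rewrite regular_distD// -Op_dist_regular// -e1// -e2//.
by rewrite !Op_dist_japE subrK.
Qed.

End L2_pairing.

(** * Completeness of L^2 *)

Section L2_convergence.
Variables (R : realType) (n : nat).
Local Notation mu := (@lebesgue_rV R n).
Implicit Types (f g w : 'rV[R]_n -> R[i]).

Lemma cvge0P (u : nat -> \bar R) : (forall j, 0 <= u j)%E ->
  (u j @[j --> \oo] --> 0%E) <->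
  (forall e : R, 0 < e -> \forall j \near \oo, (u j <= e%:E)%E).
Proof.
move=> u0; split.
  move=> /fine_cvgP[fu /cvgrPdist_le H] e e0.
  have := H e e0; apply: filterS2 fu => j fj; rewrite sub0r normrN/= => hj.
  by rewrite -(fineK fj) lee_fin (le_trans (ler_norm _)).
move=> H; apply/fine_cvgP; split.
  apply: filterS (H 1 ltr01) => j uj.
  by rewrite ge0_fin_numE// (le_lt_trans uj)// ltry.
apply/cvgrPdist_le => e e0; apply: filterS (H e e0) => j uj.
rewrite sub0r normrN/= ger0_norm ?fine_ge0// -lee_fin fineK//.
by rewrite ge0_fin_numE// (le_lt_trans uj)// ltry.
Qed.

Lemma cvg_L2norm (f_ : nat -> 'rV[R]_n -> R[i]) :
  (\int[mu]_x (normc (f_ j x) ^+ 2)%:E)%E @[j --> \oo] --> 0%E ->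
  L2norm (f_ j) @[j --> \oo] --> 0%E.
Proof.
move=> H; apply/cvge0P => [j|e e0]; first exact: L2norm_ge0.
have I0 j : (0 <= \int[mu]_x (normc (f_ j x) ^+ 2)%:E)%E.
  by apply: integral_ge0 => x _; rewrite lee_fin sqr_ge0.
have [+ _] := cvge0P I0; move=> /(_ H (e * e) (mulr_gt0 e0 e0)).
apply: filterS => j; rewrite -L2norm_sqr EFinM lee_mul_self ?L2norm_ge0// lee_fin.
exact: ltW.
Qed.

Lemma L2norm_dominated (f_ : nat -> 'rV[R]_n -> R[i]) (g : 'rV[R]_n -> \bar R) :
  (forall j, cmeasurable_fun (f_ j)) ->
  {ae mu, forall x, normc (f_ j x) @[j --> \oo] --> 0} ->
  mu.-integrable setT g ->
  {ae mu, forall x, forall j, ((normc (f_ j x) ^+ 2)%:E <= g x)%E} ->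
  L2norm (f_ j) @[j --> \oo] --> 0%E.
Proof.
move=> mf f0 ig fg; apply: cvg_L2norm.
have := @dominated_convergence _ _ R mu setT measurableT
  (fun j x => (normc (f_ j x) ^+ 2)%:E) (cst 0%E) g.
case=> //.
- by move=> j; apply/measurable_EFinP/measurable_funX; exact: measurable_normc.
- apply: filterS f0 => x fx _.
  apply: cvg_EFin; first exact: nearW.
  rewrite -[X in _ --> X](mulr0 0); rewrite /comp/=.
  under eq_fun do rewrite expr2.
  exact: cvgM.
- apply: filterS fg => x fx j _.
  by rewrite abse_EFin ger0_norm ?sqr_ge0.
- by move=> _ _; rewrite integral0.
Qed.

End L2_convergence.

(** * The Riesz-Fischer theorem for fast Cauchy sequences *)

Section riesz_fischer.
Variables (R : realType) (n : nat).
Local Notation mu := (@lebesgue_rV R n).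

(** Absolutely summable increments make both parts convergent. The distance bound, valid for every
    [j], later provides the dominating function. *)
Lemma cvg_increments (z : nat -> R[i]) (M : R) :
  (forall N, \sum_(j < N) normc (z j.+1 - z j) <= M) ->
  exists l, normc (z j - l) @[j --> \oo] --> 0 /\ forall j, normc (z j - l) <= M.
Proof.
move=> HM.
have part (p : R[i] -> R) : {morph p : x y / x - y} -> (forall x, `|p x| <= normc x) ->
    cvgn (fun j => p (z j)).
  move=> pB pn.
  have H : cvgn (series (fun j => p (z j.+1) - p (z j))).
    apply: normed_cvg.
    pose f j := `|p (z j.+1) - p (z j)|.
    have E N : series f N = \sum_(j < N) f j by rewrite /series/= big_mkord.
    suff : cvgn (series f) by [].
    apply: nondecreasing_is_cvgn.
      by apply/nondecreasing_seqP => N; rewrite !E big_ord_recr lerDl normr_ge0.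
    exists M => _ [N _ <-]; rewrite E.
    apply: le_trans (HM N); apply: ler_sum => j _.
    by rewrite /f -pB pn.
  have -> : (fun j => p (z j)) = (fun j => p (z 0%N) + series (fun j => p (z j.+1) - p (z j)) j).
    by apply/funext => N; rewrite /series/= telescope_sumr// addrC subrK.
  by apply: is_cvgD => //; exact: is_cvg_cst.
have cRe := part (@complex.Re R) (fun x y => _) (@ler_Re_normc R).
have cIm := part (@complex.Im R) (fun x y => _) (@ler_Im_normc R).
have {}cRe := cRe (fun x y => etrans (ReD _ _) (congr1 _ (ReN _))).
have {}cIm := cIm (fun x y => etrans (ImD _ _) (congr1 _ (ImN _))).
pose l : R[i] := limn (fun j => complex.Re (z j)) +i* limn (fun j => complex.Im (z j)).
have L : normc (z j - l) @[j --> \oo] --> 0.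
  apply: (@squeeze_cvgr _ _ _ _ (cst 0) (fun j =>
    `|complex.Re (z j) - complex.Re l| + `|complex.Im (z j) - complex.Im l|)).
  - apply: nearW => j; rewrite normc_ge0/=.
    by apply: (le_trans (ler_normcD_ReIm _)); rewrite ReD ImD ReN ImN.
  - exact: cvg_cst.
  - rewrite -(addr0 0); apply: cvgD.
      rewrite -(@normr0 _ R); apply: cvg_norm.
      by rewrite -(subrr (complex.Re l)); apply: cvgB; [exact: cRe|exact: cvg_cst].
    rewrite -(@normr0 _ R); apply: cvg_norm.
    by rewrite -(subrr (complex.Im l)); apply: cvgB; [exact: cIm|exact: cvg_cst].
exists l; split=> // j.
(* Telescoping from [j] to [j + N]: these increments are part of a sum bounded by [M]. *)
have step N : normc (z j - z (j + N)%N) <= M.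
  apply: le_trans (HM (j + N)%N).
  rewrite big_split_ord/= ler_wpDl//; first by apply: sumr_ge0 => *; exact: normc_ge0.
  elim: N => [|N ih]; first by rewrite addn0 subrr normc0 big_ord0.
  rewrite big_ord_recr/= addnS (le_trans _ (lerD ih (lexx _)))//.
  rewrite (normc_sub (z (j + N).+1)) (le_trans _ (normcD _ _))//.
  by rewrite addrA subrK.
apply: (@ler_cvg_to nat \oo _ R (fun N => normc (z j - l)) (fun N => M + normc (z (N + j)%N - l))).
- exact: cvg_cst.
- rewrite -[X in _ --> X]addr0; apply: cvgD; first exact: cvg_cst.
  by have := L; rewrite -(cvg_shiftn j (fun N => normc (z N - l))).
- apply: nearW => N; rewrite addnC (le_trans _ (lerD (step N) (lexx _)))//.
  by rewrite (le_trans _ (normcD _ _))// addrA subrK.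
Qed.

(** Geometric decay of the increments bounds the L^2 norm of the sum of their moduli. That sum is
    therefore finite almost everywhere; it gives pointwise convergence and its square dominates
    [|w_j - w|^2]. *)
Lemma riesz_fischer (w_ : nat -> 'rV[R]_n -> R[i]) (M : R) :
  (forall j, in_L2 (w_ j)) ->
  (forall j, (L2norm (fun x => (w_ j.+1 x - w_ j x)%R) <= (M * 2 ^- j)%:E)%E) ->
  exists2 w, in_L2 w & L2norm (fun x => w_ j x - w x) @[j --> \oo] --> 0%E.
Proof.
move=> w2 wM; have mw j := (w2 j).1.
pose S N x := \sum_(j < N) normc (w_ j.+1 x - w_ j x).
have mS N : measurable_fun setT (S N).
  by apply: measurable_sum => j; apply: measurable_normc; exact: cmeasurableB.
have S0 N x : 0 <= S N x by apply: sumr_ge0 => *; exact: normc_ge0.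
(* [2 - 2 * 2 ^ (- N)] is the sum of [2 ^ (- j)] over [j < N]. *)
have SM N : (L2norm (fun x => (S N x)%:C)%R <= (M * (2 - 2 * 2 ^- N))%:E)%E.
  elim: N => [|N ih].
    have -> : (fun x => (S 0%N x)%:C) = (fun=> 0 : R[i]).
      by apply/funext => x; rewrite /S big_ord0.
    by rewrite L2norm0 lee_fin expr0 invr1 mulr1 subrr mulr0.
  have -> : (fun x => (S N.+1 x)%:C) = (fun x => (S N x)%:C + (normc (w_ N.+1 x - w_ N x))%:C).
    by apply/funext => x; rewrite /S big_ord_recr rmorphD.
  have mB : cmeasurable_fun (fun x => w_ N.+1 x - w_ N x) by exact: cmeasurableB.
  apply: (le_trans (L2normD _ _)).
  - exact: cmeasurable_real.
  - by apply: cmeasurable_real; exact: measurable_normc.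
  - rewrite -[X in (_ + X)%E](_ : L2norm (fun x => w_ N.+1 x - w_ N x)%R = _); last first.
      by apply: eq_L2norm => x; rewrite normcr ger0_norm// normc_ge0.
    apply: (le_trans (leeD ih (wM N))); rewrite -EFinD lee_fin -mulrDr.
    rewrite le_eqVlt; apply/orP; left; apply/eqP; congr (_ * _).
    by rewrite exprS invfM; field; rewrite expf_neq0.
have M0 : 0 <= M.
  have := le_trans (L2norm_ge0 _) (wM 0%N).
  by rewrite lee_fin expr0 invr1 mulr1.
have SM2 N : (\int[mu]_x (S N x ^+ 2)%:E <= ((2 * M) ^+ 2)%:E)%E.
  have -> : (\int[mu]_x (S N x ^+ 2)%:E = \int[mu]_x (normc (S N x)%:C ^+ 2)%:E)%E.
    by apply: eq_integral => x _; rewrite normcr ger0_norm.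
  rewrite -L2norm_sqr expr2 EFinM.
  rewrite lee_mul_self ?L2norm_ge0//; last by rewrite lee_fin mulr_ge0.
  apply: (le_trans (SM N)); rewrite lee_fin mulrC ler_wpM2r//.
  by rewrite lerBlDr lerDl mulr_ge0// invr_ge0 exprn_ge0.
pose g x := limn (fun N => (S N x ^+ 2)%:E).
have ndS x : {homo (fun N => (S N x ^+ 2)%:E) : a b / (a <= b)%N >-> (a <= b)%E}.
  apply/nondecreasing_seqP => N; rewrite lee_fin lerXn2r ?nnegrE//.
  by rewrite /S big_ord_recr/= lerDl normc_ge0.
have mSE N : measurable_fun setT (fun x => (S N x ^+ 2)%:E).
  by apply/measurable_EFinP/measurable_funX.
have SE0 N x : (0 <= (S N x ^+ 2)%:E)%E by rewrite lee_fin sqr_ge0.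
have Sg N x : ((S N x ^+ 2)%:E <= g x)%E.
  rewrite /g (cvg_lim _ (ereal_nondecreasing_cvgn (ndS x)))//.
  by apply: ereal_sup_ubound; exists N.
have mg : measurable_fun setT g.
  apply: (@emeasurable_fun_cvg _ _ _ _ (fun N x => (S N x ^+ 2)%:E)) => // x _.
  by rewrite /g; exact: ereal_nondecreasing_is_cvgn.
have intg : (\int[mu]_x g x <= ((2 * M) ^+ 2)%:E)%E.
  rewrite monotone_convergence//; apply: lime_le; last by apply: nearW => N; exact: SM2.
  apply: ereal_nondecreasing_is_cvgn => a b ab; apply: ge0_le_integral => //.
  by move=> x _; exact: ndS.
have g0 x : (0 <= g x)%E by exact: le_trans (SE0 0%N x) (Sg 0%N x).
have ig : mu.-integrable setT g.
  apply/integrableP; split=> //.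
  under eq_integral do rewrite gee0_abs//.
  by rewrite (le_lt_trans intg) ?ltry.
(* The upper limit is defined and measurable everywhere and coincides with the limit wherever [g] is
   finite. *)
pose w x : R[i] := fine (limn_esup (fun j => (complex.Re (w_ j x))%:E))
  +i* fine (limn_esup (fun j => (complex.Im (w_ j x))%:E)).
have mw' : cmeasurable_fun w.
  split; apply: (measurableT_comp (@fine_measurable R setT measurableT));
    apply: measurable_fun_limn_esup => j; apply/measurable_EFinP; by case: (mw j).
have key : {ae mu, forall x, normc (w_ j x - w x) @[j --> \oo] --> 0 /\
    forall j, ((normc (w_ j x - w x) ^+ 2)%:E <= g x)%E}.
  have := integrable_ae measurableT ig; apply: filterS => x /(_ Logic.I) fgx.
  have gx0 : 0 <= fine (g x) by exact: fine_ge0.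
  have HS N : S N x <= Num.sqrt (fine (g x)).
    rewrite -(ger0_norm (S0 N x)) -sqrtr_sqr ler_wsqrtr// -lee_fin fineK//.
  have [l [cl bl]] := @cvg_increments (fun j => w_ j x) _ HS.
  have -> : w x = l.
    apply: complexE_eq; rewrite /w [LHS]/=.
      have c1 : (complex.Re (w_ j x))%:E @[j --> \oo] --> (complex.Re l)%:E.
        apply: cvg_EFin; first exact: nearW.
        apply/cvgrPdist_le => e e0; have /cvgrPdist_le/(_ e e0) := cl.
        apply: filterS => j; rewrite sub0r normrN => h; rewrite distrC.
        by apply: le_trans (le_trans (ler_norm _) h); rewrite -ReN -ReD ler_Re_normc.
      rewrite is_cvg_limn_esupE; last by apply/cvg_ex; eexists; exact: c1.
      by rewrite (cvg_lim _ c1).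
    have c1 : (complex.Im (w_ j x))%:E @[j --> \oo] --> (complex.Im l)%:E.
      apply: cvg_EFin; first exact: nearW.
      apply/cvgrPdist_le => e e0; have /cvgrPdist_le/(_ e e0) := cl.
      apply: filterS => j; rewrite sub0r normrN => h; rewrite distrC.
      by apply: le_trans (le_trans (ler_norm _) h); rewrite -ImN -ImD ler_Im_normc.
    rewrite is_cvg_limn_esupE; last by apply/cvg_ex; eexists; exact: c1.
    by rewrite (cvg_lim _ c1).
  split=> // j; rewrite -(fineK fgx) lee_fin -(sqr_sqrtr gx0).
  by rewrite lerXn2r ?nnegrE ?normc_ge0 ?sqrtr_ge0.
have cvgw : L2norm (fun x => w_ j x - w x) @[j --> \oo] --> 0%E.
  apply: (L2norm_dominated _ _ ig).
  - by move=> j; exact: cmeasurableB.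
  - by apply: filterS key => x [].
  - by apply: filterS key => x [].
exists w => //; split=> //.
have w0 j : (0 <= L2norm (fun x => (w_ j x - w x)%R))%E by exact: L2norm_ge0.
have [/(_ cvgw 1 ltr01) [N _ /(_ N (leqnn _)) H] _] := cvge0P w0.
rewrite (le_lt_trans (L2normB mw' (mw N)))// lte_add_pinfty//; first by case: (w2 N).
by rewrite L2normC (le_lt_trans H)// ltry.
Qed.

End riesz_fischer.

(** * Density of Schwartz functions in L^2 *)

Section logistic.
Variable R : realType.
Implicit Types (k t : R).

(** The factor [k] before the exponential sends the value at 0 to 0 instead of [1 / 2], so that the
    limit is the indicator of [t < 0] at every point. *)
Definition logistic (k t : R) : R := (1 + k * expR (k * t))^-1.

Lemma logistic_den k t : 0 < k -> 1 <= 1 + k * expR (k * t).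
Proof. by move=> k0; rewrite lerDl mulr_ge0 ?expR_ge0 ?ltW. Qed.

Lemma logistic_ge0 k t : 0 < k -> 0 <= logistic k t.
Proof. by move=> k0; rewrite invr_ge0 (le_trans ler01)// logistic_den. Qed.

Lemma logistic_le1 k t : 0 < k -> logistic k t <= 1.
Proof. by move=> k0; rewrite invf_le1 ?logistic_den// (lt_le_trans ltr01)// logistic_den. Qed.

Lemma is_derive_logistic k t : 0 < k ->
  is_derive t (1 : R) (logistic k) (- k * (logistic k t * (1 - logistic k t))).
Proof.
move=> k0; have d0 : 1 + k * expR (k * t) != 0.
  by rewrite gt_eqF// (lt_le_trans ltr01)// logistic_den.
have d1 : is_derive t (1 : R) (fun t : R => k * t) k.
  by apply: is_derive_eq (is_deriveZ k (is_derive_id t (1 : R))) _; exact: mulr1.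
have d2 := is_derive1_comp (is_derive_expR (k * t)) d1.
have d3 := is_deriveD (is_derive_cst (1 : R) t (1 : R)) (is_deriveZ k d2).
have := @is_deriveV _ (fun t => 1 + k * expR (k * t)) t _ _ d0 d3.
move=> H; apply: is_derive_eq H _.
by rewrite /logistic /GRing.scale/=; field.
Qed.

Lemma logistic_cvg (t : R) :
  logistic j.+1%:R t @[j --> \oo] --> ((t < 0)%R%:R : R).
Proof.
have k0 (k : nat) : 0 < k.+1%:R :> R by rewrite ltr0n.
have [t0|t0] := ltP t 0.
  (* From [exp y >= (y / 2)^2] with [y = k |t|]: the term [k exp (k t)] is at most [4 / (t^2 k)]. *)
  pose C := 4 / t ^+ 2.
  have C0 : 0 <= C by rewrite divr_ge0 ?sqr_ge0.
  have H : (fun k : nat => C * k.+1%:R^-1) @ \oo --> (0 : R).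
    by rewrite -(mulr0 C); apply: cvgM; [exact: cvg_cst|exact: cvg_harmonic].
  apply: (@squeeze_cvgr _ _ _ _ (fun k : nat => 1 - C * k.+1%:R^-1) (cst 1)).
  - apply: nearW => k; rewrite logistic_le1// andbT.
    set K := k.+1%:R : R; pose u := K * expR (K * t).
    have u0 : 0 <= u by rewrite mulr_ge0 ?expR_ge0 ?ltW.
    have uC : u <= C * K^-1.
      have e1 : K * (- t) / 2 <= expR (K * (- t) / 2).
        by rewrite (le_trans _ (expR_ge1Dx _))// lerDr.
      have e2 : (K * (- t) / 2) ^+ 2 <= expR (K * (- t)).
        rewrite [leRHS](_ : _ = expR (K * (- t) / 2) ^+ 2); last first.
          by rewrite expr2 -expRD -splitr.
        by rewrite lerXn2r ?nnegrE ?expR_ge0// divr_ge0// mulr_ge0 ?oppr_ge0 ?ltW.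
      rewrite /u -[t]opprK mulrN expRN ler_pdivrMr ?expR_gt0//.
      apply: le_trans (ler_wpM2l _ e2); last by rewrite divr_ge0// ltW.
      rewrite le_eqVlt; apply/orP; left; apply/eqP; rewrite /C; field.
      by rewrite (lt_eqF t0) gt_eqF.
    rewrite lerBlDr -lerBlDl (le_trans _ uC)//.
    have u1 : 0 < 1 + u by rewrite ltr_wpDr.
    rewrite -[X in X - _](mulfV (lt0r_neq0 u1)) /logistic -/u -[X in _ - X]mul1r -mulrBl.
    by rewrite addrAC subrr add0r ler_pdivrMr// ler_peMr// lerDl.
  - by rewrite -[X in _ --> X]subr0; apply: cvgB; [exact: cvg_cst|exact: H].
  - exact: cvg_cst.
apply: (@squeeze_cvgr _ _ _ _ (cst 0) (fun k : nat => k.+1%:R^-1)).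
- apply: nearW => k; rewrite logistic_ge0//=.
  rewrite lef_pV2 ?posrE// ?(lt_le_trans ltr01 (logistic_den _ _))//.
  rewrite ler_wpDl// ler_peMr ?(ltW (k0 k))//.
  by rewrite -expR0 ler_expR mulr_ge0 ?(ltW (k0 k)).
- exact: cvg_cst.
- exact: cvg_harmonic.
Qed.

End logistic.

(** * Smooth steps times a Gaussian *)

Section gaussian_algebra.
Variables (R : realType) (n : nat).
Local Notation mu := (@lebesgue_rV R n).
Implicit Types (f g : 'rV[R]_n -> R[i]).

Definition gaussian (x : 'rV[R]_n) : R := expR (- dotp x x).

Lemma gaussian_gt0 x : 0 < gaussian x.
Proof. exact: expR_gt0. Qed.

Lemma gaussian_derive x i : cderivable (fun y => (gaussian y)%:C) x /\
  partial i (fun y => (gaussian y)%:C) x = (-2)%:C * (x ord0 i)%:C * (gaussian x)%:C.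
Proof.
have d : is_derive (dotp x x) 1 (fun t : R => expR (- t)) (- expR (- dotp x x)).
  have -> : - expR (- dotp x x) = expR (- dotp x x) * (- 1 : R) by rewrite mulrN1.
  exact: is_derive1_comp.
have [dg pg] := @derive_comp R n _ (fun y => dotp y y) x i _ d (differentiable_dotp x).
split; first exact: cderivable_real.
rewrite partial_real pg derive_dotp -!rmorphM; congr (_%:C).
by rewrite /gaussian; ring.
Qed.

Lemma gaussian_rapid : (0 < n)%N -> rapid (fun x => (gaussian x)%:C).
Proof.
move=> n0; split=> [x|N]; first by case: (gaussian_derive x (Ordinal n0)).
exists (N.+1%:R ^+ N.+1) => x; have D0 := dotp_ge0 x.
rewrite normcr gtr0_norm ?gaussian_gt0// /gaussian expRN ler_pdivrMr ?expR_gt0//.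
have N0 : 0 < N.+1%:R :> R by rewrite ltr0n.
(* Splitting the exponential into [N + 1] factors and using [1 + r <= exp r] in each beats
   [<x> ^ (2 (N + 1))]. *)
have -> : expR (dotp x x) = expR (dotp x x / N.+1%:R) ^+ N.+1.
  by rewrite -expRM_natl mulrC divfK// gt_eqF.
rewrite -exprMn; apply: (le_trans (y := (japanese x ^+ 2) ^+ N.+1)).
  by rewrite -exprM ler_weXn2l ?japanese_ge1// mulSn mul1n (leq_trans (leqnSn _))// leq_addr.
rewrite lerXn2r ?nnegrE ?sqr_ge0 ?mulr_ge0 ?expR_ge0//.
rewrite (@jap_sqr _ _ 1)//; apply: le_trans (ler_wpM2l _ (expR_ge1Dx _)) => //.
by rewrite mulrDr mulr1 mulrC divfK ?gt_eqF// lerD2r ler1n.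
Qed.

(* Stable under partial derivatives, as the logistic function [s] of slope [k]
   satisfies [s' = - k s (1 - s)]. *)
Inductive step_alg : ('rV[R]_n -> R[i]) -> Prop :=
| step_alg_cst c : step_alg (fun=> c)
| step_alg_coord j : step_alg (fun x => (x ord0 j)%:C)
| step_alg_logistic k i a : 0 < k -> step_alg (fun x => (logistic k (x ord0 i - a))%:C)
| step_algD f g : step_alg f -> step_alg g -> step_alg (fun x => f x + g x)
| step_algM f g : step_alg f -> step_alg g -> step_alg (fun x => f x * g x).

Lemma logistic_coord_derive k a j x i : 0 < k ->
  cderivable (fun y : 'rV[R]_n => (logistic k (y ord0 j - a))%:C) x /\
  partial i (fun y : 'rV[R]_n => (logistic k (y ord0 j - a))%:C) x =
  (- k * (j == i)%:R)%:C * ((logistic k (x ord0 j - a))%:C *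
    (1 + (-1)%:C * (logistic k (x ord0 j - a))%:C)).
Proof.
move=> k0; have dq : differentiable (fun y : 'rV[R]_n => y ord0 j - a) x.
  by apply: differentiableB; [exact: differentiable_coord|exact: differentiable_cst].
have [dg pg] := @derive_comp R n _ (fun y : 'rV[R]_n => y ord0 j - a) x i _ (is_derive_logistic (x ord0 j - a) k0) dq.
split; first exact: cderivable_real.
rewrite partial_real pg.
have -> : 'D_(delta_mx ord0 i) (fun y : 'rV[R]_n => y ord0 j - a) x = (j == i)%:R.
  rewrite deriveB; last exact: derivable_cst.
    by rewrite derive_cst subr0 derive_coord.
  by apply: diff_derivable; exact: differentiable_coord.
by apply: complexE_eq => /=; ring.
Qed.

Lemma step_alg_slow f : step_alg f -> slow f.
Proof.
have J1 x m : 1 <= @japanese R n x ^+ m by rewrite exprn_ege1// japanese_ge1.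
elim=> {f}[c|j|k i a k0|f g _ [df [N [B HB]]] _ [dg [N' [B' HB']]]|
    f g _ [df [N [B HB]]] _ [dg [N' [B' HB']]]].
- split=> [x|]; first exact: cderivable_cst.
  by exists 0%N, (normc c) => x; rewrite expr0 mulr1.
- split=> [x|]; first exact: cderivable_coord.
  exists 1%N, 1 => x; rewrite normcr expr1 mul1r.
  by rewrite (coord_le_jap _ _ ltr01).
- split=> [x|]; first by case: (logistic_coord_derive a i x i k0).
  exists 0%N, 1 => x; rewrite normcr expr0 mulr1 ger0_norm ?logistic_ge0//.
  exact: logistic_le1.
- split=> [x|]; first exact: cderivableD.
  exists (N + N')%N, (`|B| + `|B'|) => x.
  have Jn m : 0 <= @japanese R n x ^+ m by rewrite (le_trans ler01).
  rewrite (le_trans (normcD _ _))// mulrDl lerD//.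
    rewrite (le_trans (HB x))// exprD (le_trans (ler_wpM2r (Jn N) (ler_norm B)))//.
    by rewrite ler_wpM2l// ler_peMr.
  rewrite (le_trans (HB' x))// exprD (le_trans (ler_wpM2r (Jn N') (ler_norm B')))//.
  by rewrite ler_wpM2l// ler_peMl.
- split=> [x|]; first exact: cderivableM.
  exists (N + N')%N, (B * B') => x.
  by rewrite normcM exprD mulrACA ler_pM ?normc_ge0.
Qed.

Lemma step_alg_partial f i : step_alg f -> step_alg (partial i f).
Proof.
elim=> {f}[c|j|k j a k0|f g sf pf sg pg|f g sf pf sg pg].
- rewrite (_ : partial i _ = fun=> 0); first exact: step_alg_cst.
  by apply/funext => x; rewrite partial_cst.
- rewrite (_ : partial i _ = fun=> ((j == i)%:R)%:C); first exact: step_alg_cst.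
  by apply/funext => x; rewrite partial_coord.
- rewrite (_ : partial i _ = fun x => (- k * (j == i)%:R)%:C * ((logistic k (x ord0 j - a))%:C *
    (1 + (-1)%:C * (logistic k (x ord0 j - a))%:C))).
    have sl := step_alg_logistic j a k0.
    apply: step_algM; first exact: step_alg_cst.
    apply: step_algM => //; apply: step_algD; first exact: step_alg_cst.
    by apply: step_algM => //; exact: step_alg_cst.
  by apply/funext => x; case: (logistic_coord_derive a j x i k0).
- rewrite (_ : partial i _ = fun x => partial i f x + partial i g x); first exact: step_algD.
  apply/funext => x; apply: partialD; [exact: (step_alg_slow sf).1|exact: (step_alg_slow sg).1].
- rewrite (_ : partial i _ = fun x => partial i f x * g x + f x * partial i g x).
    by apply: step_algD; exact: step_algM.
  apply/funext => x; apply: partialM; [exact: (step_alg_slow sf).1|exact: (step_alg_slow sg).1].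
Qed.

(** A derivative of the Gaussian is a coordinate times the Gaussian up to a constant, so algebra
    times Gaussian is closed under [partial] and [schwartz_stable] applies. *)
Lemma step_alg_schwartz f : (0 < n)%N -> step_alg f -> schwartz (fun x => f x * (gaussian x)%:C).
Proof.
move=> n0 sf.
apply: (@schwartz_stable _ _ (fun g => exists2 f, step_alg f & g = (fun x => f x * (gaussian x)%:C)));
  last by exists f.
  by move=> _ [g sg ->]; exact: rapid_slow (step_alg_slow sg) (gaussian_rapid n0).
move=> _ i [g sg ->].
exists (fun x => partial i g x + g x * ((-2)%:C * (x ord0 i)%:C)).
  apply: step_algD; first exact: step_alg_partial.
  apply: step_algM => //; apply: step_algM; [exact: step_alg_cst|exact: step_alg_coord].
apply/funext => x; have [dG pG] := gaussian_derive x i.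
rewrite partialM//; last exact: (step_alg_slow sg).1.
by rewrite pG mulrDl -!mulrA.
Qed.

End gaussian_algebra.
Import HBNNSimple.

Section density.
Variables (R : realType) (n : nat).
Hypothesis n0 : (0 < n)%N.
Local Notation mu := (@lebesgue_rV R n).
Implicit Types (f g : 'rV[R]_n -> R[i]) (A : set 'rV[R]_n).

Definition schwartz_approx f := cmeasurable_fun f /\
  forall e : R, 0 < e -> exists2 phi, schwartz phi & (L2norm (fun x => f x - phi x)%R <= e%:E)%E.

Lemma schwartz_cmeasurable f : schwartz f -> cmeasurable_fun f.
Proof. by move=> /schwartz_psch; exact: psch_cmeasurable. Qed.

Lemma schwartz_approx_schwartz f : schwartz f -> schwartz_approx f.
Proof.
move=> sf; split=> [|e e0]; first exact: schwartz_cmeasurable.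
exists f => //; rewrite (_ : (fun x => _) = (fun=> 0)); first by rewrite L2norm0 lee_fin ltW.
by apply/funext => x; rewrite subrr.
Qed.

Lemma schwartz_approx_lim (f_ : nat -> 'rV[R]_n -> R[i]) f : cmeasurable_fun f ->
  (forall j, schwartz_approx (f_ j)) ->
  L2norm (fun x => f_ j x - f x) @[j --> \oo] --> 0%E -> schwartz_approx f.
Proof.
move=> mf af cf; split=> // e e0.
have e20 : 0 < e / 2 by rewrite divr_gt0.
have w0 j : (0 <= L2norm (fun x => (f_ j x - f x)%R))%E by exact: L2norm_ge0.
have [/(_ cf _ e20) [N _ /(_ N (leqnn _)) H] _] := cvge0P w0.
have [mN aN] := af N; have [phi sp pe] := aN _ e20.
exists phi => //; rewrite (le_trans (L2normB_trans mf mN (schwartz_cmeasurable sp)))//.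
by rewrite L2normC [e]splitr EFinD leeD.
Qed.

Lemma schwartz_approx_lin (c : R[i]) f g : schwartz_approx f -> schwartz_approx g ->
  schwartz_approx (fun x => c * f x + g x).
Proof.
move=> [mf af] [mg ag]; split=> [|e e0].
  by apply: cmeasurableD => //; apply: cmeasurableM => //; exact: cmeasurable_cst.
have c1 : 0 < normc c + 1 by rewrite ltr_wpDl ?normc_ge0.
have e1 : 0 < e / 2 / (normc c + 1) by rewrite !divr_gt0.
have e2 : 0 < e / 2 by rewrite divr_gt0.
have [p sp pe] := af _ e1; have [q sq qe] := ag _ e2.
exists (fun x => c * p x + q x); first exact: schwartz_lin.
have mp := schwartz_cmeasurable sp; have mq := schwartz_cmeasurable sq.
have mfp : cmeasurable_fun (fun x => f x - p x) by exact: cmeasurableB.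
have mgq : cmeasurable_fun (fun x => g x - q x) by exact: cmeasurableB.
rewrite (_ : (fun x => _) = (fun x => c * (f x - p x) + (g x - q x))); last first.
  by apply/funext => x; ring.
have mc : cmeasurable_fun (fun x => c * (f x - p x)).
  by apply: cmeasurableM => //; exact: cmeasurable_cst.
rewrite (le_trans (L2normD mc mgq))// L2normZ// [e]splitr EFinD leeD//.
apply: (le_trans (lee_wpmul2l _ pe)); first by rewrite lee_fin normc_ge0.
rewrite -EFinM lee_fin mulrA ler_pdivrMr// mulrC ler_wpM2l ?(ltW e2)//.
by rewrite lerDl.
Qed.

(** The Gaussian weight makes every measurable set contribute an L^2 function, including the
    complements met in the Dynkin argument. *)
Definition gaussian_on A (x : 'rV[R]_n) : R[i] := (\1_A x * gaussian x)%:C.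

Lemma gaussian_schwartz : schwartz (fun x : 'rV[R]_n => (gaussian x)%:C).
Proof.
have := @step_alg_schwartz R n (fun=> 1) n0 (step_alg_cst n 1); congr schwartz.
by apply/funext => x; rewrite mul1r.
Qed.

Lemma integrable_gaussian_sqr :
  mu.-integrable setT (fun x : 'rV[R]_n => (gaussian x ^+ 2)%:E).
Proof.
have [mg g2] := psch_in_L2 n0 (schwartz_psch gaussian_schwartz).
have E : (\int[mu]_x (normc (gaussian x)%:C ^+ 2)%:E = \int[mu]_x (gaussian x ^+ 2)%:E)%E.
  by apply: eq_integral => x _; rewrite normcr ger0_norm ?ltW ?gaussian_gt0.
apply/integrableP; split.
  by apply/measurable_EFinP/measurable_funX; case: mg.
under eq_integral do rewrite abse_EFin ger0_norm ?sqr_ge0//.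
by rewrite -E -L2norm_sqr lte_mul_pinfty ?L2norm_ge0// ge0_fin_numE ?L2norm_ge0.
Qed.

Lemma measurable_gaussian : measurable_fun setT (@gaussian R n).
Proof. by case: (schwartz_cmeasurable gaussian_schwartz). Qed.

Lemma schwartz_approx_gaussian_dominated (f_ : nat -> 'rV[R]_n -> R) (f : 'rV[R]_n -> R) :
  measurable_fun setT f -> (forall x, 0 <= f x <= 1) -> (forall j x, 0 <= f_ j x <= 1) ->
  (forall x, f_ j x @[j --> \oo] --> f x) ->
  (forall j, schwartz_approx (fun x => (f_ j x * gaussian x)%:C)) ->
  schwartz_approx (fun x => (f x * gaussian x)%:C).
Proof.
move=> mf f01 fj01 fc fa.
have mfg : cmeasurable_fun (fun x => (f x * gaussian x)%:C).
  by apply: cmeasurable_real; apply: measurable_funM => //; exact: measurable_gaussian.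
apply: (schwartz_approx_lim mfg fa).
have E j x : normc ((f_ j x * gaussian x)%:C - (f x * gaussian x)%:C) =
    `|f_ j x - f x| * gaussian x.
  rewrite -rmorphB normcr -mulrBl normrM (gtr0_norm (gaussian_gt0 x))//.
apply: (L2norm_dominated _ _ integrable_gaussian_sqr).
- by move=> j; apply: cmeasurableB => //; case: (fa j).
- apply: aeW => x; under eq_fun do rewrite E.
  rewrite -(mul0r (gaussian x)); apply: cvgM; last exact: cvg_cst.
  rewrite -(@normr0 _ R); apply: cvg_norm; rewrite -(subrr (f x)).
  by apply: cvgB; [exact: fc|exact: cvg_cst].
- apply: aeW => x j; rewrite E lee_fin lerXn2r ?nnegrE ?mulr_ge0 ?(ltW (gaussian_gt0 _))//.
  rewrite ler_piMl ?(ltW (gaussian_gt0 _))// ler_norml.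
  by have /andP[? ?] := f01 x; have /andP[? ?] := fj01 j x; apply/andP; split; lra.
Qed.

Definition step_fac (k : R) (a : \bar R) (t : R) : R :=
  match a with r%:E => logistic k (t - r) | +oo%E => 1 | -oo%E => 0 end.

(** Extended bounds make half-spaces boxes, [+oo] leaving a coordinate free, and keep the family
    stable under intersection. *)
Definition lower_box (a : 'I_n -> \bar R) : set 'rV[R]_n :=
  [set x | forall i, ((x ord0 i)%:E < a i)%E].

Lemma step_fac01 k a t : 0 < k -> 0 <= step_fac k a t <= 1.
Proof. by move=> k0; case: a => [r| |]/=; rewrite ?lexx ?ler01// logistic_ge0// logistic_le1. Qed.

Lemma step_fac_cvg a t : step_fac j.+1%:R a t @[j --> \oo] --> ((t%:E < a)%E%:R : R).
Proof.
case: a => [r| |].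
- rewrite lte_fin -subr_lt0; exact: logistic_cvg.
- by rewrite ltry; exact: cvg_cst.
- by rewrite ltNge leNye; exact: cvg_cst.
Qed.

(** A product of logistic functions converges to the indicator at every point, and times the
    Gaussian each of them is Schwartz. *)
Lemma schwartz_approx_box a : measurable (lower_box a) -> schwartz_approx (gaussian_on (lower_box a)).
Proof.
move=> ma.
pose F j (x : 'rV[R]_n) : R := \prod_i step_fac j.+1%:R (a i) (x ord0 i).
apply: (@schwartz_approx_gaussian_dominated F (\1_(lower_box a))).
- exact: measurable_indic.
- by move=> x; rewrite indicE; case: (_ \in _); rewrite lexx ler01.
- move=> j x; apply/andP; split.
    by apply: prodr_ge0 => i _; have /andP[] := @step_fac01 j.+1%:R (a i) (x ord0 i) (ltr0Sn _ _).
  by apply: prodr_ile1 => i _; apply: step_fac01; exact: ltr0Sn.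
- move=> x.
  have -> : \1_(lower_box a) x = \prod_i ((x ord0 i)%:E < a i)%E%:R :> R.
    have [H|H] := pselect (lower_box a x).
      by rewrite indicE mem_set// big1// => i _; rewrite (H i).
    rewrite indicE memNset//; have [i Hi] : exists i, ~ ((x ord0 i)%:E < a i)%E.
      by apply/existsNP.
    by rewrite (bigD1 i)//= (negbTE (introN idP Hi)) mul0r.
  rewrite /F; elim: (index_enum _) => [|i s ih].
    by under eq_fun do rewrite big_nil; rewrite big_nil; exact: cvg_cst.
  under eq_fun do rewrite big_cons; rewrite big_cons.
  by apply: cvgM => //; exact: step_fac_cvg.
- move=> j; apply: schwartz_approx_schwartz.
  have -> : (fun x => (F j x * gaussian x)%:C) = (fun x => (F j x)%:C * (gaussian x)%:C).
    by apply/funext => x; rewrite rmorphM.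
  apply: step_alg_schwartz => //.
  rewrite /F; elim: (index_enum _) => [|i s ih].
    by under eq_fun do rewrite big_nil; exact: step_alg_cst.
  under eq_fun do rewrite big_cons rmorphM; apply: step_algM => //.
  case: (a i) => [r| |]/=; [|exact: step_alg_cst|exact: step_alg_cst].
  by apply: step_alg_logistic; exact: ltr0Sn.
Qed.

(** Unlike the coordinate preimages defining the sigma-algebra, these boxes are stable under
    intersection, as the Dynkin argument requires. *)
Lemma measurable_rV_generated : @measurable _ 'rV[R]_n = <<s range lower_box >>.
Proof.
apply/seteqP; split=> [A mA|]; last first.
  apply: smallest_sub; first exact: sigma_algebra_measurable.
  move=> _ [a _ <-].
  rewrite (_ : lower_box a = \bigcap_(i in [set: 'I_n]) [set x | ((x ord0 i)%:E < a i)%E]); last first.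
    by apply/seteqP; split=> x /= H i; [move=> _; exact: H|exact: H].
  apply: fin_bigcap_measurable => // i _.
  have mc : measurable_fun setT (fun x : 'rV[R]_n => (x ord0 i)%:E).
    by apply/measurable_EFinP; exact: measurable_rV_coord.
  by have := emeasurable_fun_infty_o measurableT mc (a i); rewrite setTI.
move: A mA; apply: smallest_sub; first exact: smallest_sigma_algebra.
move=> A; rewrite -bigcup_seq => -[i _ [B mB <-]].
have mB' : (RGenInftyO.G (R := R)).-sigma.-measurable B.
  by rewrite -RGenInftyO.measurableE.
move: B mB' {mB}.
have := sigma_algebra_image (D := setT) (fun x : 'rV[R]_n => x ord0 i)
  (smallest_sigma_algebra setT (range lower_box)).
move=> /smallest_sub; apply => _ [r ->].
rewrite /image_set_system/= setTI; apply: sub_sigma_algebra.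
exists (fun j => if j == i then r%:E else +oo%E) => //.
apply/seteqP; split=> x /=.
  by move=> /(_ i); rewrite eqxx lte_fin in_itv.
rewrite in_itv/= => xr j; case: eqP => [->|_]; last by rewrite ltry.
by rewrite lte_fin.
Qed.

Lemma sum_indic_trivIset (F : nat -> set 'rV[R]_n) N k0 x : trivIset setT F -> F k0 x ->
  \sum_(k < N) \1_(F k) x = (k0 < N)%N%:R :> R.
Proof.
move=> /trivIsetP tF Fx.
have F0 k : k != k0 -> \1_(F k) x = 0 :> R.
  move=> kk; rewrite indicE memNset// => Fk.
  by have /seteqP[/(_ x) + _] := tF k k0 Logic.I Logic.I kk; apply; split.
have [kN|Nk] := ltnP k0 N.
  rewrite (bigD1 (Ordinal kN))//= indicE mem_set// big1 ?addr0// => k.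
  by rewrite -val_eqE/= => /F0.
by rewrite big1// => k _; apply: F0; rewrite ltn_eqF// (leq_trans (ltn_ord k)).
Qed.

Lemma schwartz_approx0 : schwartz_approx (fun=> 0).
Proof.
have g := schwartz_approx_schwartz gaussian_schwartz.
have := schwartz_approx_lin (-1) g g; congr schwartz_approx.
by apply/funext => x; rewrite mulN1r addNr.
Qed.

(** Dynkin induction: a complement is the full Gaussian minus the part already treated, and a
    disjoint union is a dominated limit of finite sums. *)
Lemma schwartz_approx_gaussian_on A : measurable A -> schwartz_approx (gaussian_on A).
Proof.
move=> mA.
pose P (B : set 'rV[R]_n) := schwartz_approx (gaussian_on B).
have := @dynkin_induction _ 'rV[R]_n (range lower_box) P measurable_rV_generated.
apply => //.
- move=> _ _ [a _ <-] [b _ <-]; exists (fun i => mine (a i) (b i)) => //.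
  apply/seteqP; split=> x /=.
    by move=> H; split=> i; have := H i; rewrite lt_min => /andP[].
  by move=> [H1 H2] i; rewrite lt_min H1 H2.
- have := schwartz_approx_schwartz gaussian_schwartz; congr schwartz_approx.
  by apply/funext => x; rewrite /gaussian_on indicT mul1r.
- move=> _ [a _ <-]; apply: schwartz_approx_box.
  by rewrite measurable_rV_generated; apply: sub_sigma_algebra; exists a.
- move=> S mS PS.
  have := schwartz_approx_lin (-1) PS (schwartz_approx_schwartz gaussian_schwartz).
  congr schwartz_approx; apply/funext => x; rewrite /gaussian_on !indicE in_setC.
  by apply: complexE_eq; case: (x \in S); rewrite /=; ring.
- move=> F mF tF PF.
  apply: (@schwartz_approx_gaussian_dominated (fun N x => \sum_(k < N) \1_(F k) x)).
  + by apply: measurable_indic; exact: bigcup_measurable.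
  + by move=> x; rewrite indicE; case: (_ \in _); rewrite lexx ler01.
  + move=> N x; have [[k Fk]|nF] := pselect (exists k, F k x).
      by rewrite (sum_indic_trivIset N tF Fk); case: (_ < _)%N; rewrite lexx ler01.
    rewrite big1 ?lexx ?ler01// => k _; rewrite indicE memNset// => Fk.
    by apply: nF; exists k.
  + move=> x; have [[k Fk]|nF] := pselect (exists k, F k x).
      apply: cvg_near_cst; exists k.+1 => // N /= kN.
      by rewrite (sum_indic_trivIset N tF Fk) kN indicE mem_set//; exists k.
    apply: cvg_near_cst; apply: nearW => N.
    rewrite indicE memNset; last by move=> [k _ Fk]; apply: nF; exists k.
    by rewrite big1// => k _; rewrite indicE memNset// => Fk; apply: nF; exists k.
  + elim=> [|N ih].
      have := schwartz_approx0; congr schwartz_approx.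
      by apply/funext => x; rewrite big_ord0 mul0r.
    have := schwartz_approx_lin 1 (PF N) ih; congr schwartz_approx.
    by apply/funext => x; rewrite big_ord_recr/= /gaussian_on mul1r -rmorphD -mulrDl addrC.
- by rewrite -measurable_rV_generated.
Qed.

(** Simple functions increase to [u / gaussian]; multiplied back by the Gaussian they are
    combinations of [gaussian_on], and [u^2] dominates the squared errors. *)
Lemma schwartz_approx_ge0 (u : 'rV[R]_n -> R) : measurable_fun setT u -> (forall x, 0 <= u x) ->
  mu.-integrable setT (fun x => (u x ^+ 2)%:E) -> schwartz_approx (fun x => (u x)%:C).
Proof.
move=> mu_ u0 iu.
pose v x := u x / gaussian x.
have g0 x := gaussian_gt0 x : 0 < @gaussian R n x.
have mv : measurable_fun setT (EFin \o v).
  apply/measurable_EFinP; apply: measurable_funM => //.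
  have -> : (fun x => (gaussian x)^-1) = (fun x : 'rV[R]_n => expR (dotp x x)).
    by apply/funext => x; rewrite /gaussian expRN invrK.
  by apply: measurableT_comp => //; exact: measurable_dotp.
have v0 x : setT x -> (0 <= (EFin \o v) x)%E by move=> _; rewrite lee_fin divr_ge0// ltW.
have [phi [nd_phi cv_phi]] := @approximation _ _ R setT measurableT _ mv v0.
pose ph j : 'rV[R]_n -> R := HBNNSimple.NonNegSimpleFun.sort (phi j).
have phi_cvg x : ph j x @[j --> \oo] --> v x.
  by have /fine_cvgP[] := cv_phi x Logic.I.
have phi_le j x : ph j x <= v x.
  rewrite -(cvg_lim _ (phi_cvg x))//.
  apply: (@nondecreasing_cvgn_le _ (fun j => ph j x)); last by apply/cvg_ex; exists (v x); exact: phi_cvg.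
  by move=> a b /nd_phi /lefP/(_ x).
have ap j : schwartz_approx (fun x => (ph j x * gaussian x)%:C).
  have sum_approx (I : Type) (s : seq I) (c : I -> R) (A : I -> set 'rV[R]_n) :
      (forall i, measurable (A i)) ->
      schwartz_approx (fun x => ((\sum_(i <- s) c i * \1_(A i) x) * gaussian x)%:C).
    move=> mA; elim: s => [|i s ih].
      have := schwartz_approx0; congr schwartz_approx.
      by apply/funext => x; rewrite big_nil mul0r.
    have := schwartz_approx_lin (c i)%:C (schwartz_approx_gaussian_on (mA i)) ih.
    congr schwartz_approx; apply/funext => x.
    by rewrite big_cons /gaussian_on -rmorphM -rmorphD mulrDl mulrA.
  rewrite (_ : (fun x => _) = (fun x => ((\sum_(i <- index_enum _)
      (finmap.enum_fset (fset_set (range (phi j))))`_(i : 'I_(size (finmap.enum_fset (fset_set (range (phi j))))))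
      * \1_(phi j @^-1` [set (finmap.enum_fset (fset_set (range (phi j))))`_i]) x) * gaussian x)%:C)).
    apply: sum_approx => i; rewrite -[X in measurable X]setTI.
    by apply: measurable_funP => //; exact: measurable_set1.
  by apply/funext => x; rewrite /ph [in LHS]fimfunEord.
have mu' : cmeasurable_fun (fun x => (u x)%:C) by exact: cmeasurable_real.
apply: (schwartz_approx_lim mu' ap).
have E j x : normc ((ph j x * gaussian x)%:C - (u x)%:C) = (v x - ph j x) * gaussian x.
  rewrite -rmorphB normcr distrC ger0_norm; first by rewrite mulrBl divfK// gt_eqF.
  by rewrite subr_ge0 -ler_pdivlMr.
apply: (L2norm_dominated _ _ iu).
- by move=> j; apply: cmeasurableB => //; case: (ap j).
- apply: aeW => x; under eq_fun do rewrite E.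
  rewrite -(mul0r (gaussian x)) -(subrr (v x)); apply: cvgM; last exact: cvg_cst.
  by apply: cvgB; [exact: cvg_cst|exact: phi_cvg].
- apply: aeW => x j; rewrite E lee_fin lerXn2r ?nnegrE ?mulr_ge0 ?subr_ge0 ?(ltW (g0 _))//.
  by rewrite -ler_pdivlMr// lerBlDr lerDl.
Qed.

Lemma schwartz_dense f : in_L2 f -> schwartz_approx f.
Proof.
move=> [mf f2].
have sqr_int (u : 'rV[R]_n -> R) : measurable_fun setT u -> (forall x, `|u x| <= normc (f x)) ->
    mu.-integrable setT (fun x => (u x ^+ 2)%:E).
  move=> mu_ uf; apply/integrableP; split; first exact/measurable_EFinP/measurable_funX.
  apply: (@le_lt_trans _ _ (\int[mu]_x (normc (f x) ^+ 2)%:E)%E).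
    apply: ge0_le_integral => //.
    - by apply/measurableT_comp => //; apply/measurable_EFinP/measurable_funX.
    - by apply/measurable_EFinP/measurable_funX; exact: measurable_normc.
    - move=> x _; rewrite abse_EFin lee_fin ger0_norm ?sqr_ge0// -real_normK ?num_real//.
      by rewrite lerXn2r ?nnegrE ?normc_ge0.
  by rewrite -L2norm_sqr lte_mul_pinfty ?L2norm_ge0// ge0_fin_numE ?L2norm_ge0.
have real_approx (u : 'rV[R]_n -> R) : measurable_fun setT u -> (forall x, `|u x| <= normc (f x)) ->
    schwartz_approx (fun x => (u x)%:C).
  move=> mu_ uf.
  have mm (w : 'rV[R]_n -> R) : measurable_fun setT w -> (forall x, `|w x| <= normc (f x)) ->
     schwartz_approx (fun x => (Num.max (w x) 0)%:C).
    move=> mw wf.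
    have mmax : measurable_fun setT (fun x => Num.max (w x) 0).
      by apply: measurable_maxr => //; exact: measurable_cst.
    apply: schwartz_approx_ge0 => //; first by move=> x; rewrite le_max lexx orbT.
    apply: sqr_int => // x; apply: le_trans (wf x).
    by rewrite ger0_norm ?le_max ?lexx ?orbT// ge_max normr_ge0 ler_norm.
  have a1 := mm _ mu_ uf.
  have a2 : schwartz_approx (fun x => (Num.max (- u x) 0)%:C).
    by apply: mm => [|x]; [exact: measurable_funN|rewrite normrN].
  have := schwartz_approx_lin (-1) a2 a1; congr schwartz_approx; apply/funext => x.
  apply: complexE_eq; rewrite /= ?mulr0 ?mul0r; [|ring].
  by case: (leP 0 (u x)) => ux; rewrite /Num.max; case: ltP; case: ltP; lra.
have [mRe mIm] := mf.
have aR := real_approx _ mRe (fun x => ler_Re_normc (f x)).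
have aI := real_approx _ mIm (fun x => ler_Im_normc (f x)).
have := schwartz_approx_lin 'i aI aR; congr schwartz_approx; apply/funext => x.
by apply: complexE_eq; case: (f x) => a b /=; ring.
Qed.

End density.

(** * Boundedness on Sobolev spaces *)

Section Op_bound.
Variables (R : realType) (n : nat).
Hypothesis n0 : (0 < n)%N.
Local Notation mu := (@lebesgue_rV R n).
Local Notation japn := (@japanese R n).
Implicit Types (a : 'rV[R]_n -> 'rV[R]_n -> R[i]) (f g w : 'rV[R]_n -> R[i]).

Lemma cvge0_le (v : nat -> \bar R) (e : R) : (forall j, 0 <= v j)%E ->
  v j @[j --> \oo] --> 0%E -> 0 < e -> \forall j \near \oo, (v j <= e%:E)%E.
Proof. by move=> v0 /(cvge0P v0); apply. Qed.

Lemma schwartzB f g : schwartz f -> schwartz g -> schwartz (fun x => f x - g x).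
Proof.
move=> sf sg; have := schwartz_lin (-1) sg sf; congr schwartz.
by apply/funext => x; rewrite mulN1r addrC.
Qed.

Lemma symb_slow0 i M s B f : symb i M japn s B f -> slow f.
Proof. by move=> sf; apply: (@symb_slow _ _ i 0 s B) => m m0; apply: sf; apply: leq_trans m0 _. Qed.

Lemma OpB (h : R) a f g x : 0 < h -> slow (a x) -> psch f -> psch g ->
  Op h a (fun y => f y - g y) x = Op h a f x - Op h a g x.
Proof.
move=> h0 sa pf pg; have ifx := psch_cintegrable n0 pf; have igx := psch_cintegrable n0 pg.
have s0 : h^-1 != 0 by rewrite invr_eq0 gt_eqF.
rewrite !OpE//; last exact: cintegrableB.
rewrite -mulrBr; congr (_ * _).
have iF u : psch u -> cintegrable mu (fun xi => expi (- h^-1 * dotp xi x) * (a x xi * FT h^-1 u xi)).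
  move=> pu; apply: cintegrable_phase; apply: rapid_cintegrable.
  by apply: rapid_slow => //; apply: (psch_rapid n0); exact: FT_psch.
rewrite /FT -cintB; [|exact: iF..].
apply: eq_cint => xi; rewrite -!mulrBr; congr (_ * (_ * _)).
by rewrite /FT -cintB; [apply: eq_cint => y; rewrite mulrBr|exact: cintegrable_phase..].
Qed.

Lemma Op_L2_bound (k k' : R) : k < k' -> exists2 M : R, 0 <= M &
  forall (h : R) a S, 0 < h ->
    cmeasurable_fun (fun v : 'rV[R]_n * 'rV[R]_n => a v.1 v.2) ->
    (forall x i, symb i n.+1 japn k S (a x)) ->
    forall f, psch f -> cmeasurable_fun (Op h a f) /\
      (L2norm (Op h a f) <= (M * S)%:E * L2norm (Op h (fun=> japanese_pow k') f))%E.
Proof.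
move=> kk; have e0 : 0 < k' - k by rewrite subr_gt0.
have [C C0 HC] := multiplier_L2 n0 e0.
have [C1 HC1] := symb_jap n n.+1 (- k').
pose i0 := Ordinal n0.
have C1_ge0 : 0 <= C1.
  by apply: (symb_B_ge0 _ (HC1 1 i0 (lexx _))); exact: jap_gt0.
have pi2 : 0 < 2 * pi :> R by rewrite mulr_gt0// pi_gt0.
(* [2 ^ (n + 1) C1] is the cost of multiplying [a] by [<xi> ^ (- k')]. The factor [(h^-1) ^ (- n)]
   from [multiplier_L2] cancels the [h ^ (- n)] of the prefactor. *)
exists ((2 * pi) ^- n * (C * (2 ^+ n.+1 * C1))).
  by rewrite !mulr_ge0 ?invr_ge0 ?exprn_ge0 ?(ltW pi2).
move=> h a S h0 ma sa f pf.
have s0 : 0 < h^-1 by rewrite invr_gt0.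
have sn0 : h^-1 != 0 by rewrite gt_eqF.
pose g := Op h (fun=> japanese_pow k') f.
have pg : psch g by apply: schwartz_psch; exact: Op_jap_schwartz.
pose b x xi : R[i] := a x xi * japanese_pow (- k') xi.
have sb x i : symb i n.+1 japn (- (k' - k)) (2 ^+ n.+1 * (S * C1)) (b x).
  rewrite opprB; have := HC1 1 i (lexx _) => sj.
  exact: (@symbM _ _ _ _ _ _ _ _ _ _ _ (@japanese_gt0 R n) (sa x i) sj).
have S0 : 0 <= S by exact: symb_B_ge0 (japanese_gt0 0) (sa 0 i0).
have mJ : cmeasurable_fun (fun xi : 'rV[R]_n => japanese_pow (- k') xi : R[i]).
  by apply: cmeasurable_real; exact: measurable_japanese_powR.
have mb : cmeasurable_fun (fun v : 'rV[R]_n * 'rV[R]_n => b v.1 v.2).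
  by apply: cmeasurableM => //; exact: (cmeasurable_comp measurable_snd mJ).
have OpbE : Op h a f = (fun x => ((2 * pi * h) ^- n)%:C *
    FT (- h^-1) (fun xi => b x xi * FT h^-1 g xi) x).
  apply/funext => x; rewrite OpE; last exact: psch_cintegrable.
  congr (_ * FT _ _ x); apply/funext => xi.
  rewrite FT_Op_jap// /b -mulrA [X in _ = _ * X]mulrA -rmorphM -powRD.
    by rewrite addNr powRr0 mul1r.
  by rewrite (gt_eqF (japanese_gt0 _)) implybT.
have pFg : psch (FT h^-1 g) by exact: FT_psch.
have mT : cmeasurable_fun (fun x => FT (- h^-1) (fun xi => b x xi * FT h^-1 g xi) x).
  refine (@cmeasurable_FT_param _ _ (fun v => b v.1 v.2 * FT h^-1 g v.2) (- h^-1) _).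
  apply: cmeasurableM => //.
  exact: (cmeasurable_comp measurable_snd (psch_cmeasurable n0 pFg)).
rewrite OpbE; split; first by apply: cmeasurableM => //; exact: cmeasurable_cst.
rewrite L2normZ//.
have B0 : 0 <= 2 ^+ n.+1 * (S * C1) by rewrite !mulr_ge0 ?exprn_ge0.
have := HC b _ _ g s0 B0 mb sb (psch_cintegrable n0 pg) (psch_cintegrable n0 pFg).
have c0 : 0 <= (2 * pi * h) ^- n by rewrite invr_ge0 exprn_ge0// mulr_ge0 ?(ltW pi2) ?ltW.
move=> H; apply: (le_trans (lee_wpmul2l _ H)); first by rewrite lee_fin normc_ge0.
rewrite muleA -EFinM normcr ger0_norm// le_eqVlt; apply/orP; left; apply/eqP.
congr (_%:E * _)%E; rewrite !exprMn !exprVn invrK !invfM.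
have hn : h ^+ n != 0 by rewrite expf_neq0// gt_eqF.
have pn : pi ^+ n != 0 :> R by rewrite expf_neq0// gt_eqF// pi_gt0.
have tn : 2 ^+ n != 0 :> R by rewrite expf_neq0.
by field; rewrite hn pn tn.
Qed.

Variables (h k : R) (a : 'rV[R]_n -> 'rV[R]_n -> R[i]) (M : R).
Hypotheses (h0 : 0 < h) (M0 : 0 <= M) (sa : forall x, slow (a x)).
Local Notation Opk := (Op h (fun=> japanese_pow k)).
Hypothesis HM : forall f, psch f ->
  cmeasurable_fun (Op h a f) /\ (L2norm (Op h a f) <= M%:E * L2norm (Opk f))%E.

(** The bound on Schwartz functions is transferred to [w] through one sufficiently late [f_ j]. The
    infima defining the norms need not be attained, so near-optimal representatives are used. *)
Lemma Op_norm_le : (Op_norm h k a <= M%:E)%E.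
Proof.
apply: ge_ereal_sup => _ [w [u [[[tu su] [mw w2] [f_ [sf cu cw]]] u1]] <-].
apply/lee_addgt0Pr => e e0.
(* Chosen so that [M (2 D + 1) + D = M + e]. *)
pose D := e / (2 * M + 1).
have M1 : 0 < 2 * M + 1 by rewrite ltr_wpDl// mulr_ge0.
have D0 : 0 < D by rewrite divr_gt0.
have [G2 [i2 e2 n2]] : exists G, [/\ in_L2 G,
    eq_dist (Op_dist h (japanese_pow k) u) (regular_dist G) & (L2norm G < (1 + D)%:E)%E].
  by apply: dist_L2norm_lt; rewrite (le_lt_trans u1)// lte_fin ltrDl.
have A1 := cvge0_le (fun j => dist_L2norm_ge0 _) cu (divr_gt0 D0 (ltr0Sn _ 1)).
have A2 := cvge0_le (fun j => L2norm_ge0 _) cw D0.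
have [j [/= h1 h2]] := filter_ex (filterI A1 A2).
have [G1 [i1 e1 n1]] : exists G, [/\ in_L2 G,
    eq_dist (Op_dist h (japanese_pow k) (fun phi => regular_dist (f_ j) phi - u phi))
      (regular_dist G) & (L2norm G < D%:E)%E].
  by apply: dist_L2norm_lt; rewrite (le_lt_trans h1)// lte_fin ltr_pdivrMr// ltr_pMr// ltr1n.
have pf := schwartz_psch (sf j).
have [mO bO] := HM pf.
apply: (le_trans (L2normB mw mO)).
have gb : (L2norm (Opk (f_ j)) <= (D + (1 + D))%:E)%E.
  by rewrite (le_trans (L2norm_Op_jap_le n0 h0 (sf j) i1 i2 e1 e2))// EFinD leeD// ltW.
have -> : (M%:E + e%:E = (M * (D + (1 + D)))%:E + D%:E)%E.
  rewrite -!EFinD; congr (_%:E).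
  have -> : e = D * (2 * M + 1) by rewrite /D divfK// gt_eqF.
  by ring.
apply: leeD; last by rewrite L2normC.
apply: (le_trans bO); rewrite EFinM; apply: lee_wpmul2l gb.
by rewrite lee_fin.
Qed.

Lemma expr2V_cvg : (fun j : nat => 2 ^- j : R) @ \oo --> (0 : R).
Proof.
apply: (@squeeze_cvgr _ _ _ _ (cst 0) (fun j : nat => j.+1%:R^-1)).
- apply: nearW => j /=; rewrite invr_ge0 exprn_ge0//=.
  by rewrite lef_pV2 ?posrE ?exprn_gt0// -natrX ler_nat ltn_expl.
- exact: cvg_cst.
- exact: cvg_harmonic.
Qed.

(** [Op_h(<xi>^k) u] is some [G] in L^2. Schwartz functions [g_ j] within [2 ^ (- j)] of it are
    pulled back to [f_ j], and the images of these under [Op h a] form a fast Cauchy sequence. *)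
Lemma Op_sobolev_exists u : in_sobolev h k u -> exists w, Op_sobolev h k a u w.
Proof.
move=> hu; have [tu su] := hu; have [G [G2 eG _]] := dist_L2norm_lt su.
have [mG dG] := schwartz_dense n0 G2.
have p2 j : 0 < 2 ^- j :> R by rewrite invr_gt0 exprn_gt0.
have /choice[g_ Hg] : forall j : nat, exists phi, schwartz phi /\
    (L2norm (fun x => (G x - phi x)%R) <= (2 ^- j)%:E)%E.
  by move=> j; have [phi ? ?] := dG _ (p2 j); exists phi.
have pg j : psch (g_ j) by apply: schwartz_psch; case: (Hg j).
have [f_ [sf Opf]] : exists f_ : nat -> 'rV[R]_n -> R[i],
    (forall j, schwartz (f_ j)) /\ forall j, Opk (f_ j) = g_ j.
  exists (fun j => Op h (fun=> japanese_pow (- k)) (g_ j)); split=> j.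
    exact: Op_jap_schwartz.
  by have := Op_japK n0 h0 (- k) (pg j); rewrite opprK.
have pf j : psch (f_ j) by exact: schwartz_psch.
have g2 j : in_L2 (g_ j) by exact: psch_in_L2.
have w2 j : in_L2 (Op h a (f_ j)).
  have [mO bO] := HM (pf j); split=> //; apply: (le_lt_trans bO).
  by rewrite Opf lte_mul_pinfty// ?lee_fin//; case: (g2 j).
(* Both [g_ j] and [g_ (j + 1)] are within [2 ^ (- j)] of [G], whence the factor 2. *)
have wM j : (L2norm (fun x => (Op h a (f_ j.+1) x - Op h a (f_ j) x)%R) <= (2 * M * 2 ^- j)%:E)%E.
  have pd : psch (fun x => f_ j.+1 x - f_ j x) by apply: schwartz_psch; exact: schwartzB.
  have -> : (fun x => Op h a (f_ j.+1) x - Op h a (f_ j) x) = Op h a (fun x => f_ j.+1 x - f_ j x).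
    by apply/funext => x; rewrite OpB.
  have [_ bO] := HM pd; apply: (le_trans bO).
  have -> : Opk (fun x => f_ j.+1 x - f_ j x) = (fun x => g_ j.+1 x - g_ j x).
    have sJ : slow (japanese_pow k : 'rV[R]_n -> R[i]) := pslow_jap k (Ordinal n0) 0%N.
    apply/funext => x.
    apply: etrans (@OpB h (fun=> japanese_pow k) _ _ x h0 sJ (pf j.+1) (pf j)) _.
    by rewrite (Opf j.+1) (Opf j).
  rewrite -mulrA mulrCA EFinM; apply: lee_wpmul2l; first by rewrite lee_fin.
  apply: (le_trans (L2normB_trans (g2 j.+1).1 mG (g2 j).1)).
  have -> : 2 * 2 ^- j = 2 ^- j + 2 ^- j :> R by rewrite mulr_natl mulr2n.
  rewrite EFinD; apply: leeD; last by case: (Hg j).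
  rewrite L2normC; case: (Hg j.+1) => _ H; apply: (le_trans H).
  by rewrite lee_fin lef_pV2 ?posrE ?exprn_gt0// ler_eXn2l// ltr1n.
have [w wL2 cw] := riesz_fischer w2 wM.
exists w; split=> //; exists f_; split=> //.
apply/cvge0P => [j|e e0]; first exact: dist_L2norm_ge0.
have := expr2V_cvg; move=> /cvgrPdist_le/(_ e e0).
apply: filterS => j; rewrite sub0r normrN ger0_norm ?(ltW (p2 j))// => je.
have e1 : eq_dist (Op_dist h (japanese_pow k) (fun phi => regular_dist (f_ j) phi - u phi))
    (regular_dist (fun x => g_ j x - G x)).
  move=> phi sphi; rewrite regular_distB// -eG// -[in RHS]Opf -(Op_dist_regular n0 _ h0)//.
apply: (le_trans (dist_L2norm_le (in_L2B (g2 j) G2) e1)).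
by rewrite L2normC; case: (Hg j) => _ H; rewrite (le_trans H)// lee_fin.
Qed.

End Op_bound.

(** A pure derivative of order [m <= d] meets a single constant of the sum, and the others can be
    added because the estimates force every [C alpha] to be nonnegative. *)
Lemma mpartial_symb (R : realType) (d : nat) (k : R) (f : 'rV[R]_d.-1 -> R[i])
    (C : {ffun 'I_d.-1 -> nat} -> R) i : smooth f ->
  (forall alpha xi, normc (mpartial alpha f xi)
     <= C alpha * japanese xi `^ (k - (mlength alpha)%:R)) ->
  symb i d (@japanese R d.-1) k
    (\sum_(alpha : {ffun 'I_d.-1 -> 'I_d.+1} | (\sum_i alpha i <= d)%N)
       C [ffun i => nat_of_ord (alpha i)]) f.
Proof.
move=> sf Hf m md; split=> x; first exact: smooth_iter.
rewrite -mpartial_single.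
set al := [ffun j => _].
have lal : mlength al = m.
  rewrite /mlength (bigD1 i)//= ffunE eqxx big1 ?addn0// => j ji.
  by rewrite ffunE (negbTE ji).
have := Hf al x; rewrite lal => /le_trans; apply; rewrite ler_wpM2r ?powR_ge0//.
have C0 alpha : 0 <= C alpha.
  have := le_trans (normc_ge0 _) (Hf alpha 0).
  by rewrite pmulr_lge0// powR_gt0// japanese_gt0.
(* The multi-index [al] in the finite type indexing the sum: its entries are at most [m <= d], so
   [inord] loses nothing. *)
pose be : {ffun 'I_d.-1 -> 'I_d.+1} := [ffun j => inord (al j)].
have beE j : be j = al j :> nat.
  by rewrite !ffunE inordK//; case: ifP; rewrite // ltnS.
rewrite (bigD1 be)/=; last first.
  by rewrite (eq_bigr (fun j => al j)) => [|j _]; rewrite ?beE// -/(mlength al) lal.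
rewrite (_ : [ffun i => _] = al); last by apply/ffunP => j; rewrite ffunE beE.
by rewrite lerDl; apply: sumr_ge0.
Qed.

Theorem proposition2p3 (R : realType) (d : nat) (k k' : R) :
  (2 <= d)%N -> k < k' ->
  exists2 K : R, 0 < K &
  forall (h : R) (a : 'rV[R]_d.-1 -> 'rV[R]_d.-1 -> R[i])
         (C : {ffun 'I_d.-1 -> nat} -> R),
    0 < h <= 1 ->
    cmeasurable_fun (fun z : 'rV[R]_d.-1 * 'rV[R]_d.-1 => a z.1 z.2) ->
    (forall x, smooth (a x)) ->
    (forall alpha x xi, normc (mpartial alpha (a x) xi)
       <= C alpha * japanese xi `^ (k - (mlength alpha)%:R)) ->
    (forall u, in_sobolev h k' u -> exists w, Op_sobolev h k' a u w) /\
    (Op_norm h k' a <=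
      (K * (ln (1 + h^-1) *
        \sum_(alpha : {ffun 'I_d.-1 -> 'I_d.+1}
               | (\sum_i alpha i <= d)%N)
          C [ffun i => nat_of_ord (alpha i)]))%:E)%E.
Proof.
move=> d2 kk; have n0 : (0 < d.-1)%N by rewrite -ltnS prednK// ltnW.
have [M M0 HM] := Op_L2_bound n0 kk.
have l2 : 0 < ln 2 :> R by rewrite ln_gt0// ltr1n.
(* For [h <= 1], [ln 2 <= ln (1 + h^-1)] turns the uniform bound into the logarithmic one; the
   summand 1 keeps the constant positive when [M = 0]. *)
exists (M / ln 2 + 1); first by rewrite ltr_wpDl// divr_ge0// ltW.
move=> h a C /andP[h0 h1] ma sa Ha.
set S := \sum_(alpha | _) _.
(* With [d = n + 1], the orders up to [d] in the sum match the [n + 1] integrations by parts of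
   [kernel_bound]. *)
have sab x i : symb i d.-1.+1 (@japanese R d.-1) k S (a x).
  by rewrite prednK; [exact: mpartial_symb|exact: ltnW].
pose i0 := Ordinal n0.
have S0 : 0 <= S by exact: symb_B_ge0 (japanese_gt0 0) (sab 0 i0).
have slow_a x : slow (a x) by exact: symb_slow0 (sab x i0).
have MS0 : 0 <= M * S by exact: mulr_ge0.
have HMS := HM h a S h0 ma sab.
split; first exact: (Op_sobolev_exists n0 h0 MS0 slow_a HMS).
apply: (le_trans (Op_norm_le n0 h0 MS0 HMS)).
rewrite lee_fin mulrA ler_wpM2r// mulrDl mul1r.
have l2h : ln 2 <= ln (1 + h^-1).
  by rewrite ler_ln ?posrE// ?ltr_wpDr// ?invr_ge0 ?(ltW h0)// lerD2l invf_ge1.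
rewrite ler_wpDr ?(le_trans (ltW l2))// -mulrA ler_peMr// mulrC.
by rewrite ler_pdivlMr// mul1r.
Qed.
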